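(* Let $n\ge 5$, let $\lambda\vdash n$ be a partition, let $V=S^\lambda$ be the corresponding irreducible complex Specht module of $S_n$, let $d\ge 3$, and let $0\ne f\in\operatorname{Sym}^d(V^* )$ be such that $J(f)$ is $S_n$-invariant. (i) If $\lambda\ne\lambda'$, then $\sigma\cdot f=\chi(\sigma)f$ for all $\sigma\in S_n$, for some $\chi\in\{1,\operatorname{sgn}\}$, and as $S_n$-modules $$J(f)\cong\chi\otimes S^\lambda\cong\begin{cases}S^{\lambda}&\text{if }\chi=1,\\ S^{\lambda'}&\text{if }\chi=\operatorname{sgn},\end{cases}$$ and moreover $\{h\in\operatorname{Sym}^d(V^* ):J(h)=J(f)\}=\mathbb C^\times f$. (ii) Suppose $\lambda=\lambda'$ and the canonical decomposition of $f$ is the two-block decomposition $\operatorname{Res}^{S_n}_{A_n}S^\lambda=W_\lambda^+\oplus W_\lambda^-$. Let $e_+,e_-$ be the corresponding primitive idempotents of $Z(f)$, put $p=f_{e_+}$, fix a transposition $\tau\in S_n$, and put $q=\tau\cdot p$. Then, as $S_n$-modules, $J(f)\cong S^\lambda$, and $$\{h\in\operatorname{Sym}^d(V^* ):J(h)=J(f)\}=\{ap+bq: a,b\in\mathbb C^\times\}.$$ Moreover, this set contains the $S_n$-invariant form $p+q$ and the sign-relative invariant form $p-q$ (i.e. $\sigma\cdot(p-q)=\operatorname{sgn}(\sigma)(p-q)$ for all $\sigma\in S_n$).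
   Context: $\lambda'$ denotes the conjugate partition of $\lambda$. When $\lambda=\lambda'$ (and $n\ge5$), the restriction of $S^\lambda$ to $A_n$ is a direct sum $W_\lambda^+\oplus W_\lambda^-$ of two nonisomorphic irreducible $A_n$-modules, which are interchanged by every odd permutation. A group $G$ acting linearly on $V$ acts on forms by $(g\cdot h)(x)=h(g^{-1}x)$. For $v\in V$, $D_v$ is directional differentiation, and $J(f)=\langle D_vf:v\in V\rangle\subseteq\operatorname{Sym}^{d-1}(V^* )$ is the Jacobian of $f$; it is $G$-invariant if $g\cdot J(f)=J(f)$ for all $g\in G$. For $f\in\operatorname{Sym}^d(V^* )$, $\Theta_f:V^d\to\mathbb C$ is its polarization, the unique symmetric $d$-linear form with $\Theta_f(v,\dots,v)=f(v)$. The form $f$ is nondegenerate if $D_vf=0$ implies $v=0$. The center of $f$ is $$Z(f)=\{X\in\operatorname{End}(V):\Theta_f(Xv_1,v_2,v_3,\dots,v_d)=\Theta_f(v_1,Xv_2,v_3,\dots,v_d)\ \text{for all } v_i\in V\}.$$ For nondegenerate $f$ with $d\ge3$ it is a finite-dimensional commutative $\mathbb C$-algebra (Harrison). When $V$ is irreducible, $f\ne0$ and $J(f)$ is invariant, $f$ is nondegenerate. For $z\in Z(f)$, $f_z$ is the form with polarization $\Theta_{f_z}(v_1,\dots,v_d)=\Theta_f(zv_1,v_2,\dots,v_d)$. If $e_1,\dots,e_r$ are the primitive idempotents of $Z(f)$, the canonical decomposition of $f$ is $V=V_1\oplus\cdots\oplus V_r$, $V_i=e_iV$, $f=f_{e_1}+\cdots+f_{e_r}$,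 where $f_{e_i}$ is the restriction of $f$ to $V_i$ regarded as a form on $V$ via the projection $e_i$. *)

(* Defs.v *)
From HB Require Import structures.
From mathcomp Require Import all_boot all_order all_algebra all_fingroup.
From mathcomp Require Import all_solvable mxrepresentation.
From mathcomp Require Import mpoly complex reals.

Set Implicit Arguments.
Unset Strict Implicit.
Unset Printing Implicit Defensive.

Import GRing.Theory Num.Theory.
Local Open Scope ring_scope.

(* A module V for S_n over C is given by a matrix representation                *)
(* rG : mx_representation C [set: 'S_n] m; its underlying space is 'rV[C]_m and *)
(* s sends v to v *m rG s.  In MathComp (s * t) x = t (s x) on permutations, so *)
(* this right action is a left action of S_n with the usual composition.        *)
(* Linear endomorphisms of V are matrices acting on the right of row vectors.   *)
(* Sym^d(V^* ) is the set of d-homogeneous elements of {mpoly C[m]}.            *)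

Section Forms.

Context {C : numFieldType} {m : nat}.
Implicit Types (f g h : {mpoly C[m]}) (u v : 'rV[C]_m) (s : seq 'rV[C]_m).

Definition dirder v f : {mpoly C[m]} := \sum_(i < m) v 0 i *: f^`M(i).

(* v |-> dirder v f is linear (dirder_linl), so its image is its own span. *)
Definition jacobian f : {mpoly C[m]} -> Prop :=
  fun g => exists v, g = dirder v f.

Definition same_space (A B : {mpoly C[m]} -> Prop) : Prop :=
  forall g, A g <-> B g.

Definition lin_subst (A : 'M[C]_m) f : {mpoly C[m]} :=
  f \mPo [tuple \sum_(k < m) A k i *: 'X_k | i < m].

Lemma lin_substE A f v : (lin_subst A f).@[v 0] = f.@[(v *m A) 0].
Proof.
rewrite comp_mpoly_meval; apply: meval_eq => i; rewrite tnth_mktuple mxE.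
rewrite raddf_sum; apply: eq_bigr => k _ /=.
by rewrite mevalZ mevalXU mulrC.
Qed.

Lemma dirder_linl f a u v :
  dirder (a *: u + v) f = a *: dirder u f + dirder v f.
Proof.
rewrite /dirder scaler_sumr -big_split; apply: eq_bigr => i _ /=.
by rewrite !mxE scalerDl scalerA.
Qed.

Lemma dirder_linr v a f g :
  dirder v (a *: f + g) = a *: dirder v f + dirder v g.
Proof.
rewrite /dirder scaler_sumr -big_split; apply: eq_bigr => i _ /=.
by rewrite mderivD mderivZ scalerDr !scalerA mulrC.
Qed.

Lemma dirder0 v : dirder v 0 = 0.
Proof. by rewrite /dirder big1 // => i _; rewrite mderiv0 scaler0. Qed.

Lemma dirderC u v f : dirder u (dirder v f) = dirder v (dirder u f).
Proof.
have E (x y : 'rV[C]_m) : dirder x (dirder y f) =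
    \sum_(i < m) \sum_(j < m) (x 0 i * y 0 j) *: (f^`M(j))^`M(i).
  rewrite /dirder; apply: eq_bigr => i _.
  rewrite (raddf_sum (mderiv i)) /= scaler_sumr; apply: eq_bigr => j _ /=.
  by rewrite mderivZ scalerA.
rewrite !E exchange_big; apply: eq_bigr => i _; apply: eq_bigr => j _ /=.
by rewrite mderiv_comm mulrC.
Qed.

Lemma dirder_homog d v f : f \is d.-homog -> dirder v f \is d.-1.-homog.
Proof.
move=> hf; apply: rpred_sum => i _; apply: rpredZ.
apply/dhomogP => k; rewrite mcoeff_msupp mcoeff_deriv => nz.
have : f@_(k + U_(i)) != 0 by apply: contraNneq nz => ->; rewrite mul0rn.
rewrite -mcoeff_msupp => /(dhomog_mf hf) /=.
by rewrite mdegD mdeg1 addn1 => <-.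
Qed.

Lemma dirder_euler d v f :
  f \is d.-homog -> (dirder v f).@[v 0] = d%:R * f.@[v 0].
Proof.
move=> hf; rewrite [in RHS]mevalE.
have -> : dirder v f = \sum_(k <- msupp f) f@_k *: dirder v 'X_[k].
  rewrite {1}(mpolyE f); elim: (msupp f) => [|k l IH].
    by rewrite !big_nil dirder0.
  by rewrite !big_cons dirder_linr IH.
rewrite raddf_sum /= mulr_sumr.
apply: eq_big_seq => k kf; rewrite mevalZ mulrCA; congr (_ * _).
rewrite -(dhomog_mf hf kf) /dirder raddf_sum /= mdegE natr_sum mulr_suml.
apply: eq_bigr => i _; rewrite mevalZ mderivX mevalZ mevalX mulrCA.
have [->|kn0] := posnP (k i); first by rewrite !mul0r.
congr (_ * _); rewrite [RHS](bigD1 i) // [X in _ * X = _](bigD1 i) //= mulrA.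
congr (_ * _).
  by rewrite mnmBE mnm1E eqxx subn1 -exprS prednK.
by apply: eq_bigr => j ji; rewrite mnmBE mnm1E eq_sym (negPf ji) subn0.
Qed.

(* The polarization is represented as a function of lists of d vectors; for     *)
(* lists of any other length its value is irrelevant.  Symmetry makes linearity *)
(* in the first argument equivalent to d-linearity.                             *)
Record is_polarization d f (T : seq 'rV[C]_m -> C) : Prop := IsPolarization {
  pol_sym : forall s t, size s = d -> perm_eq s t -> T s = T t;
  pol_lin : forall a u v s, (size s).+1 = d ->
    T (a *: u + v :: s) = a * T (u :: s) + T (v :: s);
  pol_diag : forall v, T (nseq d v) = f.@[v 0]
}.

(* Theta_f(v_1, ..., v_d) = (1 / d!) D_(v_1) ... D_(v_d) f; see polarP and      *)
(* polar_unique for the defining property.                                      *)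
Definition polar d f s : C := (d`!%:R)^-1 * (foldr dirder f s)@_0%MM.

Lemma homog0_const f : f \is 0.-homog -> f = (f@_0%MM)%:MP.
Proof.
move=> hf; apply/mpolyP => k; rewrite mcoeffC.
have [<-|k0] := eqVneq 0%MM k; first by rewrite mulr1.
by rewrite mulr0 (dhomog_nemf_coeff hf) // mdeg_eq0 eq_sym.
Qed.

Lemma foldr_dirder_nseq d v f :
  f \is d.-homog -> (foldr dirder f (nseq d v))@_0%MM = d`!%:R * f.@[v 0].
Proof.
elim: d f => [|d IH] f hf.
  by rewrite {2}(homog0_const hf) mevalC mul1r.
have -> : foldr dirder f (nseq d.+1 v) = foldr dirder (dirder v f) (nseq d v).
  have -> : nseq d.+1 v = nseq d v ++ [:: v] by elim: (d) => //= k <-.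
  by rewrite foldr_cat.
by rewrite (IH _ (dirder_homog v hf)) (dirder_euler v hf) mulrA -natrM mulnC factS.
Qed.

Lemma polarP d f : f \is d.-homog -> is_polarization d f (polar d f).
Proof.
move=> hf; split=> [s t _ st|a u v s _|v]; rewrite /polar.
- congr (_ * _@__); apply/catCA_perm_subst: s t st => s1 s2 s3.
  rewrite !foldr_cat; elim: s1 => [|x s1 /= ->] //=.
  by elim: s2 => [|y s2 /= <-] //=; rewrite dirderC.
- by rewrite /= dirder_linl mcoeffD mcoeffZ mulrDr mulrCA.
- by rewrite foldr_dirder_nseq // mulKf // pnatr_eq0 -lt0n fact_gt0.
Qed.

Let poly_inf0 (p : {poly C}) : (forall t, p.[t] = 0) -> p = 0.
Proof.
move=> hp; apply/eqP/negPn/negP => p0.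
pose r : seq C := [seq i%:R | i <- iota 0 (size p)].
have : (size r < size p)%N.
  apply: max_poly_roots => //; first by apply/allP => x _; rewrite /root hp.
  by rewrite map_inj_uniq ?iota_uniq //; apply: (mulrIn (oner_neq0 C)).
by rewrite size_map size_iota ltnn.
Qed.

Lemma polar_unique d f T : f \is d.-homog -> is_polarization d f T ->
  forall s, size s = d -> T s = polar d f s.
Proof.
move=> /polarP [sP lP dP] [sT lT dT].
pose S s := T s - polar d f s.
have sS s t : size s = d -> perm_eq s t -> S s = S t.
  by move=> hs st; rewrite /S (sT s t) // (sP s t).
have lS a u v s : (size s).+1 = d -> S (a *: u + v :: s) = a * S (u :: s) + S (v :: s).
  by move=> hs; rewrite /S lT // lP // mulrBr opprD addrACA.
have expand u v r s : (r + size s)%N = d -> exists p : {poly C},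
    [/\ forall t, p.[t] = S (nseq r (t *: u + v) ++ s),
        p`_0 = S (nseq r v ++ s) &
        p`_1 = r%:R * S (u :: nseq r.-1 v ++ s)].
  elim: r s => [|r IH] s hs.
    exists (S s)%:P; split; last by rewrite coefC mul0r.
      by move=> t; rewrite hornerC.
    by rewrite coefC.
  have [p [p1 p2 p3]] := IH (u :: s) (etrans (addnS r (size s)) hs).
  have [q [q1 q2 q3]] := IH (v :: s) (etrans (addnS r (size s)) hs).
  have mid x y l : (r + (size l).+1)%N = d ->
      S (x :: nseq r y ++ l) = S (nseq r y ++ x :: l).
    move=> hl; apply: sS; first by rewrite /= size_cat size_nseq -addnS.
    by rewrite -cat1s perm_catCA.
  have hs' : (r + (size s).+1)%N = d by rewrite addnS -addSn.
  exists (p * 'X + q); split.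
  - move=> t; rewrite hornerD hornerMX p1 q1 /=.
    by rewrite lS ?size_cat ?size_nseq ?mid // mulrC.
  - by rewrite coefD coefMX add0r q2 -mid.
  - rewrite coefD coefMX /= p2 q3 -mid //; case: r {IH p1 p2 p3 q1 q2 q3} mid hs hs' => [|r] mid hs hs'.
      by rewrite mul0r addr0 mul1r.
    rewrite [in RHS]mulrSr mulrDl mul1r addrC; congr (_ * _ + _).
    apply: sS; first by rewrite /= size_cat size_nseq -hs' addSn.
    by rewrite /= perm_cons -cat1s perm_catCA.
have van k : forall s v, (k <= d)%N -> size s = k -> S (nseq (d - k) v ++ s) = 0.
  elim: k => [|k IH] s v kd.
    move/size0nil=> ->; rewrite cats0 subn0 /S dT dP subrr //.
  case: s => // u s [hs]; have r0 : (0 < d - k)%N by rewrite subn_gt0.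
  have [|p [p1 _ p3]] := expand u v (d - k)%N s; first by rewrite hs subnK // ltnW.
  have p0 : p = 0 by apply: poly_inf0 => t; rewrite p1 IH // ltnW.
  move/esym/eqP: p3; rewrite p0 coef0 mulf_eq0 pnatr_eq0 -leqn0 leqNgt r0 /=.
  rewrite -subnS => /eqP <-; apply: sS.
    by rewrite size_cat size_nseq /= hs subnK.
  by rewrite -cat1s perm_catCA.
move=> s hs; apply/eqP; rewrite -subr_eq0; apply/eqP.
by have := van d s 0 (leqnn d) hs; rewrite subnn.
Qed.

Definition form_center d f (X : 'M[C]_m) : Prop :=
  forall u v s, (size s).+2 = d ->
    polar d f (u *m X :: v :: s) = polar d f (u :: v *m X :: s).

(* p is the form f_z. *)
Definition is_twist d f (z : 'M[C]_m) p : Prop :=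
  p \is d.-homog /\
  forall v s, (size s).+1 = d -> polar d p (v :: s) = polar d f (v *m z :: s).

Definition primitive_idempotent (Z : 'M[C]_m -> Prop) (e : 'M[C]_m) : Prop :=
  [/\ Z e, e *m e = e, e != 0 &
      forall a b, Z a -> Z b -> a *m a = a -> b *m b = b ->
        a *m b = 0 -> b *m a = 0 -> e = a + b -> a = 0 \/ b = 0].

(* es lists the primitive idempotents of Z(f); the blocks of the canonical      *)
(* decomposition are then the row spaces of the members of es.                  *)
Definition canonical_idempotents d f (es : seq 'M[C]_m) : Prop :=
  uniq es /\
  forall e, primitive_idempotent (form_center d f) e <-> e \in es.

Lemma twist_exists d f z :
  f \is d.-homog -> (2 <= d)%N -> form_center d f z -> exists p, is_twist d f z p.
Proof.
move=> hf d2 hz.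
have [sP lP dP] := polarP hf.
pose l i : {mpoly C[m]} := \sum_(k < m) z k i *: 'X_k.
pose p := d%:R^-1 *: \sum_i l i * f^`M(i).
have hp : p \is d.-homog.
  apply: rpredZ; apply: rpred_sum => i _.
  suff: l i * f^`M(i) \is (1 + d.-1).-homog by rewrite add1n prednK // ltnW.
  apply: dhomogM.
    by apply: rpred_sum => k _; apply: rpredZ; rewrite dhomogX /= mdeg1.
  have -> : f^`M(i) = dirder (delta_mx 0 i) f.
    rewrite /dirder (bigD1 i) //= big1 ?addr0 ?mxE ?eqxx ?scale1r // => j ji.
    by rewrite mxE (negPf ji) andbF scale0r.
  exact: dirder_homog.
exists p; split=> // v s hs.
pose T s := if s is v :: s then polar d f (v *m z :: s) else 0.
suff hT : is_polarization d p T by rewrite -(polar_unique hp hT).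
split=> {v s hs} [s t hs st|a u v s hs|v].
- pose F s := if size s == d then T s else 0.
  suff : F s = F t by rewrite /F -(perm_size st) hs eqxx.
  clear hs; apply/catCA_perm_subst: s t st => s1 s2 s3.
  rewrite /F !size_cat addnCA; case: eqP => // hs.
  case: s1 hs => [|v s1] //; case: s2 => [|w s2] //= hs.
  have hs' : (size (s1 ++ s2 ++ s3)).+2 = d.
    by rewrite !size_cat -hs !(addnS, addSn) addnCA.
  have mid x y l1 l2 : (size (l1 ++ l2)).+2 = d ->
      polar d f (x :: l1 ++ y :: l2) = polar d f (x :: y :: l1 ++ l2).
    move=> hl; apply: sP; first by rewrite /= size_cat /= addnS -size_cat.
    by rewrite perm_cons -cat1s perm_catCA.
  rewrite mid // hz // [RHS]mid.
    apply: sP; first by [].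
    rewrite (perm_catCA [:: v] [:: w *m z] (s1 ++ s2 ++ s3)) /= !perm_cons.
    by rewrite perm_catCA.
  by rewrite -hs' !size_cat addnCA.
- by rewrite /T mulmxDl -scalemxAl lP.
rewrite -[d in nseq d]prednK ?(ltnW d2) //= /p.
rewrite mevalZ raddf_sum /=.
have -> : \sum_i (l i * f^`M(i)).@[v 0] = (dirder (v *m z) f).@[v 0].
  rewrite /dirder raddf_sum; apply: eq_bigr => i _ /=.
  rewrite mevalM mevalZ; congr (_ * _).
  rewrite mxE raddf_sum; apply: eq_bigr => k _ /=.
  by rewrite mevalZ mevalXU mulrC.
have hd := dirder_homog (v *m z) hf.
have -> : polar d f (v *m z :: nseq d.-1 v) = polar d f (nseq d.-1 v ++ [:: v *m z]).
  apply: sP; first by rewrite /= size_nseq prednK // ltnW.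
  by rewrite -cat1s perm_catC.
rewrite /polar foldr_cat /= (foldr_dirder_nseq v hd).
rewrite -[d in d`!](prednK (ltnW d2)) factS prednK ?(ltnW d2) // natrM invfM -mulrA.
by rewrite mulKf // pnatr_eq0 -lt0n fact_gt0.
Qed.

(* The forms of degree d with the same Jacobian as f. *)
Definition same_jacobian d f h : Prop :=
  h \is d.-homog /\ same_space (jacobian h) (jacobian f).

End Forms.

Section Action.

Context {C : numFieldType} {n m : nat}.
Variable rG : mx_representation C [set: 'S_n] m.
Implicit Types (f g h : {mpoly C[m]}) (s : 'S_n).

Definition form_act s h : {mpoly C[m]} := lin_subst (rG s^-1%g) h.

Definition jacobian_invariant f : Prop :=
  forall s, same_space (jacobian f)
              (fun h => exists2 g, jacobian f g & h = form_act s g).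

(* As an S_n-module, J(f) is isomorphic to r. *)
Definition jacobian_iso f k (r : mx_representation C [set: 'S_n] k) : Prop :=
  exists phi : {linear 'rV[C]_k -> {mpoly C[m]}},
    [/\ injective phi,
        forall g, jacobian f g <-> exists v, g = phi v &
        forall s v, phi (v *m r s) = form_act s (phi v)].

(* Wp and Wm are the two summands of the restriction of rG to A_n. *)
Definition alternating_split (Wp Wm : 'M[C]_m) : Prop :=
  let rA := subg_repr rG (subsetT ('Alt_('I_n))%g) in
  [/\ mxsimple rA Wp, mxsimple rA Wm, ~ mx_iso rA Wp Wm,
      (Wp + Wm :=: 1%:M)%MS & (Wp :&: Wm = 0)%MS].

(* The character 1 (b = false) or sgn (b = true) of S_n. *)
Definition pm_char (b : bool) s : C := (-1) ^+ (b && odd_perm s).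

Lemma pm_char_mx_repr b :
  mx_repr [set: 'S_n] (fun s => pm_char b s *: rG s).
Proof.
split=> [|s t _ _]; first by rewrite /pm_char odd_perm1 andbF scale1r repr_mx1.
rewrite repr_mxM ?inE // -scalemxAl -scalemxAr scalerA; congr (_ *: _).
by rewrite /pm_char odd_permM -signr_addb; case: b.
Qed.

Definition pm_tensor b := MxRepresentation (pm_char_mx_repr b).

End Action.

Definition is_partition (n : nat) (la : seq nat) : bool :=
  [&& sorted geq la, all (leq 1) la & sumn la == n].

Definition conj_partition (la : seq nat) : seq nat :=
  [seq count (fun r => j < r)%N la | j <- iota 0 (head 0%N la)].

Section Specht.

Variables (C : numFieldType) (n : nat) (la : seq nat).

(* Cells (row, column), numbered from 0; for a partition of n both are below n. *)
Definition diagram : {set 'I_n * 'I_n} :=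
  [set c : 'I_n * 'I_n | (c.2 < nth 0 la c.1)%N].

(* t x is the cell of the tableau t that contains the entry x. *)
Definition is_tableau (t : {ffun 'I_n -> 'I_n * 'I_n}) : bool :=
  injectiveb t && ([set t x | x : 'I_n] == diagram).

Definition relabel (T : Type) (w : {ffun 'I_n -> T}) (s : 'S_n) :=
  [ffun x => w (s^-1%g x)].

(* A tabloid is given by the row of each entry.  The permutation module M^la on *)
(* tabloids of shape la is a direct summand of the permutation module on all    *)
(* functions 'I_n -> 'I_n used here.                                            *)
Definition tabloid (t : {ffun 'I_n -> 'I_n * 'I_n}) : {ffun 'I_n -> 'I_n} :=
  [ffun x => (t x).1].

Local Notation word := {ffun 'I_n -> 'I_n}.

Definition word_mx (s : 'S_n) : 'M[C]_#|word| :=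
  \matrix_(i, j) (enum_val j == relabel (enum_val i) s)%:R.

Definition word_vec (w : word) : 'rV[C]_#|word| := delta_mx 0 (enum_rank w).

Lemma relabelM (T : Type) (w : {ffun 'I_n -> T}) s t :
  relabel (relabel w s) t = relabel w (s * t)%g.
Proof. by apply/ffunP => x; rewrite !ffunE invMg permM. Qed.

Lemma word_vec_mx w s : word_vec w *m word_mx s = word_vec (relabel w s).
Proof.
rewrite /word_vec -rowE; apply/rowP => j; rewrite !mxE enum_rankK eqxx /=.
by rewrite -(inj_eq enum_val_inj) enum_rankK.
Qed.

Lemma word_mx_repr : mx_repr [set: 'S_n] word_mx.
Proof.
have E (A B : 'M[C]_#|word|) :
    (forall w, word_vec w *m A = word_vec w *m B) -> A = B.
  move=> AB; apply/row_matrixP => i; rewrite !rowE -(enum_valK i); exact: AB.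
split=> [|s t _ _]; apply: E => w.
  rewrite word_vec_mx mulmx1; congr word_vec.
  by apply/ffunP => x; rewrite ffunE invg1 perm1.
by rewrite mulmxA !word_vec_mx relabelM.
Qed.

Definition word_repr := MxRepresentation word_mx_repr.

Definition column_stab (t : {ffun 'I_n -> 'I_n * 'I_n}) : {set 'S_n} :=
  [set q : 'S_n | [forall x, (t (q x)).2 == (t x).2]].

Definition polytabloid (t : {ffun 'I_n -> 'I_n * 'I_n}) : 'rV[C]_#|word| :=
  \sum_(q in column_stab t) (-1) ^+ q *: word_vec (tabloid (relabel t q)).

Definition specht_mx : 'M[C]_#|word| :=
  (\sum_(t | is_tableau t) <<polytabloid t>>)%MS.

Lemma is_tableau_relabel t s : is_tableau t -> is_tableau (relabel t s).
Proof.
case/andP=> /injectiveP ti /eqP td; apply/andP; split.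
  by apply/injectiveP => x y; rewrite !ffunE => /ti /perm_inj.
apply/eqP; rewrite -td; apply/setP => c.
apply/imsetP/imsetP => [[x _ ->]|[x _ ->]].
  by exists (s^-1%g x); rewrite ?ffunE.
by exists (s x); rewrite ?ffunE ?permK.
Qed.

Lemma polytabloid_act t s :
  polytabloid t *m word_mx s = polytabloid (relabel t s).
Proof.
rewrite /polytabloid mulmx_suml.
rewrite [RHS](reindex_inj (conjg_inj s)) /=.
apply: eq_big => [q|q _].
  rewrite !inE; apply/forallP/forallP => H x.
    rewrite -(permKV s x) permJ !ffunE !permK; exact: H.
  by have := H (s x); rewrite permJ !ffunE !permK.
rewrite -scalemxAl word_vec_mx odd_permJ; congr (_ *: word_vec _).
have -> : relabel (tabloid (relabel t q)) s = tabloid (relabel (relabel t q) s).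
  by apply/ffunP => x; rewrite !ffunE.
by rewrite !relabelM conjgC.
Qed.

Lemma specht_mxmodule : mxmodule word_repr specht_mx.
Proof.
apply/mxmoduleP => s _ /=; rewrite /specht_mx sumsmxMr; apply/sumsmx_subP => t ht.
apply: submx_trans (sumsmx_sup _ (is_tableau_relabel s ht) (submx_refl _)).
by rewrite (eqmxMr _ (genmxE _)) genmxE polytabloid_act.
Qed.

Definition specht_dim : nat := \rank specht_mx.

Definition specht_repr : mx_representation C [set: 'S_n] specht_dim :=
  submod_repr specht_mxmodule.

End Specht.

(* Main.v *)
(* If J(f) is invariant, each s in S_n gives an invertible X_s in Z(f) with
   D_v (s f) = D_(v X_s) f, so S_n normalizes the commutative algebra Z(f).  Its joint
   eigenspaces form a system of imprimitivity of the irreducible module V.  Everything thus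
   rests on the fact that for n > 4 such a system with more than one block forces la = la'.

   Let H stabilize a block W.  A class sum acts on V by a scalar, so for x outside H the
   elements of the class of x that lie in the coset of x sum to zero on W.  For transpositions this
   partitions the edges of K_n according to the image of W: a class outside H with two
   adjacent edges forces H = A_n and V isomorphic to its sign twist; otherwise these
   classes are matchings, none of size 1 or 3, and the partition is preserved by the
   products of two edges of one class.  The sums over 3-cycles exclude
   transpositions in H, and then a class with at least four edges forces n = 8 (the
   parallel classes of AG(3,2)) and classes of size two force n = 5 (five pairs of edges
   on five points).  In both cases the sum of all transpositions vanishes on V, hence
   so does the content sum of la, and for n = 5, 8 this implies la = la'.

   In the two-block case Z(f) is spanned by the two idempotents, which are exchanged by odd
   permutations; A_n being perfect, it fixes p and q. *)
Require Import Defs.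
From HB Require Import structures.
From mathcomp Require Import all_boot all_order all_algebra all_fingroup.
From mathcomp Require Import all_solvable mxrepresentation.
From mathcomp Require Import mpoly complex reals.
From mathcomp Require Import spectral boolp.

Set Implicit Arguments.
Unset Strict Implicit.
Unset Printing Implicit Defensive.

Import GRing.Theory Num.Theory.
Local Open Scope ring_scope.

(** * Transpositions and a block stabilizer *)

(** The matrix [X_s] lies in the center because mixed second derivatives of the form [s f] commute.
    Degree at least 3 makes the center commutative: two self-adjoint endomorphisms can be
    interchanged only when a third slot is available. Blocks are replaced by one common eigenvector
    v of the center with its eigencharacter. The vectors [v *m rG y] are again eigenvectors, two of
    them share a character exactly when the y lie in one coset of H, and eigenvectors for different
    characters are independent; so the scalar action of a class sum splits into one relation per
    coset. For cosets other than H this is [coset_sum], the only representation theory that the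
    combinatorics of edges uses. Conjugation by H preserves equivalence of edges, so each
    coincidence breeds others; contradictions come from adjacent edges in one class, or from a coset
    sum that collapses to a nonzero multiple of one vector. When H is all of S_n the center is
    scalar and f is semi-invariant. The link with la = la' is made by the dominance order, and by
    counting pairs of entries in a common row or column. *)

Ltac neqs :=
  repeat match goal with
  | H : is_true (uniq _) |- _ =>
      rewrite /= ?inE ?negb_or ?andbT -?andbA in H
  | H : is_true (_ \notin _ :: _) |- _ => rewrite !inE ?negb_or -?andbA in H
  | H : is_true (_ && _) |- _ => let H1 := fresh "D" in case/andP: H => H1 H
  end.

Ltac perm_eval :=
  rewrite ?permM ?permE /=;
  repeat match goal with
  | |- context [?a == ?a] => rewrite (eqxx a) /=
  | H : is_true (?a != ?b) |- context [?a == ?b] => rewrite (negPf H) /=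
  | H : is_true (?a != ?b) |- context [?b == ?a] => rewrite [b == a]eq_sym (negPf H) /=
  end; try done.

Section Blocks.

Context {C : numFieldType} {T : finType} {m : nat}.
Variables (rG : mx_representation C [set: {perm T}] m) (H : {group {perm T}}).
Variable v : 'rV[C]_m.

(* H stands for the stabilizer of a block; then E a b c d says that (a b) and (c d) send
   that block to the same block. *)
Local Notation E a b c d := ((tperm a b * tperm c d)%g \in H).

Lemma edge_refl a b : E a b a b.
Proof. by rewrite tperm2 group1. Qed.

Lemma edge_flip a b c d : E a b c d -> E a b d c.
Proof. by rewrite (tpermC c). Qed.

Lemma edge_sym a b c d : E a b c d -> E c d a b.
Proof. by move=> /groupVr; rewrite invMg !tpermV. Qed.

Lemma edge_trans a b c d e f : E a b c d -> E c d e f -> E a b e f.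
Proof. by move=> h1 /(groupM h1); rewrite -mulgA tpermKg. Qed.

Lemma edge_mem a b c d : E a b c d -> tperm c d \in H -> tperm a b \in H.
Proof. by move=> h1 h2; rewrite -(groupMr _ h2). Qed.

Lemma edge_conj a b c d h a' b' c' d' : E a b c d -> h \in H ->
  h a = a' -> h b = b' -> h c = c' -> h d = d' -> E a' b' c' d'.
Proof.
move=> h1 hh <- <- <- <-; rewrite -!tpermJ -conjMg.
by rewrite memJ_norm // (subsetP (normG H)).
Qed.

Lemma mem_conj a b h a' b' : tperm a b \in H -> h \in H ->
  h a = a' -> h b = b' -> tperm a' b' \in H.
Proof.
by move=> h1 hh <- <-; rewrite -tpermJ memJ_norm // (subsetP (normG H)).
Qed.


(** The product [(a b)(b c)] is a 3-cycle in H; conjugating the hypothesis by it turns the triangle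
    by one step. *)
Lemma edge_triangle a b c : uniq [:: a; b; c] -> E a b b c -> E a b a c.
Proof.
move=> U h; neqs; apply: edge_flip; apply: edge_sym.
by apply: (edge_conj h h); perm_eval.
Qed.

Hypothesis v_neq0 : v != 0.
Hypothesis coset_sum : forall x, x \notin H ->
  \sum_(y in (x ^: [set: {perm T}])%g | (x * y^-1)%g \in H) v *m rG y = 0.

Lemma double_neq0 (s : {perm T}) : v *m rG s + v *m rG s != 0.
Proof.
rewrite -mulr2n -scaler_nat scaler_eq0 pnatr_eq0 /=.
apply: contraNneq v_neq0 => /(congr1 (mulmxr (rG s^-1%g))).
by rewrite /= mul0mx -mulmxA -repr_mxM ?inE // mulgV repr_mx1 mulmx1 => ->.
Qed.

Lemma tperm_classP a b y : a != b ->
  reflect (exists c d, c != d /\ y = tperm c d) (y \in (tperm a b ^: [set: {perm T}])%g).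
Proof.
move=> ab; apply: (iffP imsetP) => [[s _ ->]|[c [d [cd ->]]]].
  by exists (s a), (s b); rewrite tpermJ (inj_eq perm_inj).
have [s [sa sb]] : exists s : {perm T}, s a = c /\ s b = d.
  exists (tperm a c * tperm (tperm a c b) d)%g; rewrite !permM tpermL tpermL.
  split; last by [].
  apply: tpermD; last by rewrite eq_sym.
  by rewrite -[X in _ != X](tpermL a c) (inj_eq perm_inj) eq_sym.
by exists s; rewrite ?inE // tpermJ sa sb.
Qed.

Lemma edge_sum a b (l : seq {perm T}) : a != b -> tperm a b \notin H ->
  uniq l ->
  (forall c d, c != d -> E a b c d -> tperm c d \in l) ->
  (forall y, y \in l -> exists c d, [/\ c != d, y = tperm c d & E a b c d]) ->
  \sum_(y <- l) v *m rG y = 0.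
Proof.
move=> ab abH ul l1 l2; rewrite -[RHS](coset_sum abH) big_uniq //=.
apply: eq_bigl => y; apply/idP/andP.
  move=> /l2 [c [d [cd -> h]]]; rewrite tpermV; split=> //.
  by apply/tperm_classP => //; exists c, d.
case=> /(tperm_classP _ ab) [c [d [cd ->]]]; rewrite tpermV; exact: l1.
Qed.

Lemma tperm_eqP (a b c d : T) : a != b -> tperm c d = tperm a b ->
  (c = a /\ d = b) \/ (c = b /\ d = a).
Proof.
move=> ab e; have cd : c != d.
  apply: contraNneq ab => cd; move/permP/(_ a): e.
  by rewrite cd tperm1 perm1 tpermL => ->.
have : tperm a b c != c by rewrite -e tpermL eq_sym.
case: tpermP => [ca _|cb _|_ _ /eqP //].
  by left; split=> //; rewrite -(tpermL c d) e ca tpermL.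
by right; split=> //; rewrite -(tpermL c d) e cb tpermR.
Qed.

(** A class reduced to one edge would make its coset sum a single vector [v *m rG (tperm a b)],
    which is nonzero. *)
Lemma edge_other a b : a != b -> tperm a b \notin H ->
  exists c d, [/\ c != d, E a b c d & tperm c d != tperm a b].
Proof.
move=> ab abH.
have [/existsP [c /existsP [d /and3P [h1 h2 h3]]]|no] :=
    boolP [exists c, exists d, [&& c != d, E a b c d & tperm c d != tperm a b]].
  by exists c, d.
have S : \sum_(y <- [:: tperm a b]) v *m rG y = 0.
  apply: (edge_sum ab abH) => // [c d cd h|y].
    rewrite inE; apply: contraR no => ne.
    by apply/existsP; exists c; apply/existsP; exists d; rewrite cd h.
  by rewrite inE => /eqP ->; exists a, b; split=> //; apply: edge_refl.
move: S; rewrite big_seq1.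
move/(congr1 (mulmxr (rG (tperm a b)))); rewrite /= mul0mx -mulmxA -repr_mxM ?inE //.
by rewrite tperm2 repr_mx1 mulmx1 => /eqP; rewrite (negPf v_neq0).
Qed.

(** With only two edges in the class the coset sum has two terms; multiplying it by [(c d)] turns
    one of them into v. All the signs used below come from here. *)
Lemma edge_pairN a b c d : a != b -> c != d -> tperm a b \notin H ->
  tperm c d != tperm a b -> E a b c d ->
  (forall e f, e != f -> E a b e f ->
     tperm e f = tperm a b \/ tperm e f = tperm c d) ->
  v *m rG (tperm a b * tperm c d)%g = - v.
Proof.
move=> ab cd abH ne h only.
have S : \sum_(y <- [:: tperm a b; tperm c d]) v *m rG y = 0.
  apply: (edge_sum ab abH) => [|e f ef /(only _ _ ef) [] ->|y].
  - by rewrite /= inE eq_sym ne.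
  - by rewrite inE eqxx.
  - by rewrite !inE eqxx orbT.
  - rewrite !inE => /orP [] /eqP ->; first by exists a, b; rewrite edge_refl.
    by exists c, d.
move: S; rewrite big_cons big_seq1.
move/(congr1 (mulmxr (rG (tperm c d)))).
rewrite /= mul0mx mulmxDl -!mulmxA -!repr_mxM ?inE // tperm2 repr_mx1 mulmx1.
by move/eqP; rewrite addr_eq0 => /eqP.
Qed.


(** Otherwise a x would be alone in its class, against [edge_other]: the 3-cycle [t] in H turns any
    further edge equivalent to a x into relations that end by putting a x into the class of a b. *)
Lemma edge_clique a b c x : uniq [:: a; b; c] -> tperm a b \notin H -> E a b b c ->
  x != a -> E a b a x.
Proof.
move=> U abH h xa; apply: contraT => nax.
have h' := edge_triangle U h.
have xb : x != b by apply: contraNneq nax => ->; apply: edge_refl.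
have xc : x != c by apply: contraNneq nax => ->.
neqs.
have nbx : ~~ E a b b x.
  by apply: contraNN nax => h1; apply: edge_triangle => //=; rewrite !inE; perm_eval.
have ncx : ~~ E a b c x.
  apply: contraNN nax => h1; apply: (edge_trans h').
  apply: edge_triangle; first by rewrite /= !inE; perm_eval.
  exact: (edge_trans (edge_sym h') h1).
pose t := (tperm a b * tperm b c)%g.
have tH : t \in H by [].
have ta : t a = c by rewrite /t; perm_eval.
have tb : t b = a by rewrite /t; perm_eval.
have tc : t c = b by rewrite /t; perm_eval.
have tx : t x = x by rewrite /t; perm_eval.
have axH : tperm a x \notin H.
  apply: contraNN abH => axH.
  have bxH : tperm b x \in H
    by apply: (mem_conj (h := (t * t)%g) axH (groupM tH tH)); rewrite permM ?ta ?tc ?tx.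
  by rewrite tpermC; apply: (mem_conj bxH axH); perm_eval.
have nab : ~~ E a x a b by apply: contraNN nax; apply: edge_sym.
have nac : ~~ E a x a c.
  by apply: contraNN nab => /edge_trans; apply; apply: edge_sym.
have nbx' : ~~ E a x b x.
  apply: contraNN nab => h1; apply: edge_triangle; last exact: edge_flip.
  by rewrite /= !inE; perm_eval.
have ncx' : ~~ E a x c x.
  apply: contraNN nac => h1; apply: edge_triangle; last exact: edge_flip.
  by rewrite /= !inE; perm_eval.
have nbc' : ~~ E a x b c.
  by apply: contraNN nab => /edge_trans; apply; apply: edge_sym.
(* An edge disjoint from the triangle is fixed by [t], which moves a x to c x. *)
have out0 p q : p != q -> E a x p q -> p \notin [:: a; b; c] -> q \in [:: a; b; c].
  move=> pq h1 pn; apply: contraNT ncx' => qn.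
  apply: (edge_trans h1 (edge_sym _)).
  have fx z : z \notin [:: a; b; c] -> t z = z.
    by move=> zn; neqs; rewrite /t; perm_eval.
  by apply: (edge_conj h1 tH); [exact: ta|exact: tx|exact: fx|exact: fx].
have by_ y : y \notin [:: a; b; c; x] -> ~~ E a x b y.
  move=> yn; neqs; apply: contraNN nax => h1.
  have h2 : E b x c y.
    have ty : t y = y by rewrite /t; perm_eval.
    by apply: (edge_conj h1 (groupM tH tH)); rewrite permM ?(ta, tb, tc, tx, ty).
  have h3 : E y a c b by apply: (edge_conj h2 h1); perm_eval.
  have h4 : E a b a y.
    apply: edge_sym; rewrite (tpermC a y); apply: (edge_trans h3).
    apply: edge_sym; rewrite (tpermC c b); exact: h.
  have h5 : E a b b y.
    rewrite (tpermC a b); apply: edge_triangle; first by rewrite /= !inE; perm_eval.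
    by rewrite (tpermC b a).
  exact: (edge_trans h5 (edge_sym h1)).
have cy_ y : y \notin [:: a; b; c; x] -> ~~ E a x c y.
  move=> yn; neqs; apply: contraNN ncx => h1.
  have ty : t y = y by rewrite /t; perm_eval.
  have h2 : E b x a y.
    by apply: (edge_conj h1 (groupM tH tH)); rewrite permM ?(ta, tb, tc, tx, ty).
  have h3 : E b a x c by apply: (edge_conj h2 h1); perm_eval.
  by rewrite (tpermC a) (tpermC c).
have out p q : p != q -> E a x p q -> tperm p q != tperm a x -> p \in [:: a; b; c] -> False.
  move=> pq h1 ne; rewrite !inE => /or3P [] /eqP ep; subst p.
  - have qx : q != x by apply: contraNneq ne => ->.
    have qb : q != b by apply: contraNneq nab => ea; subst q.
    have qc : q != c by apply: contraNneq nac => ea; subst q.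
    have h2 : E a x x q.
      rewrite (tpermC a x); apply: edge_triangle; first by rewrite /= !inE; perm_eval.
      by rewrite (tpermC x a).
    have xq : x != q by rewrite eq_sym.
    have xn : x \notin [:: a; b; c] by rewrite !inE; perm_eval.
    by have := out0 x q xq h2 xn; rewrite !inE; perm_eval.
  - have qa : q != a by apply: contraNneq nab => ea; subst q; apply: edge_flip.
    have qx : q != x by apply: contraNneq nbx' => ea; subst q.
    have qc : q != c by apply: contraNneq nbc' => ea; subst q.
    by apply: (negP (by_ q _) h1); rewrite !inE; perm_eval.
  - have qa : q != a by apply: contraNneq nac => ea; subst q; apply: edge_flip.
    have qx : q != x by apply: contraNneq ncx' => ea; subst q.
    have qb : q != b by apply: contraNneq nbc' => ea; subst q; apply: edge_flip.
    by apply: (negP (cy_ q _) h1); rewrite !inE; perm_eval.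
have [|p [q [pq h1 ne]]] := @edge_other a x _ axH; first by rewrite eq_sym.
have [pin|pn] := boolP (p \in [:: a; b; c]); first by case: (out p q).
have qin := out0 p q pq h1 pn.
by case: (out q p) => //; [rewrite eq_sym|apply: edge_flip|rewrite tpermC].
Qed.


(** All edges form one class, so H contains every product of two transpositions, while [(a b)] is
    missing. *)
Lemma clique_alternating a b c : uniq [:: a; b; c] -> tperm a b \notin H -> E a b b c ->
  forall s : {perm T}, (s \in H) = ~~ odd_perm s.
Proof.
move=> U abH h.
have all_edges p q : p != q -> E a b p q.
  move=> pq; have h1 x : x != a -> E a b a x by apply: edge_clique h.
  have [pa|pa] := eqVneq p a; first by rewrite pa; apply: h1; rewrite eq_sym -pa.
  have [qa|qa] := eqVneq q a; first by rewrite qa; apply: edge_flip; apply: h1.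
  apply: (edge_trans (edge_flip (h1 _ pa))); apply: edge_triangle.
    by neqs; rewrite /= !inE; perm_eval.
  exact: edge_trans (edge_sym (edge_flip (h1 _ pa))) (h1 _ qa).
have par s : if odd_perm s then (tperm a b * s)%g \in H else s \in H.
  have [ts -> +] := prod_tpermP s.
  elim: ts => [_|[p q] ts IH /andP [/= pq tsP]].
    by rewrite big_nil odd_perm1 group1.
  rewrite big_cons odd_permM odd_tperm pq /=; move: IH => /(_ tsP).
  case: (odd_perm _) => /= IH; last by rewrite mulgA groupMl ?all_edges.
  have -> : forall u : {perm T}, (tperm p q * u = (tperm p q * tperm a b) * (tperm a b * u))%g.
    by move=> u; rewrite -mulgA tpermKg.
  by rewrite groupM ?(edge_sym (all_edges _ _ pq)).
move=> s; have := par s; case: (odd_perm s) => // h1.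
by apply: contraNF abH => sH; rewrite groupMr in h1.
Qed.

(** * Classes of edges that are matchings *)

Hypothesis matching : forall a b c, uniq [:: a; b; c] -> E a b b c -> tperm a b \in H.

Lemma edge_cases a b p q : a != b -> tperm a b \notin H -> p != q -> E a b p q ->
  [\/ p = a /\ q = b, p = b /\ q = a | uniq [:: a; b; p; q]].
Proof.
move=> ab abH pq h; have baH : tperm b a \notin H by rewrite tpermC.
have ba : b != a by rewrite eq_sym.
have [pa|pa] := eqVneq p a.
  have [qb|qb] := eqVneq q b; first by constructor 1.
  case/negP: baH; subst p; apply: (@matching b a q); last by rewrite (tpermC b).
  by rewrite /= !inE; perm_eval.
have [pb|pb] := eqVneq p b.
  have [qa|qa] := eqVneq q a; first by constructor 2.
  case/negP: abH; subst p; apply: (@matching a b q) => //.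
  by rewrite /= !inE; perm_eval.
have [qa|qa] := eqVneq q a.
  case/negP: baH; subst q; apply: (@matching b a p); last by rewrite (tpermC b) (tpermC a p).
  by rewrite /= !inE; perm_eval.
have [qb|qb] := eqVneq q b.
  case/negP: abH; subst q; apply: (@matching a b p); last by rewrite (tpermC b p).
  by rewrite /= !inE; perm_eval.
by constructor 3; rewrite /= !inE; perm_eval.
Qed.

Lemma edge_disjoint a b : a != b -> tperm a b \notin H ->
  exists c d, uniq [:: a; b; c; d] /\ E a b c d.
Proof.
move=> ab abH; have [c [d [cd h ne]]] := edge_other ab abH.
case: (edge_cases ab abH cd h) => [[ca db]|[cb da]|U].
- by rewrite ca db eqxx in ne.
- by rewrite cb da tpermC eqxx in ne.
- by exists c, d.
Qed.

(** All comes from conjugation by [(a b)(c d)], which sends a x to the adjacent edge b x and fixes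
    every edge that avoids the four points. *)
Lemma edge_outside a b c d x : uniq [:: a; b; c; d; x] -> E a b c d ->
  tperm a b \notin H ->
  [/\ tperm a x \notin H, ~~ E a x b x &
   forall p q, p != q -> E a x p q -> p \notin [:: a; b; c; d] -> q \in [:: a; b; c; d]].
Proof.
move=> U h abH; neqs.
have axH : tperm a x \notin H.
  apply: contraNN abH => axH.
  have bxH : tperm b x \in H by apply: (mem_conj axH h); perm_eval.
  by rewrite (tpermC a); apply: (mem_conj bxH axH); perm_eval.
have nE : ~~ E a x b x.
  apply: contraNN axH => h1; apply: (matching (c := b)); last exact: edge_flip.
  by rewrite /= !inE; perm_eval.
split=> // p q pq h1 pn; apply: contraNT nE => qn.
apply: (edge_trans h1); apply: edge_sym; neqs.
by apply: (edge_conj h1 h); perm_eval.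
Qed.


(** Conjugation by [(x y)] sends a x to the adjacent edge a y, so it cannot fix the partner p q.
    Hence y is an end of p q, and [edge_outside] places the other end. *)
Lemma edge_across a b c d x y p q : uniq [:: a; b; c; d; x; y] -> E a b c d ->
  tperm a b \notin H -> tperm x y \in H -> uniq [:: a; x; p; q] -> E a x p q ->
  (p = y /\ q \in [:: b; c; d]) \/ (q = y /\ p \in [:: b; c; d]).
Proof.
move=> U h abH xyH Up h1.
have Ux : uniq [:: a; b; c; d; x].
  by neqs; rewrite /= !inE; perm_eval.
have [axH _ out] := edge_outside Ux h abH.
have [py|py] := eqVneq p y.
  left; split=> //; have : q \in [:: a; b; c; d].
    by apply: (out p) => //; [neqs|neqs; rewrite py !inE; perm_eval].
  by neqs; rewrite inE; perm_eval.
have [qy|qy] := eqVneq q y.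
  right; split=> //; have : p \in [:: a; b; c; d].
    apply: (out q) => //; last by neqs; rewrite qy !inE; perm_eval.
      by neqs; rewrite eq_sym.
    exact: edge_flip.
  by neqs; rewrite inE; perm_eval.
case/negP: axH; rewrite tpermC; apply: (matching (c := y)).
  by neqs; rewrite /= !inE; perm_eval.
rewrite (tpermC x); apply: (edge_trans h1); apply: edge_sym; neqs.
by apply: (edge_conj h1 xyH); perm_eval.
Qed.

(* The opposite vertices are a and c, b and d, x and y. *)
Definition octahedron a b c d x y :=
  [/\ uniq [:: a; b; c; d; x; y], E a b c d, E a x c y, tperm a b \notin H &
      tperm x y \in H].

(** The elements [(a x)(c y)] and [(a b)(c d)] of H carry the axis x y to a c, and a c to b d. *)
Lemma octahedron_axes a b c d x y : octahedron a b c d x y ->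
  [/\ tperm a c \in H, tperm b d \in H & tperm a x \notin H].
Proof.
case=> U h1 h2 abH xyH.
have acH : tperm a c \in H.
  by neqs; apply: (mem_conj xyH h2); perm_eval.
split=> //; first by neqs; apply: (mem_conj acH h1); perm_eval.
have Ux : uniq [:: a; b; c; d; x] by neqs; rewrite /= !inE; perm_eval.
by case: (edge_outside Ux h1 abH).
Qed.

(** This and the next two lemmas are the symmetries of the octahedron that carry a statement about x
    to the other five vertices. *)
Lemma octahedron_opp a b c d x y : octahedron a b c d x y -> octahedron c d a b y x.
Proof.
case=> U h1 h2 abH xyH; split; try exact: edge_sym.
- by neqs; rewrite /= !inE; perm_eval.
- exact: contraNN (edge_mem h1) abH.
- by rewrite tpermC.
Qed.

Lemma octahedron_swap a b c d x y : octahedron a b c d x y -> octahedron a x c y b d.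
Proof.
move=> o; have [acH bdH axH] := octahedron_axes o.
case: o => U h1 h2 abH xyH; split=> //.
by neqs; rewrite /= !inE; perm_eval.
Qed.

Lemma octahedron_rot a b c d x y : octahedron a b c d x y -> octahedron x b y d a c.
Proof.
move=> o; have [acH bdH axH] := octahedron_axes o.
case: o => U h1 h2 abH xyH; split=> //.
- by neqs; rewrite /= !inE; perm_eval.
- by rewrite (tpermC x) (tpermC y); neqs; apply: (edge_conj h2 h1); perm_eval.
- by rewrite (tpermC x) (tpermC y).
- have Ux : uniq [:: b; a; d; c; x] by neqs; rewrite /= !inE; perm_eval.
  have h1' : E b a d c by rewrite (tpermC b) (tpermC d).
  have baH : tperm b a \notin H by rewrite tpermC.
  by rewrite tpermC; case: (edge_outside Ux h1' baH).
Qed.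

(** A partner of a x joins y to b, c or d. With b, conjugation makes c d equivalent to x y, hence an
    element of H; with d, two edges at y fall into one class. Only c remains. *)
Lemma octahedron_class a b c d x y p q : octahedron a b c d x y -> p != q ->
  E a x p q -> tperm p q = tperm a x \/ tperm p q = tperm c y.
Proof.
move=> o pq h; have [acH bdH axH] := octahedron_axes o.
case: (o) => U h1 h2 abH xyH.
have ax : a != x by neqs.
case: (edge_cases ax axH pq h) => [[-> ->]|[-> ->]|Up]; first by left.
  by left; rewrite tpermC.
have by_ : ~~ E a x b y.
  apply: contraNN abH => h3; apply: (edge_mem h1).
  suff /edge_sym/edge_mem -> : E x y c d by [].
  by neqs; apply: (edge_conj h1 h3); perm_eval.
have dy : ~~ E a x d y.
  apply: contraNN axH => h3; apply: (edge_mem h2); apply: (matching (c := d)).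
    by neqs; rewrite /= !inE; perm_eval.
  by rewrite (tpermC y); apply: (edge_trans (edge_sym h2)).
right; case: (edge_across U h1 abH xyH Up h) => -[e]; rewrite e !inE => /or3P [] /eqP e'.
- by case/negP: by_; apply: edge_flip; rewrite -e -e'.
- by rewrite e' tpermC.
- by case/negP: dy; apply: edge_flip; rewrite -e -e'.
- by case/negP: by_; rewrite -e -e'.
- by rewrite e'.
- by case/negP: dy; rewrite -e -e'.
Qed.

(** If z differed from y, [edge_across] with z in place of y would put z on the edge c y, and z = c
    is excluded by [edge_outside]. *)
Lemma octahedron_partner a b c d x y z : octahedron a b c d x y -> z != x ->
  tperm x z \in H -> z = y.
Proof.
move=> o zx xzH; have [acH bdH axH] := octahedron_axes o.
case: (o) => U h1 h2 abH xyH.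
have base a' b' c' d' : uniq [:: a'; b'; c'; d'; x] -> E a' b' c' d' ->
    tperm a' b' \notin H -> z != a'.
  move=> U' h' H'; case: (edge_outside U' h' H') => + _ _.
  by rewrite tpermC; apply: contraNneq => <-.
have za : z != a by apply: (base a b c d) => //; neqs; rewrite /= !inE; perm_eval.
have zb : z != b.
  apply: (base b a d c); first by neqs; rewrite /= !inE; perm_eval.
    by rewrite (tpermC b) (tpermC d).
  by rewrite tpermC.
have cdH : tperm c d \notin H by exact: contraNN (edge_mem h1) abH.
have zc : z != c.
  by apply: (base c d a b) => //; [neqs; rewrite /= !inE; perm_eval|exact: edge_sym].
have zd : z != d.
  apply: (base d c b a); first by neqs; rewrite /= !inE; perm_eval.
    by rewrite (tpermC b) (tpermC d); apply: edge_sym.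
  by rewrite tpermC.
have Uz : uniq [:: a; b; c; d; x; z] by neqs; rewrite /= !inE; perm_eval.
have Uc : uniq [:: a; x; c; y] by neqs; rewrite /= !inE; perm_eval.
case: (edge_across Uz h1 abH xzH Uc h2) => -[e] //.
by rewrite e eqxx in zc.
Qed.

Lemma octahedron_pairN a b c d x y : octahedron a b c d x y ->
  v *m rG (tperm a x * tperm c y)%g = - v.
Proof.
move=> o; have [acH bdH axH] := octahedron_axes o.
have cls p q := @octahedron_class a b c d x y p q o.
case: o => U h1 h2 abH xyH; apply: edge_pairN => //; try by neqs.
apply/eqP => e; have ax : a != x by neqs.
by case: (tperm_eqP ax e) => -[/eqP + _]; neqs; perm_eval.
Qed.

Definition cycle3 (p q r : T) : {perm T} := (tperm p q * tperm q r)%g.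

Lemma cycle3_rot p q r : uniq [:: p; q; r] -> cycle3 p q r = cycle3 q r p.
Proof.
move=> U; neqs; apply/permP => z; rewrite /cycle3.
have [->|zp] := eqVneq z p; first by perm_eval.
have [->|zq] := eqVneq z q; first by perm_eval.
by have [->|zr] := eqVneq z r; perm_eval.
Qed.

Lemma cycle3_id p q r z : z \notin [:: p; q; r] -> cycle3 p q r z = z.
Proof. by move=> n; neqs; rewrite /cycle3; perm_eval. Qed.

(* The coset of the 3-cycle t contains exactly two 3-cycles t and t', and
   t t'^-1 is a product of two elements acting by -1, so that the coset sum is 2 v t'. *)
Lemma no_octahedron a b c d x y : ~ octahedron a b c d x y.
Proof.
move=> o; have [acH bdH axH] := octahedron_axes o.
have pX := @octahedron_partner _ _ _ _ _ _ _ o.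
have pY := @octahedron_partner _ _ _ _ _ _ _ (octahedron_opp o).
have pB := @octahedron_partner _ _ _ _ _ _ _ (octahedron_swap o).
have pD := @octahedron_partner _ _ _ _ _ _ _ (octahedron_opp (octahedron_swap o)).
have pA := @octahedron_partner _ _ _ _ _ _ _ (octahedron_rot o).
have pC := @octahedron_partner _ _ _ _ _ _ _ (octahedron_opp (octahedron_rot o)).
have v1 := octahedron_pairN o.
have v2 := octahedron_pairN (octahedron_swap o).
case: (o) => U h1 h2 abH xyH.
(* [t] rotates a face; [t'] rotates the opposite face, as the inverse of the antipodal image of
   [t]. *)
pose t := cycle3 a b x; pose t' := cycle3 c y d.
have ett : t = (tperm a x * tperm c y * (tperm a b * tperm c d) * t')%g.
  neqs; apply/permP => z; rewrite /t /t' /cycle3.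
  have [->|za] := eqVneq z a; first by perm_eval.
  have [->|zb] := eqVneq z b; first by perm_eval.
  have [->|zc] := eqVneq z c; first by perm_eval.
  have [->|zd] := eqVneq z d; first by perm_eval.
  have [->|zx] := eqVneq z x; first by perm_eval.
  by have [->|zy] := eqVneq z y; perm_eval.
have tt'H : (t * t'^-1)%g \in H by rewrite ett mulgK groupM.
have tH : t \notin H.
  apply/negP => tH; have : tperm x c \in H.
    by neqs; apply: (mem_conj acH tH); rewrite /t /cycle3; perm_eval.
  move=> /pX e; have /e cy : c != x by neqs.
  by neqs; move/eqP: cy; perm_eval.
have np z w w' : (forall u, u != z -> tperm z u \in H -> u = w) -> w' != z -> w' != w ->
    tperm z w' \notin H.
  by move=> pz h3; apply: contraNN => /(pz _ h3) ->.
have nA z : z != a -> z != c -> tperm a z \notin H by apply: np.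
have nB z : z != b -> z != d -> tperm b z \notin H by apply: np.
have nC z : z != c -> z != a -> tperm c z \notin H by apply: np.
have nD z : z != d -> z != b -> tperm d z \notin H by apply: np.
have nX z : z != x -> z != y -> tperm x z \notin H by apply: np.
have nY z : z != y -> z != x -> tperm y z \notin H by apply: np.
have two y' : y' \in (t ^: [set: {perm T}])%g -> (t * y'^-1)%g \in H ->
    y' = t \/ y' = t'.
{ have Ut : uniq [:: a; b; x] by neqs; rewrite /= !inE; perm_eval.
  case/imsetP => s _; rewrite /t /cycle3 conjMg !tpermJ.
  have : uniq [:: s a; s b; s x]
    by rewrite -[[:: s a; s b; s x]]/(map s [:: a; b; x]) (map_inj_uniq perm_inj).
  move: (s a) (s b) (s x) => p q r Us; rewrite -[(tperm p q * _)%g]/(cycle3 p q r).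
  have eti : (t^-1 = tperm b x * tperm a b)%g by rewrite invMg !tpermV.
  move=> -> {y'} /groupVr; rewrite invMg invgK eti.
  set k := (cycle3 p q r * _)%g => kH.
  (* On an axis avoided by the 3-cycle, [k] acts as the inverse of [t], which sends every axis to an
     edge outside H. So the 3-cycle meets all three axes. *)
  have hit u w u' w' : tperm u w \in H -> (tperm b x * tperm a b)%g u = u' ->
      (tperm b x * tperm a b)%g w = w' ->
      tperm u' w' \notin H -> (u \in [:: p; q; r]) || (w \in [:: p; q; r]).
    move=> uw eu ew; apply: contraR; rewrite negb_or => /andP [un wn].
    by apply: (mem_conj uw kH); rewrite permM cycle3_id.
  have hA : (a \in [:: p; q; r]) || (c \in [:: p; q; r]).
    by neqs; apply: (hit a c b c) => //; [perm_eval|perm_eval|apply: nB; perm_eval].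
  have hB : (b \in [:: p; q; r]) || (d \in [:: p; q; r]).
    by neqs; apply: (hit b d x d) => //; [perm_eval|perm_eval|apply: nX; perm_eval].
  have hX : (x \in [:: p; q; r]) || (y \in [:: p; q; r]).
    by neqs; apply: (hit x y a y) => //; [perm_eval|perm_eval|apply: nA; perm_eval].
  rewrite -/(cycle3 a b x) -/t.
  wlog hp : p q r Us @k kH hA hB hX {hit} / (p == a) || (p == c).
    move=> IH; have [hp|hp] := boolP ((p == a) || (p == c)); first exact: IH.
    have U1 : uniq [:: q; r; p] by neqs; rewrite /= !inE; perm_eval.
    have U2 : uniq [:: r; p; q] by neqs; rewrite /= !inE; perm_eval.
    have cat1 z : (z \in [:: q; r; p]) = (z \in [:: p; q; r]).
      by rewrite !inE; do ![case: (_ == _)].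
    have cat2 z : (z \in [:: r; p; q]) = (z \in [:: p; q; r]).
      by rewrite !inE; do ![case: (_ == _)].
    have [hq|hq] := boolP ((q == a) || (q == c)).
      by rewrite cycle3_rot //; apply: IH; rewrite ?cat1 // -cycle3_rot.
    have [hr|hr] := boolP ((r == a) || (r == c)).
      rewrite cycle3_rot // cycle3_rot //; apply: IH; rewrite ?cat2 //.
      by rewrite -(cycle3_rot U1) -(cycle3_rot Us).
    move: hA hp hq hr; rewrite !inE !negb_or.
    by case/orP => /or3P [] /eqP ->; rewrite !eqxx ?andbF.
  have kH' := kH; rewrite /k /cycle3 in kH'.
  have out z w : tperm z w \in H -> tperm ((tperm p q * tperm q r * (tperm b x * tperm a b))%g z)
      ((tperm p q * tperm q r * (tperm b x * tperm a b))%g w) \in H.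
    by move=> zw; apply: (mem_conj zw kH').
  have oA := out _ _ acH; have oB := out _ _ bdH; have oX := out _ _ xyH.
  have pick z w : p != z -> p != w -> (z \in [:: p; q; r]) || (w \in [:: p; q; r]) ->
      [|| q == z, q == w, r == z | r == w].
    move=> pz pw; rewrite !inE ![z == _]eq_sym ![w == _]eq_sym (negPf pz) (negPf pw) /=.
    by do ![case: (_ == _)].
  have hB' : [|| q == b, q == d, r == b | r == d].
    by apply: pick => //; neqs; case/orP: hp => /eqP ->; perm_eval.
  have hX' : [|| q == x, q == y, r == x | r == y].
    by apply: pick => //; neqs; case/orP: hp => /eqP ->; perm_eval.
  (* One vertex on each axis and two orientations leave sixteen 3-cycles. Except for [t] and [t'],
     each makes [k] send some axis to an edge outside H. *)
  move: Us oA oB oX; clear -U hp hB' hX' nA nB nC nD nX nY; neqs.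
  have imp u w : (tperm u w \notin H) -> tperm u w \in H -> False by move/negP.
  case/orP: hp => /eqP e1; subst p; case/or4P: hB' => /eqP e2;
    first [subst q|subst r]; case/or4P: hX' => /eqP e3; try subst q; try subst r.
  all: move=> Us; neqs.
  all: try by move/eqP: e3; perm_eval.
  all: rewrite !permM !permE /=.
  all: perm_eval.
  all: move=> oA oB oX.
  all: try by [left|right].
  all: have ne_ (z w : T) : z != w -> w != z by rewrite eq_sym.
  all: exfalso; first
    [ move: oA; apply/negP;
      by first [apply: nA|apply: nB|apply: nC|apply: nD|apply: nX|apply: nY]; auto
    | move: oB; apply/negP;
      by first [apply: nA|apply: nB|apply: nC|apply: nD|apply: nX|apply: nY]; auto
    | move: oX; apply/negP;
      by first [apply: nA|apply: nB|apply: nC|apply: nD|apply: nX|apply: nY]; auto ]. }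
have tt' : t != t'.
  apply/eqP => /permP /(_ a); rewrite /t /t' /cycle3; neqs; perm_eval => /eqP; perm_eval.
have t'cl : t' \in (t ^: [set: {perm T}])%g.
  have ht : t \in (t ^: [set: {perm T}])%g by apply: class_refl.
  apply/imsetP; exists ((tperm a c * tperm b y * tperm x d))%g => //.
  rewrite /t /t' /cycle3 conjMg !tpermJ; neqs.
  by congr (tperm _ _ * tperm _ _)%g; perm_eval.
have S : \sum_(y0 <- [:: t; t']) v *m rG y0 = 0.
  rewrite -[RHS](coset_sum tH) big_uniq /=; last by rewrite inE tt'.
  apply: eq_bigl => z; rewrite !inE; apply/orP/andP.
    by case=> /eqP ->; rewrite ?mulgV ?group1 // ?class_refl.
  by case=> z1 z2; case: (two z z1 z2) => ->; rewrite eqxx; [left|right].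
have vt : v *m rG t = v *m rG t'.
  by rewrite ett (repr_mxM rG) ?inE // (repr_mxM rG) ?inE // !mulmxA v1 mulNmx v2 opprK.
by move: S; rewrite big_cons big_seq1 vt => /eqP; apply/negP; apply: double_neq0.
Qed.

(** If [(x y)] were in H, the partner of a x would join y to b, c or d. With b, conjugation makes x
    y equivalent to c d, which is not in H; with c or d the six points form an octahedron. *)
Lemma no_fixed_edge a b c d x y : uniq [:: a; b; c; d; x; y] -> E a b c d ->
  tperm a b \notin H -> tperm x y \notin H.
Proof.
move=> U h1 abH; apply/negP => xyH.
have Ux : uniq [:: a; b; c; d; x] by neqs; rewrite /= !inE; perm_eval.
have [axH _ _] := edge_outside Ux h1 abH.
have ax : a != x by neqs.
have [p [q [Up h]]] := edge_disjoint ax axH.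
have {p q Up h} [z zin h] : exists2 z, z \in [:: b; c; d] & E a x z y.
  by case: (edge_across U h1 abH xyH Up h) => -[e zin]; [exists q|exists p];
    rewrite // -e //; apply: edge_flip.
move: zin; rewrite !inE => /or3P [] /eqP e; subst z.
- have cdH : tperm c d \notin H by exact: contraNN (edge_mem h1) abH.
  have /edge_sym/edge_mem/(_ xyH) : E x y c d.
    by neqs; apply: (edge_conj h1 h); perm_eval.
  by apply/negP.
- exact: (@no_octahedron a b c d x y).
- apply: (@no_octahedron a b d c x y); split=> //; last exact: edge_flip.
  by neqs; rewrite /= !inE; perm_eval.
Qed.

(** If [(a c)] were in H, so would be [(b d)]. The partner p q of a z is compared with b and d: in
    each position [edge_outside] or [no_fixed_edge], applied to a z and p q, expels [(a c)] or
    [(b d)] from H. *)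
Lemma no_fixed_transversal a b c d z : uniq [:: a; b; c; d; z] -> E a b c d ->
  tperm a b \notin H -> tperm a c \notin H.
Proof.
move=> U h abH; apply/negP => acH.
have bdH : tperm b d \in H by neqs; apply: (mem_conj acH h); perm_eval.
have [azH _ _] := edge_outside U h abH.
have az : a != z by neqs.
have [p [q [Up h1]]] := edge_disjoint az azH.
have UE x : x \notin [:: a; z; p; q] -> uniq [:: a; z; p; q; x].
  by move=> xn; neqs; rewrite /= !inE; perm_eval.
have pzH : tperm p q \notin H by exact: contraNN (edge_mem h1) azH.
have out x y : x \in [:: p; q] -> y \notin [:: a; z; p; q] -> tperm x y \notin H.
  move=> xin yn; move: xin; rewrite !inE => /orP [] /eqP ->.
    have [|//] := @edge_outside p q a z y _ (edge_sym h1) pzH.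
    by neqs; rewrite /= !inE; perm_eval.
  have [| | |//] := @edge_outside q p a z y.
  - by neqs; rewrite /= !inE; perm_eval.
  - by rewrite (tpermC q); apply: edge_sym.
  - by rewrite tpermC.
have [bin|bn] := boolP (b \in [:: p; q]); have [din|dn] := boolP (d \in [:: p; q]).
- have cn : c \notin [:: a; z; p; q].
    have bd : b != d by neqs.
    move: bin din; rewrite !inE => /orP [] /eqP e1 /orP [] /eqP e2;
      try by [rewrite e1 e2 eqxx in bd]; neqs; rewrite -e1 -e2; perm_eval.
  by have [H1 _ _] := edge_outside (UE _ cn) h1 azH; rewrite acH in H1.
- have dn' : d \notin [:: a; z; p; q] by neqs; rewrite !inE; perm_eval.
  by have := out b d bin dn'; rewrite bdH.
- have bn' : b \notin [:: a; z; p; q] by neqs; rewrite !inE; perm_eval.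
  by have := out d b din bn'; rewrite tpermC bdH.
- have Ub : uniq [:: a; z; p; q; b; d] by neqs; rewrite /= !inE; perm_eval.
  by have := no_fixed_edge Ub h1 azH; rewrite bdH.
Qed.

Hypothesis card_T : (4 < #|T|)%N.
Hypothesis not_full : exists a b, a != b /\ tperm a b \notin H.

Lemma fresh (l : seq T) : (size l < #|T|)%N -> exists z, z \notin l.
Proof.
move=> sl; have [/existsP //|/existsPn all_in] := boolP [exists z, z \notin l].
move: sl; rewrite ltnNge; case/negP; apply: leq_trans (card_size l).
by apply/subset_leq_card/subsetP => z _; apply: negbNE.
Qed.

(** Take two equivalent edges a b and c d outside H. Any other edge joins two of these points, or
    has one end among them, or avoids them: [no_fixed_transversal], [edge_outside] and
    [no_fixed_edge] treat the three cases. The first needs a fifth point. *)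
Lemma no_transposition x y : x != y -> tperm x y \notin H.
Proof.
move=> xy; have [a [b [ab abH]]] := not_full.
have [c [d [U h]]] := edge_disjoint ab abH.
have [z zn] := @fresh [:: a; b; c; d] card_T.
have Uz : uniq [:: a; b; c; d; z] by neqs; rewrite /= !inE; perm_eval.
have h1 : E b a c d by rewrite (tpermC b).
have h2 : E a b d c by apply: edge_flip.
have h3 : E b a d c by apply: edge_flip.
have baH : tperm b a \notin H by rewrite tpermC.
have cdH : tperm c d \notin H by exact: contraNN (edge_mem h) abH.
have acH : tperm a c \notin H by apply: no_fixed_transversal Uz h abH.
have adH : tperm a d \notin H.
  by apply: (no_fixed_transversal (z := z) _ h2) => //; neqs; rewrite /= !inE; perm_eval.
have bcH : tperm b c \notin H.
  by apply: (no_fixed_transversal (z := z) _ h1) => //; neqs; rewrite /= !inE; perm_eval.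
have bdH : tperm b d \notin H.
  by apply: (no_fixed_transversal (z := z) _ h3) => //; neqs; rewrite /= !inE; perm_eval.
have out u w : u \in [:: a; b; c; d] -> w \notin [:: a; b; c; d] -> tperm u w \notin H.
  move=> uin wn; move: uin; rewrite !inE => /or4P [] /eqP ->.
  - have [|//] := @edge_outside a b c d w _ h abH.
    by neqs; rewrite /= !inE; perm_eval.
  - have [|//] := @edge_outside b a c d w _ h1 baH.
    by neqs; rewrite /= !inE; perm_eval.
  - have [|//] := @edge_outside c d a b w _ (edge_sym h) cdH.
    by neqs; rewrite /= !inE; perm_eval.
  - have [| |//] := @edge_outside d c a b w _ (edge_sym h2).
      by neqs; rewrite /= !inE; perm_eval.
    by rewrite tpermC.
have [xin|xn] := boolP (x \in [:: a; b; c; d]); have [yin|yn] := boolP (y \in [:: a; b; c; d]).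
- move: xin yin xy; rewrite !inE.
  by case/or4P=> /eqP -> /or4P [] /eqP ->; rewrite ?eqxx // 1?tpermC.
- exact: out.
- by rewrite tpermC; apply: out.
- apply: (no_fixed_edge _ h abH); neqs; rewrite /= !inE; perm_eval.
Qed.


(** * Sizes of the matchings *)

Lemma edge_adjacent a b c : uniq [:: a; b; c] -> ~~ E a b a c.
Proof.
move=> U; have ba : b != a by neqs; rewrite eq_sym.
apply: contraNN (no_transposition ba) => h; apply: (matching (c := c)).
  by neqs; rewrite /= !inE; perm_eval.
by rewrite (tpermC b).
Qed.

Lemma edge_meets a b c d x p q : uniq [:: a; b; c; d; x] -> E a b c d ->
  uniq [:: a; x; p; q] -> E a x p q ->
  [|| b \in [:: p; q], c \in [:: p; q] | d \in [:: p; q]].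
Proof.
move=> U h Up h1; have ab : a != b by neqs.
have [_ _ out] := edge_outside U h (no_transposition ab).
have pq : p != q by neqs.
have ap : a != p by neqs.
have aq : a != q by neqs.
apply: contraT; rewrite !inE !negb_or -!andbA => N.
have pn : p \notin [:: a; b; c; d] by neqs; rewrite !inE; perm_eval.
by have := out p q pq h1 pn; neqs; rewrite !inE; perm_eval.
Qed.

Lemma three_in_pair (u w z p q : T) : uniq [:: u; w; z] ->
  u \in [:: p; q] -> w \in [:: p; q] -> z \in [:: p; q] -> False.
Proof.
move=> U hu hw hz.
have /allP S : all (mem [:: p; q]) [:: u; w; z] by rewrite /= hu hw hz.
by have := uniq_leq_size U S.
Qed.

(** The partner p q of a e must meet [{b,c,d}], [{b,g,h}], [{f,c,d}] and [{f,g,h}]; two points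
    achieve this only by containing both b and f, or neither. In the second case conjugation by
    [(a b)(e f)] fixes p q and sends a e to b f. *)
Lemma edge_cross a b c d e f g h : uniq [:: a; b; c; d; e; f; g; h] ->
  E a b c d -> E a b e f -> E a b g h -> E a e b f.
Proof.
move=> U h1 h2 h3.
have ae : a != e by neqs.
have [p [q [Up hh]]] := edge_disjoint ae (no_transposition ae).
have M1 : [|| b \in [:: p; q], c \in [:: p; q] | d \in [:: p; q]].
  by apply: (edge_meets _ h1 Up hh); neqs; rewrite /= !inE; perm_eval.
have M2 : [|| b \in [:: p; q], g \in [:: p; q] | h \in [:: p; q]].
  by apply: (edge_meets _ h3 Up hh); neqs; rewrite /= !inE; perm_eval.
have Ue : uniq [:: e; a; p; q] by neqs; rewrite /= !inE; perm_eval.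
have he : E e a p q by rewrite (tpermC e).
have M3 : [|| f \in [:: p; q], c \in [:: p; q] | d \in [:: p; q]].
  apply: (edge_meets _ (edge_trans (edge_sym h2) h1) Ue he).
  by neqs; rewrite /= !inE; perm_eval.
have M4 : [|| f \in [:: p; q], g \in [:: p; q] | h \in [:: p; q]].
  apply: (edge_meets _ (edge_trans (edge_sym h2) h3) Ue he).
  by neqs; rewrite /= !inE; perm_eval.
have three z : uniq [:: z; c; g] -> uniq [:: z; c; h] -> uniq [:: z; d; g] ->
    uniq [:: z; d; h] -> z \in [:: p; q] ->
    (c \in [:: p; q]) || (d \in [:: p; q]) -> (g \in [:: p; q]) || (h \in [:: p; q]) -> False.
  by move=> U1 U2 U3 U4 zin /orP [] h4 /orP [] h5;
    [apply: three_in_pair U1 _ _ _|apply: three_in_pair U2 _ _ _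
    |apply: three_in_pair U3 _ _ _|apply: three_in_pair U4 _ _ _]; eassumption.
have [bin|bn] := boolP (b \in [:: p; q]); have [fin|fn] := boolP (f \in [:: p; q]).
- have bf : b != f by neqs.
  move: bin fin hh; rewrite !inE => /orP [] /eqP e1 /orP [] /eqP e2.
  + by rewrite e1 e2 eqxx in bf.
  + by rewrite e1 e2.
  + by rewrite e1 e2; apply: edge_flip.
  + by rewrite e1 e2 eqxx in bf.
- rewrite (negPf fn) /= in M3 M4.
  by case: (three b _ _ _ _ bin M3 M4); neqs; rewrite /= !inE; perm_eval.
- rewrite (negPf bn) /= in M1 M2.
  by case: (three f _ _ _ _ fin M1 M2); neqs; rewrite /= !inE; perm_eval.
- apply: (edge_trans hh); apply: edge_sym; clear M1 M2 M3 M4 three; neqs.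
  by apply: (edge_conj hh h2); perm_eval.
Qed.

(** The fifth edge i j forces every partner of a e to contain b, since two points cannot otherwise
    meet [{b,c,d}], [{b,g,h}] and [{b,i,j}]. So b f is the only partner, and [edge_pairN]
    applies. *)
Lemma edge_cross_pairN a b c d e f g h i j :
  uniq [:: a; b; c; d; e; f; g; h; i; j] ->
  E a b c d -> E a b e f -> E a b g h -> E a b i j ->
  v *m rG (tperm a e * tperm b f)%g = - v.
Proof.
move=> U h1 h2 h3 h4.
have hX : E a e b f.
  by apply: (edge_cross _ h1 h2 h3); neqs; rewrite /= !inE; perm_eval.
have ae : a != e by neqs.
have bf : b != f by neqs.
apply: edge_pairN => //; first exact: no_transposition.
  apply/eqP => ee; case: (tperm_eqP ae ee) => -[/eqP + _]; neqs; perm_eval.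
move=> p q pq hh; case: (edge_cases ae (no_transposition ae) pq hh).
- by case=> -> ->; left.
- by case=> -> ->; left; rewrite tpermC.
move=> Up; right.
have M1 : [|| b \in [:: p; q], c \in [:: p; q] | d \in [:: p; q]].
  by apply: (edge_meets _ h1 Up hh); neqs; rewrite /= !inE; perm_eval.
have M2 : [|| b \in [:: p; q], g \in [:: p; q] | h \in [:: p; q]].
  by apply: (edge_meets _ h3 Up hh); neqs; rewrite /= !inE; perm_eval.
have M3 : [|| b \in [:: p; q], i \in [:: p; q] | j \in [:: p; q]].
  by apply: (edge_meets _ h4 Up hh); neqs; rewrite /= !inE; perm_eval.
have bin : b \in [:: p; q].
  apply: contraT => bn; rewrite (negPf bn) /= in M1 M2 M3.
  clear -U M1 M2 M3.
  case/orP: M1 => x1; case/orP: M2 => x2; case/orP: M3 => x3;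
    case: (three_in_pair _ x1 x2 x3); neqs; rewrite /= !inE; perm_eval.
have {}bin : p = b \/ q = b.
  by move: bin; rewrite !inE => /orP [] /eqP ->; [left|right].
have adj x : E a e b x -> x != b -> x = f.
  move=> hx xb; apply/eqP; apply: contraT => xf.
  have : ~~ E b x b f by apply: edge_adjacent; rewrite /= !inE; perm_eval.
  by case/negP; apply: (edge_trans (edge_sym hx)).
case: bin => eb; subst.
  by rewrite (adj q) // eq_sym.
by rewrite tpermC (adj p) //; apply: edge_flip.
Qed.

(** Both [(a e)(b f)] and [(a f)(b e)] act on v by -1, and their product is [(a b)(e f)]. *)
Lemma edge_pair_fix a b c d e f g h i j :
  uniq [:: a; b; c; d; e; f; g; h; i; j] ->
  E a b c d -> E a b e f -> E a b g h -> E a b i j ->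
  v *m rG (tperm e f) = v *m rG (tperm a b).
Proof.
move=> U h1 h2 h3 h4.
have v1 := edge_cross_pairN U h1 h2 h3 h4.
have v2 : v *m rG (tperm a f * tperm b e)%g = - v.
  by apply: (edge_cross_pairN _ h1 (edge_flip h2) h3 h4); neqs; rewrite /= !inE; perm_eval.
have -> : (tperm e f = (tperm a e * tperm b f) * (tperm a f * tperm b e) * tperm a b)%g.
  clear v1 v2 h1 h2 h3 h4; neqs; apply/permP => z.
  have [->|za] := eqVneq z a; first by perm_eval.
  have [->|zb] := eqVneq z b; first by perm_eval.
  have [->|ze] := eqVneq z e; first by perm_eval.
  by have [->|zf] := eqVneq z f; perm_eval.
by rewrite (repr_mxM rG) ?inE // (repr_mxM rG) ?inE // !mulmxA v1 mulNmx v2 opprK.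
Qed.

(** With five edges all members of the class send v to the same vector, so the coset sum is a
    positive multiple of that vector. *)
Lemma class_size_le4 a b c d e f g h i j :
  uniq [:: a; b; c; d; e; f; g; h; i; j] ->
  E a b c d -> E a b e f -> E a b g h -> ~~ E a b i j.
Proof.
move=> U h1 h2 h3; apply/negP => h4.
have ab : a != b by neqs.
have all_same p q : p != q -> E a b p q -> v *m rG (tperm p q) = v *m rG (tperm a b).
  move=> pq hh; case: (edge_cases ab (no_transposition ab) pq hh).
  - by case=> -> ->.
  - by case=> -> ->; rewrite tpermC.
  move=> Up.
  have D u w : uniq [:: a; b; u; w] -> E a b u w ->
      tperm p q = tperm u w \/ uniq [:: u; w; p; q].
    move=> Uu hu; have uw : u != w by neqs.
    case: (edge_cases uw (no_transposition uw) pq (edge_trans (edge_sym hu) hh)).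
    - by case=> -> ->; left.
    - by case=> -> ->; left; rewrite tpermC.
    - by right.
  have [|->|U1] := D c d _ h1; first by neqs; rewrite /= !inE; perm_eval.
    by apply: (edge_pair_fix _ h2 h1 h3 h4); neqs; rewrite /= !inE; perm_eval.
  have [|->|U2] := D e f _ h2; first by neqs; rewrite /= !inE; perm_eval.
    exact: (edge_pair_fix U h1 h2 h3 h4).
  have [|->|U3] := D g h _ h3; first by neqs; rewrite /= !inE; perm_eval.
    by apply: (edge_pair_fix _ h1 h3 h2 h4); neqs; rewrite /= !inE; perm_eval.
  apply: (edge_pair_fix _ h1 hh h2 h3).
  by clear -U Up U1 U2 U3; neqs; rewrite /= !inE; perm_eval.
have := coset_sum (no_transposition ab).
rewrite (eq_bigr (fun=> v *m rG (tperm a b))) => [|y /andP []].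
  rewrite sumr_const -scaler_nat => /eqP; rewrite scaler_eq0 pnatr_eq0.
  case/orP.
    rewrite -leqn0 leqNgt => /negP; apply; apply/card_gt0P; exists (tperm a b).
    by rewrite unfold_in /= class_refl tpermV edge_refl.
  move/eqP => e0; have := double_neq0 (tperm a b).
  by rewrite e0 addr0 eqxx.
move/(tperm_classP _ ab) => [p [q [pq ->]]]; rewrite tpermV; exact: all_same.
Qed.


(** In a class of exactly three edges the terms of the coset sum would all be equal, so that the sum
    could not vanish. *)
Lemma class_size_neq3 a b c d e f : uniq [:: a; b; c; d; e; f] ->
  E a b c d -> E a b e f ->
  exists g h, uniq [:: a; b; c; d; e; f; g; h] /\ E a b g h.
Proof.
move=> U h1 h2; have ab : a != b by neqs.
have [/existsP [g /existsP [h /andP [U8 h3]]]|no] := boolP [exists g, exists h,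
    uniq [:: a; b; c; d; e; f; g; h] && E a b g h]; first by exists g, h.
have disj (u w u' w' : T) : uniq [:: u; w; u'; w'] -> tperm u w != tperm u' w'.
  move=> Uu; apply/eqP; have uw : u' != w' by neqs.
  by case/(tperm_eqP uw) => -[/eqP + _]; neqs; perm_eval.
have S : \sum_(y <- [:: tperm a b; tperm c d; tperm e f]) v *m rG y = 0.
  apply: (edge_sum ab (no_transposition ab)).
  - rewrite /= !inE andbT negb_or !disj //; neqs; rewrite /= !inE; perm_eval.
  - move=> p q pq hh; rewrite !inE.
    case: (edge_cases ab (no_transposition ab) pq hh) => [[-> ->]|[-> ->]|U1].
    + by rewrite eqxx.
    + by rewrite tpermC eqxx.
    apply: contraR no; rewrite !negb_or => /and3P [_ ncd nef].
    apply/existsP; exists p; apply/existsP; exists q; rewrite hh andbT.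
    have D u w : u != w -> E a b u w -> tperm p q != tperm u w -> uniq [:: u; w; p; q].
      move=> uw hu ne.
      case: (edge_cases uw (no_transposition uw) pq (edge_trans (edge_sym hu) hh)) => //.
      + by case=> e1 e2; rewrite e1 e2 eqxx in ne.
      + by case=> e1 e2; rewrite e1 e2 tpermC eqxx in ne.
    have cd : c != d by neqs.
    have ef : e != f by neqs.
    have U2 := D c d cd h1 ncd; have U3 := D e f ef h2 nef.
    by clear -U U1 U2 U3; neqs; rewrite /= !inE; perm_eval.
  - move=> y; rewrite !inE => /or3P [] /eqP ->.
    + by exists a, b; rewrite ab edge_refl.
    + by exists c, d; split=> //; neqs.
    + by exists e, f; split=> //; neqs.
(* [k] interchanges the first two terms and therefore fixes the third; as it commutes with
   [(u1 w1)], it fixes v. *)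
have fix_pair (u w u' w' u1 w1 : T) : uniq [:: u; w; u'; w'; u1; w1] ->
    v *m rG (tperm u w) + v *m rG (tperm u' w') + v *m rG (tperm u1 w1) = 0 ->
    v *m rG (tperm u w) = v *m rG (tperm u' w').
  move=> Uu S0; pose k := (tperm u w * tperm u' w')%g.
  have kV : (k * k = 1)%g.
    clear -Uu; neqs; apply/permP => z; rewrite /k.
    have [->|zu] := eqVneq z u; first by perm_eval.
    have [->|zw] := eqVneq z w; first by perm_eval.
    have [->|zu'] := eqVneq z u'; first by perm_eval.
    by have [->|zw'] := eqVneq z w'; perm_eval.
  have e1 : (tperm u w * k = tperm u' w')%g by rewrite /k tpermKg.
  have e2 : (tperm u' w' * k = tperm u w)%g by rewrite -e1 -mulgA kV mulg1.
  have e3 : (tperm u1 w1 * k = k * tperm u1 w1)%g.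
    rewrite (conjgC _ k) tpermJ; congr (_ * tperm _ _)%g; rewrite /k; clear -Uu; neqs; perm_eval.
  have : v *m rG (tperm u1 w1 * k)%g = v *m rG (tperm u1 w1).
    rewrite (repr_mxM rG) ?inE //; move: (S0) => /(congr1 (mulmxr (rG k))).
    rewrite /= mul0mx !mulmxDl -!mulmxA -!(repr_mxM rG) ?inE // e1 e2 => S1.
    apply: (addrI (v *m rG (tperm u w) + v *m rG (tperm u' w'))).
    by rewrite S0 [X in X + _]addrC.
  rewrite e3 => /(congr1 (mulmxr (rG (tperm u1 w1)))).
  rewrite /= -!mulmxA -!(repr_mxM rG) ?inE // -mulgA tperm2 mulg1 repr_mx1 mulmx1.
  move/(congr1 (mulmxr (rG (tperm u' w')))).
  by rewrite /= -mulmxA -(repr_mxM rG) ?inE // /k -mulgA tperm2 mulg1.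
move: S; rewrite !big_cons big_nil addr0 addrA => S.
have s1 := fix_pair _ _ _ _ _ _ U S.
have s2 : v *m rG (tperm a b) = v *m rG (tperm e f).
  apply: (fix_pair _ _ _ _ c d); last by rewrite addrAC.
  by neqs; rewrite /= !inE; perm_eval.
move: S; rewrite -s1 -s2 -mulr2n -mulrSr -scaler_nat => /eqP.
rewrite scaler_eq0 pnatr_eq0 /= => /eqP e0; have := double_neq0 (tperm a b).
by rewrite e0 addr0 eqxx.
Qed.

(** For a ninth point x, the partner of a x has the form b y. Here y is a tenth point, since
    [edge_cross] ties each edge from b to c, ..., h to another edge at a. Conjugation by
    [(a x)(b y)] then makes x y a fifth edge of the class. *)
Lemma class_size4_card a b c d e f g h : uniq [:: a; b; c; d; e; f; g; h] ->
  E a b c d -> E a b e f -> E a b g h -> #|T| = 8.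
Proof.
move=> U h1 h2 h3.
have le8 : (8 <= #|T|)%N.
  by have := max_card (mem [:: a; b; c; d; e; f; g; h]); rewrite (card_uniqP U).
apply/eqP; rewrite eqn_leq le8 andbT leqNgt; apply/negP => lt8.
have [x xn] := @fresh [:: a; b; c; d; e; f; g; h] lt8.
have ax : a != x by neqs; rewrite eq_sym.
have [p [q [Up hh]]] := edge_disjoint ax (no_transposition ax).
have M1 : [|| b \in [:: p; q], c \in [:: p; q] | d \in [:: p; q]].
  by apply: (edge_meets _ h1 Up hh); neqs; rewrite /= !inE; perm_eval.
have M2 : [|| b \in [:: p; q], e \in [:: p; q] | f \in [:: p; q]].
  by apply: (edge_meets _ h2 Up hh); neqs; rewrite /= !inE; perm_eval.
have M3 : [|| b \in [:: p; q], g \in [:: p; q] | h \in [:: p; q]].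
  by apply: (edge_meets _ h3 Up hh); neqs; rewrite /= !inE; perm_eval.
have bin : b \in [:: p; q].
  apply: contraT => bn; rewrite (negPf bn) /= in M1 M2 M3.
  clear -U M1 M2 M3.
  case/orP: M1 => x1; case/orP: M2 => x2; case/orP: M3 => x3;
    case: (three_in_pair _ x1 x2 x3); neqs; rewrite /= !inE; perm_eval.
have [y [Uy hy]] : exists y, uniq [:: a; x; b; y] /\ E a x b y.
  move: bin; rewrite !inE => /orP [] /eqP eb; subst b; first by exists q.
  exists p; split; last exact: edge_flip.
  by neqs; rewrite /= !inE; perm_eval.
have nX u w : E a u b w -> uniq [:: a; u; x] -> y = w -> False.
  move=> hu Uu ey; subst w; case/negP: (edge_adjacent Uu).
  exact: edge_trans hu (edge_sym hy).
have yn : y \notin [:: c; d; e; f; g; h].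
  apply/negP; rewrite !inE => /orP [|/orP [|/or4P []]] /eqP.
  - apply: (nX d); last by neqs; rewrite /= !inE; perm_eval.
    by apply: (edge_cross _ h2 (edge_flip h1) h3); neqs; rewrite /= !inE; perm_eval.
  - apply: (nX c); last by neqs; rewrite /= !inE; perm_eval.
    by apply: (edge_cross _ h2 h1 h3); neqs; rewrite /= !inE; perm_eval.
  - apply: (nX f); last by neqs; rewrite /= !inE; perm_eval.
    by apply: (edge_cross _ h1 (edge_flip h2) h3); neqs; rewrite /= !inE; perm_eval.
  - apply: (nX e); last by neqs; rewrite /= !inE; perm_eval.
    by apply: (edge_cross _ h1 h2 h3); neqs; rewrite /= !inE; perm_eval.
  - apply: (nX h); last by neqs; rewrite /= !inE; perm_eval.
    by apply: (edge_cross _ h1 (edge_flip h3) h2); neqs; rewrite /= !inE; perm_eval.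
  - apply: (nX g); last by neqs; rewrite /= !inE; perm_eval.
    by apply: (edge_cross _ h1 h3 h2); neqs; rewrite /= !inE; perm_eval.
have U10 : uniq [:: a; b; c; d; e; f; g; h; x; y].
  by clear -U xn Uy yn; neqs; rewrite /= !inE; perm_eval.
case/negP: (class_size_le4 U10 h1 h2 h3); apply: (edge_trans h1); apply: edge_sym.
by clear M1 M2 M3; neqs; apply: (edge_conj h1 hy); perm_eval.
Qed.

(** Let a b and c d be partners. The partner of a c is not b d by [no_square], and it cannot avoid
    both b and d, for conjugation by [(a b)(c d)] would again give b d. So it joins b or d to a
    fifth point; [pentad] shows that this leaves no room for a sixth. *)
Lemma class_size2_card :
  (forall a b c d e f, uniq [:: a; b; c; d; e; f] -> E a b c d -> ~~ E a b e f) ->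
  #|T| = 5.
Proof.
move=> only; apply/eqP; rewrite eqn_leq card_T andbT leqNgt; apply/negP => lt5.
have only2 a b c d p q : uniq [:: a; b; c; d] -> E a b c d -> p != q -> E a b p q ->
    [\/ p = a \/ p = b, p = c /\ q = d | p = d /\ q = c].
  move=> U h pq hh; have ab : a != b by neqs.
  have cd : c != d by neqs.
  case: (edge_cases ab (no_transposition ab) pq hh) => [[-> _]|[-> _]|U1].
  - by constructor 1; left.
  - by constructor 1; right.
  case: (edge_cases cd (no_transposition cd) pq (edge_trans (edge_sym h) hh)) => [|e|U2].
  - by constructor 2.
  - by constructor 3.
  have U6 : uniq [:: a; b; c; d; p; q].
    by clear -U U1 U2; neqs; rewrite /= !inE; perm_eval.
  by have := only _ _ _ _ _ _ U6 h; rewrite hh.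
have minus a b c d : uniq [:: a; b; c; d] -> E a b c d ->
    v *m rG (tperm a b * tperm c d)%g = - v.
  move=> U h; have ab : a != b by neqs.
  apply: edge_pairN => //; [by neqs|exact: no_transposition| |].
    by apply/eqP => ee; case: (tperm_eqP ab ee) => -[/eqP + _]; neqs; perm_eval.
  move=> p q pq hh; case: (edge_cases ab (no_transposition ab) pq hh).
  - by case=> -> ->; left.
  - by case=> -> ->; left; rewrite tpermC.
  move=> U1; right; case: (only2 _ _ _ _ _ _ U h pq hh) => [ee|[-> ->] //|[-> ->]].
    by case: ee => ee; move: U1; rewrite ee /= !inE eqxx ?orbT ?andbF.
  by rewrite tpermC.
(* All three pairings of the four points would act on v by -1, yet one is the product of the other
   two. *)
have no_square a b c d : uniq [:: a; b; c; d] -> E a b c d -> ~~ E a c b d.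
  move=> U h; apply/negP => h1.
  have U1 : uniq [:: a; c; b; d] by neqs; rewrite /= !inE; perm_eval.
  have U2 : uniq [:: a; d; b; c] by neqs; rewrite /= !inE; perm_eval.
  have ee : (tperm a d * tperm b c = tperm a b * tperm c d * (tperm a c * tperm b d))%g.
    clear -U; neqs; apply/permP => z.
    have [->|za] := eqVneq z a; first by perm_eval.
    have [->|zb] := eqVneq z b; first by perm_eval.
    have [->|zc] := eqVneq z c; first by perm_eval.
    by have [->|zd] := eqVneq z d; perm_eval.
  have h2 : E a d b c by rewrite ee groupM.
  have := minus _ _ _ _ U2 h2; rewrite ee (repr_mxM rG) ?inE // mulmxA.
  rewrite (minus _ _ _ _ U h) mulNmx (minus _ _ _ _ U1 h1) opprK => /eqP.
  rewrite -addr_eq0 => /eqP; have := double_neq0 1%g.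
  by rewrite repr_mx1 mulmx1 => /eqP.
have pentad a b c d x : uniq [:: a; b; c; d; x] -> E a b c d -> ~~ E a c b x.
  move=> U h; apply/negP => h1.
  (* Conjugation completes the two given pairs to five, which use up all ten edges on the five
     points. An edge a y to a sixth point then finds no partner p q, wherever p and q lie. *)
  have h2 : E a x b d.
    by apply: edge_sym; clear only only2 minus no_square; neqs;
      apply: (edge_conj h1 h); perm_eval.
  have h3 : E a d c x.
    by apply: edge_sym; clear only only2 minus no_square; neqs;
      apply: (edge_conj h h1); perm_eval.
  have h4 : E b c d x.
    by apply: edge_sym; clear only only2 minus no_square; neqs;
      apply: (edge_conj (edge_sym h3) h); perm_eval.
  have [y yn] := @fresh [:: a; b; c; d; x] lt5.
  have ay : a != y by neqs; rewrite eq_sym.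
  have [p [q [Up hh]]] := edge_disjoint ay (no_transposition ay).
  have yL z : z \in [:: a; b; c; d; x] -> y <> z by move=> zin e; rewrite e zin in yn.
  pose Q u w := exists s t, [/\ s \in [:: a; b; c; d; x], t \in [:: a; b; c; d; x],
                                uniq [:: u; w; s; t] & E u w s t].
  have table u w : u \in [:: b; c; d; x] -> w \in [:: b; c; d; x] -> u != w -> Q u w.
    have tab u1 w1 s t : uniq [:: u1; w1; s; t] -> E u1 w1 s t ->
        s \in [:: a; b; c; d; x] -> t \in [:: a; b; c; d; x] ->
        u = u1 /\ w = w1 \/ u = w1 /\ w = u1 -> Q u w.
      move=> U1 h5 sL tL [] [-> ->]; exists s, t; split=> //.
        by neqs; rewrite /= !inE; perm_eval.
      by rewrite (tpermC w1).
    have [aL bL cL dL] : [/\ a \in [:: a; b; c; d; x], b \in [:: a; b; c; d; x],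
        c \in [:: a; b; c; d; x] & d \in [:: a; b; c; d; x]].
      by rewrite !inE !eqxx !orbT.
    have xL : x \in [:: a; b; c; d; x] by rewrite !inE eqxx !orbT.
    have bd_ : u = b /\ w = d \/ u = d /\ w = b -> Q u w.
      by apply: (tab b d a x _ (edge_sym h2)) => //; clear -U; neqs; rewrite /= !inE; perm_eval.
    have bx_ : u = b /\ w = x \/ u = x /\ w = b -> Q u w.
      by apply: (tab b x a c _ (edge_sym h1)) => //; clear -U; neqs; rewrite /= !inE; perm_eval.
    have cd_ : u = c /\ w = d \/ u = d /\ w = c -> Q u w.
      by apply: (tab c d a b _ (edge_sym h)) => //; clear -U; neqs; rewrite /= !inE; perm_eval.
    have cx_ : u = c /\ w = x \/ u = x /\ w = c -> Q u w.
      by apply: (tab c x a d _ (edge_sym h3)) => //; clear -U; neqs; rewrite /= !inE; perm_eval.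
    have bc_ : u = b /\ w = c \/ u = c /\ w = b -> Q u w.
      by apply: (tab b c d x _ h4) => //; clear -U; neqs; rewrite /= !inE; perm_eval.
    have dx_ : u = d /\ w = x \/ u = x /\ w = d -> Q u w.
      by apply: (tab d x b c _ (edge_sym h4)) => //; clear -U; neqs; rewrite /= !inE; perm_eval.
    rewrite !inE => /or4P [] /eqP eu /or4P [] /eqP ew uw;
      first [by rewrite eu ew eqxx in uw
            |apply: bd_; by [left|right]|apply: bx_; by [left|right]
            |apply: cd_; by [left|right]|apply: cx_; by [left|right]
            |apply: bc_; by [left|right]|apply: dx_; by [left|right]].
  have spoke u : u \in [:: b; c; d; x] ->
      exists s t, [/\ s \in [:: b; c; d; x], t \in [:: b; c; d; x],
                      uniq [:: a; u; s; t] & E a u s t].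
    have D1 : uniq [:: a; b; c; d] by clear -U; neqs; rewrite /= !inE; perm_eval.
    have D2 : uniq [:: a; c; b; x] by clear -U; neqs; rewrite /= !inE; perm_eval.
    have D3 : uniq [:: a; d; c; x] by clear -U; neqs; rewrite /= !inE; perm_eval.
    have D4 : uniq [:: a; x; b; d] by clear -U; neqs; rewrite /= !inE; perm_eval.
    rewrite !inE => /or4P [] /eqP ->.
    - by exists c, d; rewrite !inE !eqxx ?orbT.
    - by exists b, x; rewrite !inE !eqxx ?orbT.
    - by exists c, x; rewrite !inE !eqxx ?orbT.
    - by exists b, d; rewrite !inE !eqxx ?orbT.
  have sub z : z \in [:: b; c; d; x] -> z \in [:: a; b; c; d; x].
    by rewrite [in X in _ -> X]inE => ->; rewrite orbT.
  (* Conjugation by [(a y)(u w)] fixes the partner s t of a u, so y w would be a third edge in that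
     class. *)
  have mixed u w : u \in [:: b; c; d; x] -> w \notin [:: a; b; c; d; x] ->
      uniq [:: a; y; u; w] -> E a y u w -> False.
    move=> uL wL Uu hu; have [s [t [sL tL Us hs]]] := spoke u uL.
    have yw : y != w by neqs.
    have h5 : E a u y w.
      apply: (edge_trans hs); apply: edge_sym.
      have [ns nt] : s != y /\ t != y.
        by split; apply/eqP => e; [move: (yL s (sub s sL))|move: (yL t (sub t tL))]; rewrite e.
      have [ns' nt'] : s != w /\ t != w.
        by split; apply: contraNneq wL => <-; apply: sub.
      apply: (edge_conj hs hu); clear -Uu Us ns nt ns' nt'; neqs; perm_eval.
    case: (only2 _ _ _ _ _ _ Us hs yw h5) => [[e|e]|[e _]|[e _]].
    - by case: (yL a) => //; rewrite inE eqxx.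
    - by case: (yL u (sub u uL)).
    - by case: (yL s (sub s sL)).
    - by case: (yL t (sub t tL)).
  have pL' z : z \in [:: p; q] -> z \notin [:: b; c; d; x] -> z \notin [:: a; b; c; d; x].
    move=> zp zn; rewrite inE negb_or zn andbT; apply: contraTneq zp => ->.
    by clear -Up; neqs; rewrite !inE; perm_eval.
  have [pL|pn] := boolP (p \in [:: b; c; d; x]); have [qL|qn] := boolP (q \in [:: b; c; d; x]).
  - have pq : p != q by neqs.
    have [s [t [sL tL Us hs]]] := table p q pL qL pq.
    case: (only2 _ _ _ _ _ _ Us hs ay (edge_sym hh)) => [ea|[_ ey]|[_ ey]].
    + by clear -ea Up; neqs; case: ea => /eqP; perm_eval.
    + by case: (yL t).
    + by case: (yL s).
  - apply: (mixed p q) => //; apply: pL' => //; by rewrite !inE eqxx orbT.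
  - apply: (mixed q p) => //; last exact: edge_flip.
      by apply: pL' => //; rewrite !inE eqxx.
    by clear -Up; neqs; rewrite /= !inE; perm_eval.
  - have {}pn : p \notin [:: a; b; c; d; x] by apply: pL' => //; rewrite inE eqxx.
    have {}qn : q \notin [:: a; b; c; d; x] by apply: pL' => //; rewrite !inE eqxx orbT.
    have h5 : E a b y b.
      apply: (edge_trans h); apply: edge_sym.
      by apply: (edge_conj h hh); clear -U yn Up pn qn; neqs; perm_eval.
    have yb : y != b by neqs.
    have D1 : uniq [:: a; b; c; d] by clear -U; neqs; rewrite /= !inE; perm_eval.
    case: (only2 _ _ _ _ _ _ D1 h yb h5) => [[e|e]|[e _]|[e _]].
    + by case: (yL a) => //; rewrite inE eqxx.
    + by case/eqP: yb.
    + by case: (yL c) => //; rewrite !inE eqxx !orbT.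
    + by case: (yL d) => //; rewrite !inE eqxx !orbT.
have [a [b [ab abH]]] := not_full.
have [c [d [U h]]] := edge_disjoint ab abH.
have ac : a != c by neqs.
have [p [q [Up hh]]] := edge_disjoint ac (no_transposition ac).
have acbd := no_square _ _ _ _ U h.
have bcase z : uniq [:: a; c; b; z] -> z != d -> E a c b z -> False.
  move=> Uz zd hz; have U5 : uniq [:: a; b; c; d; z].
    by clear -U Uz zd; neqs; rewrite /= !inE; perm_eval.
  by have := pentad _ _ _ _ _ U5 h; rewrite hz.
have dcase z : uniq [:: a; c; d; z] -> z != b -> E a c d z -> False.
  move=> Uz zd hz; have U5 : uniq [:: c; d; a; b; z].
    by clear -U Uz zd; neqs; rewrite /= !inE; perm_eval.
  by have := pentad _ _ _ _ _ U5 (edge_sym h); rewrite (tpermC c) hz.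
have flipU u w : uniq [:: a; c; u; w] -> uniq [:: a; c; w; u].
  by clear => Uu; neqs; rewrite /= !inE; perm_eval.
have [e|pb] := eqVneq p b.
  subst p; have [e|qd] := eqVneq q d; first by rewrite -e hh in acbd.
  exact: bcase qd hh.
have [e|qb] := eqVneq q b.
  subst q; have [e|pd] := eqVneq p d; first by rewrite -e (edge_flip hh) in acbd.
  exact: bcase (flipU _ _ Up) pd (edge_flip hh).
have [e|pd] := eqVneq p d; first by subst p; apply: dcase hh.
have [e|qd] := eqVneq q d.
  by subst q; apply: dcase (flipU _ _ Up) pb (edge_flip hh).
case/negP: acbd; apply: (edge_trans hh); apply: edge_sym.
by apply: (edge_conj hh h); clear -U Up pb qb pd qd; neqs; perm_eval.
Qed.

Lemma card_5_or_8 : #|T| = 5 \/ #|T| = 8.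
Proof.
have [/existsP [a /existsP [b /existsP [c /existsP [d /existsP [e /existsP [f]]]]]]|no] :=
  boolP [exists a, exists b, exists c, exists d, exists e, exists f,
    [&& uniq [:: a; b; c; d; e; f], E a b c d & E a b e f]].
  case/and3P=> U h1 h2; right.
  have [g [h [U8 h3]]] := class_size_neq3 U h1 h2.
  exact: class_size4_card U8 h1 h2 h3.
left; apply: class_size2_card => a b c d e f U h1; apply: contraNN no => h2.
by do 6![apply/existsP; eexists]; apply/and3P; split; [exact: U|exact: h1|exact: h2].
Qed.

End Blocks.


(** The outcomes are one block, two blocks exchanged by the odd permutations, and the exceptional
    systems. The third records the absence of transpositions in H because that makes their class sum
    vanish. *)
Theorem block_stabilizer (C : numFieldType) (T : finType) (m : nat)
    (rG : mx_representation C [set: {perm T}] m) (H : {group {perm T}}) (v : 'rV[C]_m) :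
  (4 < #|T|)%N -> v != 0 ->
  (forall x, x \notin H ->
     \sum_(y in (x ^: [set: {perm T}])%g | (x * y^-1)%g \in H) v *m rG y = 0) ->
  [\/ forall a b, tperm a b \in H,
      forall s : {perm T}, (s \in H) = ~~ odd_perm s |
      (forall a b, a != b -> tperm a b \notin H) /\ (#|T| = 5 \/ #|T| = 8)].
Proof.
move=> T4 v0 cs.
have [/existsP [a /existsP [b abH]]|full] :=
  boolP [exists a, exists b, tperm a b \notin H]; last first.
  constructor 1 => a b; apply: contraNT full => abH.
  by apply/existsP; exists a; apply/existsP; exists b.
have [/existsP [p /existsP [q /existsP [r /and3P [U pqH h]]]]|tri] :=
  boolP [exists p, exists q, exists r, [&& uniq [:: p; q; r], tperm p q \notin H &
           (tperm p q * tperm q r)%g \in H]].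
  by constructor 2; apply: (clique_alternating v0 cs U pqH h).
have matching p q r : uniq [:: p; q; r] -> (tperm p q * tperm q r)%g \in H -> tperm p q \in H.
  move=> U h; apply: contraNT tri => pqH.
  by do 3![apply/existsP; eexists]; apply/and3P; split; [exact: U|exact: pqH|exact: h].
have ab : a != b by apply: contraNneq abH => ->; rewrite tperm1 group1.
have nf : exists a b, a != b /\ tperm a b \notin H by exists a, b.
constructor 3; split; first by move=> x y; apply: (no_transposition v0 cs).
exact: (card_5_or_8 v0 cs).
Qed.

(** * Specht modules *)

Section Tableaux.

Variables (n : nat) (la : seq nat).
Local Notation D := (diagram n la).
Local Notation tab := {ffun 'I_n -> 'I_n * 'I_n}.
Implicit Types (t s : tab) (w : {ffun 'I_n -> 'I_n}).

Definition column_closed := forall i j i' : 'I_n, (i, j) \in D -> (i' <= i)%N -> (i', j) \in D.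

Lemma tableau_inj t : is_tableau la t -> injective t.
Proof. by case/andP => /injectiveP. Qed.

Lemma tableau_mem t x : is_tableau la t -> t x \in D.
Proof. by case/andP=> _ /eqP <-; apply: imset_f. Qed.

Lemma tableau_surj t c : is_tableau la t -> c \in D -> exists x, t x = c.
Proof. by case/andP=> _ /eqP <- /imsetP [x _ ->]; exists x. Qed.

Lemma card_tableau t : is_tableau la t -> #|D| = n.
Proof.
by case/andP=> /injectiveP ti /eqP <-; rewrite card_imset // card_ord.
Qed.

Lemma tableauP t : #|D| = n -> injective t -> (forall x, t x \in D) -> is_tableau la t.
Proof.
move=> cD ti tD; apply/andP; split; first exact/injectiveP.
rewrite eqEcard cD card_imset // card_ord leqnn andbT.
by apply/subsetP => c /imsetP [x _ ->].
Qed.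

Lemma tableau_relabel t s : is_tableau la t -> is_tableau la s ->
  exists q : 'S_n, s = relabel t q.
Proof.
move=> ht hs; have f_ex x : exists y, t x == s y.
  by have [y <-] := tableau_surj hs (tableau_mem x ht); exists y.
pose f x := xchoose (f_ex x).
have fE x : t x = s (f x) by apply/eqP; exact: (xchooseP (f_ex x)).
have fI : injective f by move=> x y e; apply: (tableau_inj ht); rewrite !fE e.
exists (perm fI); apply/ffunP => x; rewrite ffunE fE; congr (s _).
by rewrite -[in LHS](permKV (perm fI) x) permE.
Qed.

Definition column_injective t w := forall x y, (t x).2 = (t y).2 -> w x = w y -> x = y.

Definition below w k := [set x : 'I_n | (w x < k)%N].

Section Dominance.

Variables (t : tab) (w : {ffun 'I_n -> 'I_n}).
Hypotheses (closed : column_closed) (ht : is_tableau la t) (wi : column_injective t w).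

(** Either the whole column j lies in the first k rows of t, or it fills all of these rows; in the
    second case column injectivity bounds the left side by k. *)
Lemma card_column_below (j : 'I_n) k :
  (#|[set x in below w k | (t x).2 == j]| <= #|[set x in below (tabloid t) k | (t x).2 == j]|)%N.
Proof.
have [/forallP all_lt|/forallPn [x0]] := boolP [forall x, ((t x).2 == j) ==> ((t x).1 < k)%N].
  apply/subset_leq_card/subsetP => x; rewrite !inE => /andP [_ xj].
  by rewrite xj ffunE andbT (implyP (all_lt x)).
rewrite negb_imply -leqNgt => /andP [/eqP x0j kx0].
have kn : (k <= n)%N by apply: leq_trans kx0 (ltnW (ltn_ord _)).
apply: (@leq_trans k).
  rewrite -[X in (_ <= X)%N](size_iota 0 k) cardE.
  rewrite -(size_map (fun x => w x : nat)); apply: uniq_leq_size.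
    rewrite map_inj_in_uniq ?enum_uniq // => x y; rewrite !mem_enum !inE.
    by move=> /andP [_ /eqP xj] /andP [_ /eqP yj] /val_inj; apply: wi; rewrite xj yj.
  by move=> _ /mapP [x + ->]; rewrite mem_enum !inE mem_iota => /andP [].
have g_ex (i : 'I_k) : exists y, t y == (widen_ord kn i, j).
  have iD : (widen_ord kn i, j) \in D.
    apply: (closed (i := (t x0).1)); last exact: leq_trans (ltnW (ltn_ord i)) kx0.
    by rewrite -x0j -surjective_pairing tableau_mem.
  by have [y <-] := tableau_surj ht iD; exists y.
pose g i := xchoose (g_ex i).
have gE i : t (g i) = (widen_ord kn i, j) by apply/eqP; exact: (xchooseP (g_ex i)).
have gi : injective g by move=> x y e; move: (gE x); rewrite e gE => -[] /val_inj.
rewrite -{1}(card_ord k) -(card_imset _ gi).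
apply/subset_leq_card/subsetP => _ /imsetP [i _ ->].
by rewrite !inE ffunE gE /= eqxx ltn_ord.
Qed.

Lemma card_columns (A : {set 'I_n}) :
  #|A| = (\sum_(j < n) #|[set x in A | (t x).2 == j]|)%N.
Proof.
rewrite -sum1_card (partition_big (fun x => (t x).2) predT) //=.
by apply: eq_bigr => j _; rewrite -sum1_card; apply: eq_bigl => x; rewrite !inE.
Qed.

Lemma card_below k : (#|below w k| <= #|below (tabloid t) k|)%N.
Proof.
rewrite [X in (X <= _)%N]card_columns [X in (_ <= X)%N]card_columns.
by apply: leq_sum => j _; apply: card_column_below.
Qed.

(** Equality of the totals forces equality in each column, so the pairs formed by [w x] and the
    column of x are the cells of a second tableau with the same columns as t. *)
Lemma column_relabel : (forall k, #|below w k| = #|below (tabloid t) k|) ->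
  exists2 q, q \in column_stab t & w = tabloid (relabel t q).
Proof.
move=> eq_card.
have eq_col (j : 'I_n) k : #|[set x in below w k | (t x).2 == j]| =
    #|[set x in below (tabloid t) k | (t x).2 == j]|.
  have := leqif_sum (fun j (_ : true) => leqif_eq (card_column_below j k)).
  rewrite -!card_columns => -[_]; rewrite eq_card eqxx => /esym/forallP/(_ j).
  by move=> /eqP.
(* If the cell were missing, the column would have at most [w x] cells; equality of the counts would
   then give [w y < w x] for all its entries y, including x. *)
have wD x : (w x, (t x).2) \in D.
  apply: contraT => nD; have := eq_col (t x).2 (w x).
  have -> : [set y in below (tabloid t) (w x) | (t y).2 == (t x).2] =
            [set y | (t y).2 == (t x).2].
    apply/setP => y; rewrite !inE ffunE; case: eqP => [ej|]; rewrite ?andbF ?andbT //.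
    rewrite ltnNge; apply: contraNN nD; apply: closed; rewrite -ej -surjective_pairing.
    exact: tableau_mem.
  move=> e; have := subset_leqif_cards (A := [set y in below w (w x) | (t y).2 == (t x).2])
     (B := [set y | (t y).2 == (t x).2]).
  case=> [|_]; first by apply/subsetP => y; rewrite !inE => /andP [].
  rewrite e eqxx => /esym/eqP/setP/(_ x).
  by rewrite !inE eqxx ltnn.
pose s : tab := [ffun x => (w x, (t x).2)].
have hs : is_tableau la s.
  apply: (tableauP (card_tableau ht)); last by move=> x; rewrite ffunE.
  by move=> x y; rewrite !ffunE => -[h1 h2]; apply: wi h2 h1.
have [q eq_s] := tableau_relabel ht hs.
exists q; last by rewrite -eq_s; apply/ffunP => x; rewrite !ffunE.
rewrite inE; apply/forallP => x; apply/eqP.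
by have := congr1 (fun u : tab => (u (q x)).2) eq_s; rewrite !ffunE permK /=.
Qed.

End Dominance.

End Tableaux.

Section ColumnStabilizer.

Variables (n : nat) (t : {ffun 'I_n -> 'I_n * 'I_n}).

Lemma column_stabP (q : 'S_n) : reflect (forall x, (t (q x)).2 = (t x).2) (q \in column_stab t).
Proof. by rewrite inE; apply: (iffP forallP) => h x; apply/eqP. Qed.

Lemma column_stab_group_set : group_set (column_stab t).
Proof.
apply/group_setP; split; first by apply/column_stabP => x; rewrite perm1.
move=> q r /column_stabP hq /column_stabP hr; apply/column_stabP => x.
by rewrite permM hr hq.
Qed.

Canonical column_stab_group := Group column_stab_group_set.

End ColumnStabilizer.

(** * Column antisymmetrizers and irreducibility of Specht modules *)

Section SpechtModule.

Variables (C : numFieldType) (n : nat) (la : seq nat).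
Local Notation D := (diagram n la).
Local Notation tab := {ffun 'I_n -> 'I_n * 'I_n}.
Local Notation word := {ffun 'I_n -> 'I_n}.
Implicit Types (t s : tab) (w : word).

Definition kappa t : 'M[C]_#|word| :=
  \sum_(q in column_stab t) (-1) ^+ q *: word_mx C q.

Lemma word_vec_kappa w t :
  word_vec C w *m kappa t = \sum_(q in column_stab t) (-1) ^+ q *: word_vec C (relabel w q).
Proof.
rewrite mulmx_sumr; apply: eq_bigr => q _.
by rewrite -scalemxAr word_vec_mx.
Qed.

Lemma tabloid_relabel t q : tabloid (relabel t q) = relabel (tabloid t) q.
Proof. by apply/ffunP => x; rewrite !ffunE. Qed.

Lemma tabloid_kappa t : word_vec C (tabloid t) *m kappa t = polytabloid C t.
Proof.
rewrite word_vec_kappa; apply: eq_bigr => q _; by rewrite tabloid_relabel.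
Qed.

Lemma polytabloid_relabel t q : q \in column_stab t ->
  polytabloid C (relabel t q) = (-1) ^+ q *: polytabloid C t.
Proof.
move=> hq; rewrite -polytabloid_act -tabloid_kappa !word_vec_kappa.
rewrite mulmx_suml scaler_sumr [RHS](reindex_inj (mulIg q)) /=.
apply: eq_big => [r|r _]; first by rewrite groupMr.
rewrite -scalemxAl word_vec_mx relabelM scalerA odd_permM -signr_addb.
by rewrite addbC -addbA addbb addbF.
Qed.

Lemma polytabloid_kappa t :
  polytabloid C t *m kappa t = #|column_stab t|%:R *: polytabloid C t.
Proof.
rewrite mulmx_sumr (eq_bigr (fun=> polytabloid C t)) => [|q hq].
  by rewrite sumr_const scaler_nat.
rewrite -scalemxAr polytabloid_act polytabloid_relabel // scalerA -signr_addb addbb.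
by rewrite scale1r.
Qed.

(** The odd element [(x y)] of the column stabilizer fixes w, so the signed sum equals its own
    negative. *)
Lemma word_kappa_eq0 w t x y : x != y -> (t x).2 = (t y).2 -> w x = w y ->
  word_vec C w *m kappa t = 0.
Proof.
move=> xy txy wxy; rewrite word_vec_kappa; set S := \sum_(_ in _) _.
have hxy : tperm x y \in column_stab t.
  by apply/column_stabP => z; case: tpermP => [->|->|].
have : S = - S.
  rewrite {1}/S (reindex_inj (mulgI (tperm x y))) /= -sumrN.
  apply: eq_big => [q|q _]; first by rewrite groupMl.
  rewrite odd_permM odd_tperm xy -relabelM signr_addb expr1 mulN1r scaleNr.
  congr (- (_ *: word_vec C (relabel _ q))); apply/ffunP => z; rewrite ffunE tpermV.
  by case: tpermP => [->|->|].
move/eqP; rewrite -addr_eq0 -mulr2n -scaler_nat scaler_eq0 pnatr_eq0 /=.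
by move/eqP.
Qed.

Lemma kappa_absorb t q : q \in column_stab t ->
  word_mx C q *m kappa t = (-1) ^+ q *: kappa t.
Proof.
move=> hq; rewrite mulmx_sumr scaler_sumr [RHS](reindex_inj (mulgI q)) /=.
apply: eq_big => [r|r _]; first by rewrite groupMl.
rewrite -scalemxAr -(repr_mxM (word_repr C n)) ?inE // scalerA odd_permM -signr_addb.
by rewrite addbA addbb addFb.
Qed.

Lemma word_vec_coef w w' : word_vec C w 0 (enum_rank w') = (w == w')%:R.
Proof. by rewrite mxE eqxx (inj_eq enum_rank_inj) eq_sym. Qed.

Lemma polytabloid_coef t w : polytabloid C t 0 (enum_rank w) =
  \sum_(q in column_stab t | tabloid (relabel t q) == w) (-1) ^+ q.
Proof.
rewrite summxE big_mkcondr; apply: eq_bigr => q _.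
by rewrite mxE word_vec_coef; case: eqP; rewrite ?mulr1 ?mulr0.
Qed.

Lemma polytabloid_coef1 t : injective t -> polytabloid C t 0 (enum_rank (tabloid t)) = 1.
Proof.
move=> ti; rewrite polytabloid_coef (big_pred1 1%g) ?odd_perm1 // => q.
apply/andP/eqP => [[/column_stabP hq /eqP/ffunP ht]|->]; last first.
  split; first exact: group1.
  by apply/eqP/ffunP => x; rewrite !ffunE invg1 perm1.
apply/permP => x; rewrite perm1; apply: ti; apply/eqP.
have := ht (q x); rewrite !ffunE permK => h.
by rewrite -pair_eqE /pair_eq /= hq h !eqxx.
Qed.

Lemma polytabloid_neq0 t : injective t -> polytabloid C t != 0.
Proof.
move=> ti; apply: contraTneq (oner_neq0 C) => e0.
by rewrite -(polytabloid_coef1 ti) e0 mxE eqxx.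
Qed.

Lemma polytabloid_specht t : is_tableau la t -> (polytabloid C t <= specht_mx C n la)%MS.
Proof. by move=> ht; rewrite (sumsmx_sup t) // genmxE. Qed.

Lemma specht_generated t m (A : 'M_(m, #|word|)) : is_tableau la t ->
  mxmodule (word_repr C n) A -> (polytabloid C t <= A)%MS -> (specht_mx C n la <= A)%MS.
Proof.
move=> ht modA tA; apply/sumsmx_subP => s hs; rewrite genmxE.
have [q ->] := tableau_relabel ht hs; rewrite -polytabloid_act.
by apply: (mxmodule_trans modA) => //; rewrite inE.
Qed.

(** If two entries in a column of t share a row of s, the product vanishes. Otherwise, both tableaux
    having the same shape, the equality case of dominance makes the tabloid of s a column
    permutation of that of t. *)
Lemma tableau_kappa t s : column_closed n la -> is_tableau la t -> is_tableau la s ->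
  (word_vec C (tabloid s) *m kappa t <= polytabloid C t)%MS.
Proof.
move=> closed ht hs; set w := tabloid s.
have [/forallP wi|] := boolP [forall x, forall y,
    [&& (t x).2 == (t y).2 & w x == w y] ==> (x == y)].
  have {}wi : column_injective t w.
    move=> x y e1 e2; have /forallP/(_ y) := wi x.
    by rewrite e1 e2 !eqxx /= => /eqP.
  have [|q hq ->] := column_relabel closed ht wi.
    move=> k; have [q eq_s] := tableau_relabel ht hs.
    rewrite -(card_imset _ (@perm_inj _ q^-1%g)); apply: eq_card => x.
    apply/imsetP/idP => [[y + ->]|]; rewrite /w eq_s !inE !ffunE //.
    by move=> xk; exists (q x); rewrite ?permK // !inE !ffunE permK.
  rewrite tabloid_relabel -word_vec_mx -mulmxA kappa_absorb // -scalemxAr scalemx_sub //.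
  by rewrite tabloid_kappa.
case/forallPn=> x /forallPn [y]; rewrite negb_imply => /andP [/andP [/eqP e1 /eqP e2] xy].
by rewrite (word_kappa_eq0 xy e1 e2) sub0mx.
Qed.

Lemma specht_kappa t : column_closed n la -> is_tableau la t ->
  (specht_mx C n la *m kappa t <= polytabloid C t)%MS.
Proof.
move=> closed ht; rewrite sumsmxMr; apply/sumsmx_subP => s hs.
rewrite (eqmxMr _ (genmxE _)) mulmx_suml; apply: summx_sub => q _.
rewrite -scalemxAl scalemx_sub //; apply: tableau_kappa => //.
exact: is_tableau_relabel.
Qed.

Lemma column_stab_card t : #|column_stab t|%:R != 0 :> C.
Proof. by rewrite pnatr_eq0 -lt0n cardG_gt0. Qed.

(** [kappa t] maps the Specht module into the line of the polytabloid and multiplies the latter by a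
    nonzero scalar. For a submodule U with Maschke complement W it is thus nonzero on one of the
    two, and that one contains the polytabloid, which generates everything. *)
Lemma specht_simple t : column_closed n la -> is_tableau la t ->
  mxsimple (word_repr C n) (specht_mx C n la).
Proof.
move=> closed ht; have ti := tableau_inj ht.
have modS := specht_mxmodule C n la.
split=> // [|U modU sUS nzU].
  apply: contraNneq (polytabloid_neq0 ti) => S0.
  by rewrite -submx0 -S0 polytabloid_specht.
have gen (A : 'M_#|word|) (u : 'rV_#|word|) : mxmodule (word_repr C n) A ->
    (A <= specht_mx C n la)%MS -> (u <= A)%MS -> u *m kappa t != 0 ->
    (specht_mx C n la <= A)%MS.
  move=> modA sAS uA nz; apply: (specht_generated ht modA).
  have uk : (u *m kappa t <= polytabloid C t)%MS.
    by apply: submx_trans (specht_kappa closed ht); rewrite submxMr // (submx_trans uA).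
  have : (u *m kappa t <= A)%MS.
    rewrite mulmx_sumr; apply: summx_sub => q _; rewrite -scalemxAr scalemx_sub //.
    by apply: (mxmodule_trans modA); rewrite ?inE.
  apply: submx_trans; case/sub_rVP: uk => a ea; rewrite ea in nz *.
  have a0 : a != 0 by apply: contraNneq nz => ->; rewrite scale0r.
  by rewrite (eqmx_scale _ a0).
have [|W modW defW dx] := mx_reducibleS modS (submx1 _) _ modU sUS.
  by apply: mx_Maschke_pchar; rewrite /pgroup; apply/pnatP => [|p _ _]; [exact: cardG_gt0|rewrite inE /= pchar_num].
have /sub_addsmxP [[u1 u2] /= e12] : (polytabloid C t <= U + W)%MS.
  by rewrite defW polytabloid_specht.
have sWS : (W <= specht_mx C n la)%MS by rewrite -defW addsmxSr.
have [k1|k1] := eqVneq (u1 *m U *m kappa t) 0; last exact: gen (submxMl _ _) k1.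
have k2 : u2 *m W *m kappa t != 0.
  apply: contraNneq (polytabloid_neq0 ti) => k2.
  have := polytabloid_kappa t; rewrite {1}e12 mulmxDl k1 k2 addr0 => /esym/eqP.
  by rewrite scaler_eq0 (negPf (column_stab_card t)).
have sSW := gen W _ modW sWS (submxMl _ _) k2.
case/negP: nzU; rewrite -submx0 -(mxdirect_addsP dx) sub_capmx submx_refl /=.
exact: submx_trans sSW.
Qed.

End SpechtModule.

Section Intertwiners.

Variables (F : fieldType) (gT : finGroupType) (G : {group gT}) (n1 n2 : nat).
Variables (rG1 : mx_representation F G n1) (rG2 : mx_representation F G n2).

Lemma intertwiner_bijective (B : 'M[F]_(n1, n2)) :
  mx_irreducible rG1 -> mx_irreducible rG2 ->
  {in G, forall x, rG1 x *m B = B *m rG2 x} -> B != 0 -> row_free B && row_full B.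
Proof.
move=> [_ _ irr1] [_ _ irr2] hB nzB; apply/andP; split.
  rewrite -kermx_eq0; apply: contraNT nzB => nzK.
  have modK : mxmodule rG1 (kermx B).
    apply/mxmoduleP => x Gx; apply/sub_kermxP.
    by rewrite -mulmxA hB // mulmxA mulmx_ker mul0mx.
  have /sub_kermxP := irr1 _ modK (submx1 _) nzK.
  by rewrite mul1mx => ->.
have modI : mxmodule rG2 <<B>>%MS.
  apply/mxmoduleP => x Gx; rewrite genmxE (eqmxMr _ (genmxE _)) -hB //.
  exact: submxMl.
have nzI : <<B>>%MS != 0 by rewrite -submx0 genmxE submx0.
by rewrite -sub1mx -(genmxE B); apply: irr2 modI (submx1 _) nzI.
Qed.

(** Irreducibility makes the cyclic module of v the whole space. This serves as an induction
    principle on vectors and spares the construction of submodules. *)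
Lemma irreducible_span (v : 'rV[F]_n1) (P : 'rV[F]_n1 -> Prop) :
  mx_irreducible rG1 -> v != 0 -> P v -> P 0 ->
  (forall a u w, P u -> P w -> P (a *: u + w)) ->
  (forall x u, x \in G -> P u -> P (u *m rG1 x)) -> forall u, P u.
Proof.
move=> [_ _ irr] nz Pv P0 Plin PG u.
have := irr _ (cyclic_mx_module rG1 v) (submx1 _).
rewrite cyclic_mx_eq0 => /(_ nz) /(submx_trans (submx1 u)) /cyclic_mxP [A].
case/envelop_mxP => c -> ->; rewrite mulmx_sumr.
elim/big_ind: _ => [|x y Px Py|x Gx] //.
  by rewrite -[x]scale1r; apply: Plin.
by rewrite -scalemxAr -[_ *: _]addr0; apply: Plin => //; apply: PG.
Qed.

End Intertwiners.

(** * Conjugate partitions and the sign twist *)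

Section SignTwist.

Variables (C : numFieldType) (n : nat) (la mu : seq nat).
Local Notation word := {ffun 'I_n -> 'I_n}.
Local Notation tab := {ffun 'I_n -> 'I_n * 'I_n}.
Hypothesis transposed : forall i j, ((i, j) \in diagram n mu) = ((j, i) \in diagram n la).

Definition flip (t : tab) : tab := [ffun x => ((t x).2, (t x).1)].

Lemma flip_tableau t : is_tableau la t -> is_tableau mu (flip t).
Proof.
move=> ht; have ti := tableau_inj ht.
apply/andP; split.
  apply/injectiveP => x y; rewrite !ffunE => -[e1 e2]; apply: ti.
  by rewrite [t x]surjective_pairing e1 e2 -surjective_pairing.
apply/eqP/setP => -[i j]; rewrite transposed; apply/imsetP/idP => [[x _]|jiD].
  by rewrite ffunE => -[-> ->]; rewrite -surjective_pairing; apply: tableau_mem.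
by have [x ex] := tableau_surj ht jiD; exists x; rewrite // ffunE ex.
Qed.

Variable t : tab.
Hypothesis ht : is_tableau la t.

(* The homomorphism from the tabloid module of shape mu to [specht la] twisted
   by the sign sending the tabloid of [flip t] to the polytabloid of t. *)
Definition twist_row (w : word) : 'rV[C]_#|word| :=
  if [pick g : 'S_n | relabel (tabloid (flip t)) g == w] is Some g
  then (-1) ^+ g *: polytabloid C (relabel t g) else 0.

Definition twist_mx : 'M[C]_#|word| := \matrix_i twist_row (enum_val i).

Lemma word_vec_twist w : word_vec C w *m twist_mx = twist_row w.
Proof. by rewrite /word_vec -rowE rowK enum_rankK. Qed.

(** The g picked in [twist_row] is immaterial: two candidates differ by a column permutation of t,
    whose sign on the polytabloid cancels the change of the sign factor. *)
Lemma twist_rowE g :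
  twist_row (relabel (tabloid (flip t)) g) = (-1) ^+ g *: polytabloid C (relabel t g).
Proof.
rewrite /twist_row; case: pickP => [h /eqP e|/(_ g)]; last by rewrite eqxx.
have hk : (h * g^-1)%g \in column_stab t.
  rewrite -groupV; apply/column_stabP => x.
  have /ffunP/(_ x) := congr1 (fun w => relabel w g^-1%g) e.
  by rewrite !relabelM mulgV !ffunE invg1 perm1.
move: hk; set k := (h * g^-1)%g => hk.
have -> : h = (k * g)%g by rewrite mulgKV.
rewrite -relabelM -polytabloid_act polytabloid_relabel // -scalemxAl polytabloid_act.
by rewrite scalerA odd_permM signr_addb mulrAC -signr_addb addbb mul1r.
Qed.

Lemma twist_row_relabel w (s : 'S_n) :
  twist_row (relabel w s) = (-1) ^+ s *: (twist_row w *m word_mx C s).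
Proof.
have [/existsP [g /eqP <-]|no] :=
    boolP [exists g : 'S_n, relabel (tabloid (flip t)) g == w].
  rewrite relabelM !twist_rowE -scalemxAl polytabloid_act relabelM scalerA.
  by rewrite odd_permM signr_addb mulrC.
have -> : twist_row w = 0.
  rewrite /twist_row; case: pickP => // g e; case/negP: no.
  by apply/existsP; exists g.
rewrite mul0mx scaler0 /twist_row; case: pickP => // g /eqP e; case/negP: no.
by apply/existsP; exists (g * s^-1)%g; rewrite -relabelM e relabelM mulgV;
  apply/eqP/ffunP => x; rewrite ffunE invg1 perm1.
Qed.

Lemma word_mx_twist (s : 'S_n) :
  word_mx C s *m twist_mx = (-1) ^+ s *: (twist_mx *m word_mx C s).
Proof.
apply/row_matrixP => i; rewrite !rowE -(enum_valK i) -/(word_vec C _).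
rewrite mulmxA word_vec_mx word_vec_twist twist_row_relabel.
by rewrite -scalemxAr mulmxA word_vec_twist.
Qed.

Lemma twist_mx_specht : (twist_mx <= specht_mx C n la)%MS.
Proof.
apply/row_subP => i; rewrite rowK /twist_row; case: pickP => [g _|_]; last exact: sub0mx.
by apply: scalemx_sub; apply: polytabloid_specht; apply: is_tableau_relabel.
Qed.

(** A column permutation of [flip t] preserves the rows of t, and the two signs cancel. Each term
    thus contributes 1 to the coefficient of the tabloid of t. *)
Lemma polytabloid_twist : polytabloid C (flip t) *m twist_mx != 0.
Proof.
have ti := tableau_inj ht.
have coef r : r \in column_stab (flip t) -> tabloid (relabel t r) = tabloid t.
  move=> hr; apply/ffunP => x; rewrite !ffunE.
  have /column_stabP/(_ x) : (r^-1)%g \in column_stab (flip t) by rewrite groupV.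
  by rewrite !ffunE.
suff : (polytabloid C (flip t) *m twist_mx) 0 (enum_rank (tabloid t)) =
    #|column_stab (flip t)|%:R.
  by apply: contra_eqN => /eqP ->; rewrite mxE eq_sym column_stab_card.
rewrite mulmx_suml summxE (eq_bigr (fun=> 1)) => [|r hr]; first by rewrite sumr_const.
rewrite -scalemxAl word_vec_twist tabloid_relabel twist_rowE scalerA -signr_addb addbb.
rewrite scale1r -(coef r hr) polytabloid_coef1 //.
by move=> x y; rewrite !ffunE => /ti /perm_inj.
Qed.

End SignTwist.

Lemma pm_tensor_irreducible (C : numFieldType) (n m : nat)
    (rG : mx_representation C [set: 'S_n] m) b :
  mx_irreducible rG -> mx_irreducible (pm_tensor rG b).
Proof.
case=> _ nz irr; split; [exact: mxmodule1|exact: nz|move=> U modU].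
apply: irr; apply/mxmoduleP => x Gx; have := mxmoduleP modU x Gx.
rewrite /= -scalemxAr => h; rewrite -[rG x]scale1r -(signrMK (b && odd_perm x) 1) mulr1.
by rewrite -scalerA -!scalemxAr; apply: scalemx_sub; exact: h.
Qed.

Lemma specht_irreducible (C : numFieldType) (n : nat) (la : seq nat)
    (t : {ffun 'I_n -> 'I_n * 'I_n}) : column_closed n la -> is_tableau la t ->
  mx_irreducible (specht_repr C n la).
Proof. by move=> cl ht; apply/submod_mx_irr; apply: specht_simple ht. Qed.

Section SpechtRepr.

Variables (C : numFieldType) (n : nat) (la mu : seq nat).
Local Notation word := {ffun 'I_n -> 'I_n}.
Local Notation tab := {ffun 'I_n -> 'I_n * 'I_n}.
Implicit Types (t s : tab).

Lemma specht_sign t : column_closed n la -> column_closed n mu ->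
  (forall i j, ((i, j) \in diagram n mu) = ((j, i) \in diagram n la)) ->
  is_tableau la t ->
  exists B : 'M[C]_(specht_dim C n mu, specht_dim C n la),
    row_free B && row_full B /\
    forall s : 'S_n, specht_repr C n mu s *m B = B *m pm_tensor (specht_repr C n la) true s.
Proof.
move=> cla cmu tr ht; have ht' := flip_tableau tr ht.
pose U := specht_mx C n mu; pose W := specht_mx C n la.
pose P := twist_mx C t.
pose B : 'M_(\rank U, \rank W) := in_submod W (val_submod (1%:M : 'M_(\rank U)) *m P).
have PW : (val_submod (1%:M : 'M_(\rank U)) *m P <= W)%MS.
  by apply: submx_trans (submxMl _ _) (twist_mx_specht C ht).
have hB (s : 'S_n) : specht_repr C n mu s *m B = B *m pm_tensor (specht_repr C n la) true s.
  apply: (@val_submod_inj _ _ W); rewrite /= -scalemxAr linearZ /=.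
  rewrite [RHS](_ : _ = pm_char true s *: (val_submod B *m word_mx C s)); last first.
    by congr (_ *: _); rewrite (val_submodJ (specht_mxmodule C n la)) ?inE.
  have -> : val_submod (specht_repr C n mu s *m B) = specht_repr C n mu s *m val_submod B.
    exact: (esym (mulmxA _ _ _)).
  rewrite in_submodK // mulmxA.
  have -> : specht_repr C n mu s *m val_submod (1%:M : 'M_(\rank U)) =
      val_submod (1%:M : 'M_(\rank U)) *m word_mx C s.
    rewrite -(val_submodJ (specht_mxmodule C n mu)) ?inE // mul1mx.
    by rewrite [RHS]val_submodE.
  move: (val_submod _) => A.
  by rewrite -[LHS]mulmxA word_mx_twist -scalemxAr mulmxA.
exists B; split=> //.
apply: (@intertwiner_bijective _ _ [set: 'S_n]%G _ _ (specht_repr C n mu)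
  (pm_tensor (specht_repr C n la) true)).
- exact: (specht_irreducible C cmu ht').
- by apply: pm_tensor_irreducible; apply: (specht_irreducible C cla ht).
- by move=> s _; apply: hB.
apply: contraNneq (polytabloid_twist C ht) => B0.
have := in_submodK PW; rewrite -/B B0 linear0 => /esym e0.
by rewrite -(in_submodK (polytabloid_specht C ht')) val_submodE -mulmxA e0 mulmx0.
Qed.

End SpechtRepr.

Section Shapes.

Local Open Scope nat_scope.

Lemma nth_leq_sumn (l : seq nat) i : nth 0 l i <= sumn l.
Proof.
elim: l i => [|a l IH] [|i] //=; first exact: leq_addr.
exact: leq_trans (IH i) (leq_addl _ _).
Qed.

Lemma size_leq_sumn (l : seq nat) : all (leq 1) l -> size l <= sumn l.
Proof. by elim: l => //= a l IH /andP [a1 /IH h]; rewrite -add1n leq_add. Qed.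

Lemma nth_sorted_geq (l : seq nat) i j : sorted geq l -> i <= j -> nth 0 l j <= nth 0 l i.
Proof.
move=> sl ij; have [jl|jl] := ltnP j (size l); last by rewrite nth_default.
have geqT : transitive geq by move=> x y z h1 h2; apply: leq_trans h2 h1.
by apply: (sorted_leq_nth geqT leqnn 0 sl); rewrite ?inE // (leq_ltn_trans ij).
Qed.

(** In a weakly decreasing list the entries exceeding j form an initial segment. *)
Lemma count_gtn_sorted (l : seq nat) i j : sorted geq l ->
  (i < count (fun r => j < r) l) = (j < nth 0 l i).
Proof.
elim: l i => [|a l IH] i /= sl; first by rewrite nth_nil.
have sl' := path_sorted sl.
case: i => [|i] /=; last first.
  have [ja|ja] := ltnP j a; first by rewrite ltnS IH.
  rewrite add0n; have := @nth_sorted_geq (a :: l) 0 i.+1 sl isT => /= h1.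
  have h2 k : k < count (fun r => j < r) l -> false.
    rewrite IH // => h; have := @nth_sorted_geq (a :: l) 0 k.+1 sl isT => /= h3.
    by have := leq_trans h (leq_trans h3 ja); rewrite ltnn.
  rewrite [RHS]ltnNge (leq_trans h1 ja) /=.
  by apply/negP => /h2.
have [ja|ja] := ltnP j a; first by [].
rewrite add0n; apply/negP; rewrite IH // => h.
have := @nth_sorted_geq (a :: l) 0 1 sl isT => /= h3.
by have := leq_trans h (leq_trans h3 ja); rewrite ltnn.
Qed.

Variables (n : nat) (la : seq nat).
Hypothesis hla : is_partition n la.

Lemma partition_sorted : sorted geq la. Proof. by case/and3P: hla. Qed.

Lemma conj_nthE i j : (i < nth 0 (conj_partition la) j) = (j < nth 0 la i).
Proof.
rewrite -[RHS](count_gtn_sorted i j partition_sorted).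
have [jl|jl] := ltnP j (head 0 la).
  by rewrite /conj_partition (nth_map 0) ?size_iota // nth_iota.
rewrite nth_default ?size_map ?size_iota // ltn0; apply/esym/negP.
rewrite count_gtn_sorted ?partition_sorted //.
rewrite ltnNge (leq_trans _ jl) // -nth0; exact: nth_sorted_geq partition_sorted _.
Qed.

Lemma row_leq i : nth 0 la i <= n.
Proof. by case/and3P: hla => _ _ /eqP <-; apply: nth_leq_sumn. Qed.

Lemma column_leq i : nth 0 (conj_partition la) i <= n.
Proof.
rewrite leqNgt conj_nthE nth_default //.
by case/and3P: hla => _ la1 /eqP <-; apply: size_leq_sumn.
Qed.

Lemma card_row k : k <= n -> #|[set j : 'I_n | j < k]| = k.
Proof.
move=> le; have wI : injective (widen_ord le) by move=> x y [] /val_inj.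
rewrite -[RHS]card_ord -(card_imset _ wI).
apply: eq_card => j; rewrite inE; apply/idP/imsetP => [h|[j' _ ->]]; last exact: ltn_ord j'.
by exists (Ordinal h) => //; apply: val_inj.
Qed.

Lemma card_diagram : #|diagram n la| = n.
Proof.
have /and3P [_ la1 /eqP la_n] := hla.
rewrite -sum1_card (eq_bigl (fun c : 'I_n * 'I_n => true && (c.2 < nth 0 la c.1))).
  rewrite -(pair_big_dep predT (fun i j : 'I_n => j < nth 0 la i) (fun _ _ => 1)) /=.
  under eq_bigr => i _.
    rewrite (_ : \sum_(j < n | _) 1 = nth 0 la i); first over.
    by rewrite -[RHS](card_row (row_leq i)) -sum1_card; apply: eq_bigl => j; rewrite inE.
  have sz : size la <= n by rewrite -la_n; apply: size_leq_sumn.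
  rewrite -(big_mkord predT (nth 0 la)) (big_cat_nat (leq0n _) sz) //= -[RHS]addn0.
  congr (_ + _); first by rewrite -[RHS]la_n sumnE [RHS](big_nth 0).
  rewrite big_nat big1 // => i /andP [h _]; exact: nth_default.
by move=> c; rewrite inE.
Qed.

Lemma tableau_exists : exists t : {ffun 'I_n -> 'I_n * 'I_n}, is_tableau la t.
Proof.
have e := card_diagram.
exists [ffun x => enum_val (cast_ord (esym e) x)]; apply: tableauP => //.
  by move=> x y; rewrite !ffunE => /enum_val_inj/cast_ord_inj.
by move=> x; rewrite ffunE; apply: enum_valP.
Qed.

Lemma diagram_closed : column_closed n la.
Proof.
move=> i j i'; rewrite !inE /= => h ii; apply: (leq_trans h).
exact: nth_sorted_geq partition_sorted ii.
Qed.

Lemma diagram_conj (i j : 'I_n) :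
  ((i, j) \in diagram n (conj_partition la)) = ((j, i) \in diagram n la).
Proof. by rewrite !inE /= conj_nthE. Qed.

Lemma diagram_conj_closed : column_closed n (conj_partition la).
Proof.
move=> i j i'; rewrite !diagram_conj !inE /= => h ii; exact: leq_ltn_trans ii h.
Qed.

Lemma self_conjugate : (forall i : 'I_n, nth 0 la i = nth 0 (conj_partition la) i) ->
  la = conj_partition la.
Proof.
move=> e; have /and3P [_ la1 /eqP la_n] := hla.
have {}e i : nth 0 la i = nth 0 (conj_partition la) i.
  have [i_n|n_i] := ltnP i n; first exact: (e (Ordinal i_n)).
  rewrite !nth_default //.
    rewrite size_map size_iota (leq_trans _ n_i) // -nth0 -la_n; exact: nth_leq_sumn.
  by apply: leq_trans (size_leq_sumn la1) _; rewrite la_n.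
have sz i : (i < size la) = (0 < nth 0 la i).
  have [il|li] := ltnP i (size la); last by rewrite nth_default.
  by rewrite (allP la1) // mem_nth.
apply: (@eq_from_nth _ 0) => //; rewrite size_map size_iota -nth0.
have h i : (i < size la) = (i < nth 0 la 0) by rewrite sz e conj_nthE.
apply/eqP; rewrite eqn_leq leqNgt h ltnn /= leqNgt -h ltnn //.
Qed.

Lemma card_tableau_row (t : {ffun 'I_n -> 'I_n * 'I_n}) (i : 'I_n) : is_tableau la t ->
  #|[set x | (t x).1 == i]| = #|[set j | (i, j) \in diagram n la]|.
Proof.
move=> ht; rewrite -(card_imset _ (tableau_inj ht)).
have pI : injective (fun j : 'I_n => (i, j)) by move=> x y [].
rewrite -[RHS](card_imset _ pI); apply: eq_card => c.
apply/imsetP/imsetP => [[x]|[j]]; rewrite inE => h ->.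
  exists (t x).2; first by rewrite inE -(eqP h) -surjective_pairing tableau_mem.
  by rewrite -(eqP h) -surjective_pairing.
have [x ex] := tableau_surj ht h.
by exists x; rewrite ?inE ?ex.
Qed.

End Shapes.

Lemma card_tableau_below (n : nat) (la : seq nat) (t s : {ffun 'I_n -> 'I_n * 'I_n}) k :
  is_tableau la t -> is_tableau la s -> #|below (tabloid s) k| = #|below (tabloid t) k|.
Proof.
move=> ht hs; have [q ->] := tableau_relabel ht hs.
rewrite -(card_imset _ (@perm_inj _ q^-1%g)); apply: eq_card => x.
apply/imsetP/idP => [[y + ->]|]; rewrite !inE !ffunE //.
by move=> xk; exists (q x); rewrite ?permK // !inE !ffunE permK.
Qed.

Section Dominance.

Variables (C : numFieldType) (n : nat) (la mu : seq nat).
Variables (t s : {ffun 'I_n -> 'I_n * 'I_n}).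
Hypotheses (closed : column_closed n la) (ht : is_tableau la t) (hs : is_tableau mu s).

(** [kappa t] does not kill the polytabloid of t, and B carries this to the Specht module of mu. So
    some tabloid of shape mu survives [kappa t]; entries in one column of t then lie in different
    rows of it, and [card_below] applies. *)
Lemma specht_dominance (B : 'M[C]_(specht_dim C n la, specht_dim C n mu)) k :
  row_free B ->
  (forall x : 'S_n, specht_repr C n la x *m B = B *m specht_repr C n mu x) ->
  (#|below (tabloid s) k| <= #|below (tabloid t) k|)%N.
Proof.
move=> freeB hB; pose U := specht_mx C n la; pose W := specht_mx C n mu.
have [/forallP no|/forallPn [s']] := boolP [forall s' : {ffun 'I_n -> 'I_n * 'I_n},
    is_tableau mu s' ==> (word_vec C (tabloid s') *m kappa C t == 0)]; last first.
  rewrite negb_imply => /andP [hs' nz]; rewrite (card_tableau_below k hs' hs).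
  apply: (card_below closed ht) => x y e1 e2; apply: contraNeq nz => xy.
  by rewrite (word_kappa_eq0 _ xy e1 e2).
have W0 : W *m kappa C t = 0.
  apply/eqP; rewrite -submx0 sumsmxMr; apply/sumsmx_subP => s' hs'.
  rewrite (eqmxMr _ (genmxE _)) mulmx_suml; apply: summx_sub => q _.
  by rewrite -scalemxAl (eqP (implyP (no _) _)) ?is_tableau_relabel // scaler0 sub0mx.
have W0' (u : 'rV_#|{ffun 'I_n -> 'I_n}|) : (u <= W)%MS -> u *m kappa C t = 0.
  by case/submxP => a ->; rewrite -mulmxA W0 mulmx0.
pose v : 'rV_(\rank U) := in_submod U (polytabloid C t).
have kE nu (u : 'rV_(specht_dim C n nu)) :
    val_submod (\sum_(q in column_stab t) (-1) ^+ q *: (u *m specht_repr C n nu q)) =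
    val_submod u *m kappa C t.
  rewrite linear_sum mulmx_sumr; apply: eq_bigr => q _; rewrite linearZ /= -scalemxAr.
  by rewrite (val_submodJ (specht_mxmodule C n nu)) ?inE.
have /eqP := W0' _ (val_submodP (v *m B)); rewrite -kE val_submod_eq0.
under eq_bigr do rewrite -mulmxA -hB mulmxA scalemxAl.
rewrite -mulmx_suml -(mul0mx 1 B) => /eqP/(row_free_inj freeB)/eqP.
rewrite -(@val_submod_eq0 _ _ U 1) (kE la) in_submodK ?polytabloid_specht //.
rewrite polytabloid_kappa scaler_eq0 (negPf (column_stab_card C t)) /=.
by rewrite (negPf (polytabloid_neq0 C (tableau_inj ht))).
Qed.

End Dominance.

Lemma card_tableau_row_nth (n : nat) (la : seq nat) (t : {ffun 'I_n -> 'I_n * 'I_n})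
    (i : 'I_n) : is_tableau la t -> (nth 0 la i <= n)%N ->
  #|[set x | (t x).1 == i]| = nth 0%N la i.
Proof.
move=> ht le; rewrite (card_tableau_row i ht) -[RHS](card_row le).
by apply: eq_card => j; rewrite !inE.
Qed.

Lemma card_below_succ (n : nat) (w : {ffun 'I_n -> 'I_n}) (i : 'I_n) :
  #|below w i.+1| = (#|below w i| + #|[set x | w x == i]|)%N.
Proof.
rewrite -cardsUI [X in (_ + X)%N](_ : _ = 0%N) ?addn0; last first.
  by apply: eq_card0 => x; rewrite !inE; case: eqP => [->|_]; rewrite ?ltnn ?andbF.
by apply: eq_card => x; rewrite !inE ltnS leq_eqVlt orbC.
Qed.

Lemma pm_tensorE (C : numFieldType) (n m : nat) (rG : mx_representation C [set: 'S_n] m) b s :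
  pm_tensor rG b s = pm_char b s *: rG s.
Proof. by []. Qed.

Section SelfConjugate.

Variables (C : numFieldType) (n : nat) (la : seq nat).
Hypothesis hla : is_partition n la.
Local Notation mu := (conj_partition la).
Local Notation V := (specht_repr C n la).

(** Y identifies V with its sign twist, which is the Specht module of the conjugate partition.
    Dominance in both directions equates all partial row sums. *)
Lemma anticommuting_self_conjugate (Y : 'M[C]_(specht_dim C n la)) :
  Y != 0 -> (forall s : 'S_n, V s *m Y = (-1) ^+ s *: (Y *m V s)) ->
  la = mu.
Proof.
move=> nzY hY; have [t ht] := tableau_exists hla.
have cl := diagram_closed hla; have cmu := diagram_conj_closed hla.
have tr := diagram_conj hla.
have irrV := specht_irreducible C cl ht.
have [B [/andP [freeB fullB] hB]] := specht_sign C cl cmu tr ht.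
have /andP [freeY fullY] : row_free Y && row_full Y.
  apply: (@intertwiner_bijective _ _ [set: 'S_n]%G _ _ V (pm_tensor V true)) => //.
    exact: pm_tensor_irreducible.
  by move=> s _; rewrite hY pm_tensorE -scalemxAr.
have [A [hA freeA fullA]] : exists A : 'M[C]_(specht_dim C n mu, specht_dim C n la),
    [/\ forall s : 'S_n, specht_repr C n mu s *m A = A *m V s, row_free A & row_full A].
  exists (B *m Y); split; [|by rewrite /row_free mxrankMfree|by rewrite /row_full mxrankMfree].
  move=> s; rewrite mulmxA hB pm_tensorE -scalemxAr -scalemxAl -[B *m _ *m Y]mulmxA hY -scalemxAr scalerA.
  by rewrite /pm_char /= -signr_addb addbb scale1r mulmxA.
pose A' := pinvmx A.
have A'A : A' *m A = 1%:M by apply: mulVpmx.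
have AA' : A *m A' = 1%:M by apply: mulmxVp.
have freeA' : row_free A' by apply/row_freeP; exists A.
have hA' (s : 'S_n) : V s *m A' = A' *m specht_repr C n mu s.
  by rewrite -[V s]mul1mx -A'A -(mulmxA A' A) -hA (mulmxA A') -(mulmxA _ A A') AA' mulmx1.
have ht' := flip_tableau tr ht.
apply: (self_conjugate hla) => i.
rewrite -(card_tableau_row_nth ht (row_leq hla i)).
rewrite -(card_tableau_row_nth ht' (column_leq hla i)).
have eqb k : #|below (tabloid t) k| = #|below (tabloid (flip t)) k|.
  apply/eqP; rewrite eqn_leq (specht_dominance cmu ht' ht k freeA hA).
  by rewrite (specht_dominance cl ht ht' k freeA' hA').
have e1 := card_below_succ (tabloid t) i.
have e2 := card_below_succ (tabloid (flip t)) i.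
move: e1; rewrite !eqb e2 => /addnI.
have rowE (u : {ffun 'I_n -> 'I_n * 'I_n}) :
    [set x | tabloid u x == i] = [set x | (u x).1 == i].
  by apply/setP => x; rewrite !inE ffunE.
by rewrite !rowE.
Qed.

End SelfConjugate.

(** * Transposition sums and contents *)

Section Content.

Variables (C : numFieldType) (n : nat) (t : {ffun 'I_n -> 'I_n * 'I_n}).
Hypothesis ti : injective t.

Lemma word_mx_coef (v : 'rV[C]_#|{ffun 'I_n -> 'I_n}|) (s : 'S_n) w :
  (v *m word_mx C s) 0 (enum_rank w) = v 0 (enum_rank (relabel w s^-1%g)).
Proof.
rewrite mxE (bigD1 (enum_rank (relabel w s^-1%g))) //= mxE !enum_rankK.
rewrite relabelM mulVg (_ : relabel w 1 = w); last first.
  by apply/ffunP => x; rewrite ffunE invg1 perm1.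
rewrite eqxx mulr1 big1 ?addr0 // => i ne; rewrite mxE enum_rankK.
case: eqP => [e|_]; last by rewrite mulr0.
case/eqP: ne; rewrite e relabelM mulgV (_ : relabel _ 1 = enum_val i) ?enum_valK //.
by apply/ffunP => x; rewrite ffunE invg1 perm1.
Qed.

(** Only a column permutation acting on the rows of t as [(x y)] does can contribute: the identity
    if x and y share a row, [(x y)] itself if they share a column, and none otherwise. *)
Lemma transposition_coef (x y : 'I_n) : x != y ->
  (polytabloid C t *m word_mx C (tperm x y)) 0 (enum_rank (tabloid t)) =
  ((t x).1 == (t y).1)%:R - ((t x).2 == (t y).2)%:R.
Proof.
move=> xy; rewrite word_mx_coef tpermV polytabloid_coef.
have condP (q : 'S_n) : (q \in column_stab t) && (tabloid (relabel t q) ==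
     relabel (tabloid t) (tperm x y)) ->
   forall z, t (q^-1%g z) = ((t (tperm x y z)).1, (t z).2).
  case/andP=> hq /eqP/ffunP h z; have := h z; rewrite !ffunE tpermV => h1.
  have /column_stabP/(_ z) h2 : q^-1%g \in column_stab t by rewrite groupV.
  by rewrite [LHS]surjective_pairing h1 h2.
have txy : t x != t y by apply: contra_neq xy => /ti.
have [r|nr] := eqVneq (t x).1 (t y).1.
  have nc : (t x).2 != (t y).2.
    by apply: contraNneq txy => c; rewrite -pair_eqE /pair_eq /= r c !eqxx.
  have rowE z : (t (tperm x y z)).1 = (t z).1 by case: tpermP => [->|->|].
  rewrite (negPf nc) subr0 (big_pred1 1%g) ?odd_perm1 // => q.
  apply/idP/eqP => [/condP h|->].
    apply/permP => z; rewrite perm1; apply: ti.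
    by rewrite -{2}(permK q z) h rowE -surjective_pairing.
  rewrite group1; apply/eqP/ffunP => z; rewrite !ffunE invg1 perm1 tpermV.
  by rewrite rowE.
rewrite sub0r.
have [c|nc] := eqVneq (t x).2 (t y).2.
  have colE z : (t (tperm x y z)).2 = (t z).2 by case: tpermP => [->|->|].
  rewrite (big_pred1 (tperm x y)) ?odd_tperm ?xy // => q.
  apply/idP/eqP => [/condP h|->].
    apply/permP => z; rewrite -[q z](tpermK x y); congr (tperm x y _).
    by apply: ti; rewrite -[in RHS](permK q z) h -(colE (q z)) -surjective_pairing.
  apply/andP; split; first exact/column_stabP.
  by apply/eqP/ffunP => z; rewrite !ffunE.
rewrite oppr0 big_pred0 // => q; apply/negP => /condP h.
have fixz z : z != x -> z != y -> q^-1%g z = z.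
  move=> zx zy; apply: ti; rewrite h tpermD 1?eq_sym // -surjective_pairing //.
have hx := h x; rewrite tpermL in hx.
have [e|ne] := eqVneq (q^-1%g x) x.
  by case/eqP: nr; rewrite -{1}e hx.
have [e|ne'] := eqVneq (q^-1%g x) y.
  by case/eqP: nc; rewrite -e hx.
by case/eqP: (ne); apply: (@perm_inj _ q^-1%g); apply: fixz.
Qed.

End Content.

Lemma sum_over_transpositions (V : nmodType) (n : nat) (a b : 'I_n) (F : 'S_n -> V) : a != b ->
  \sum_(p : 'I_n * 'I_n | p.1 != p.2) F (tperm p.1 p.2) =
  (\sum_(y in (tperm a b ^: [set: 'S_n])%g) F y) *+ 2.
Proof.
move=> ab; rewrite (partition_big (fun p => tperm p.1 p.2)
  (mem (tperm a b ^: [set: 'S_n])%g)) /=; last first.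
  by move=> [c d] /= cd; apply/tperm_classP => //; exists c, d.
rewrite -sumrMnl; apply: eq_bigr => s /(tperm_classP _ ab) [c [d [cd ->]]].
have dc : d != c by rewrite eq_sym.
rewrite (bigD1 (c, d)) /= ?cd ?eqxx // (big_pred1 (d, c)) /= ?[tperm d c]tpermC ?mulr2n //.
move=> [x y] /=; rewrite -!pair_eqE /pair_eq /=.
apply/idP/idP => [/andP [/andP [_ /eqP /(tperm_eqP cd) [[-> ->]|[-> ->]]]]|/andP [/eqP -> /eqP ->]].
- by rewrite !eqxx.
- by rewrite !eqxx.
by rewrite dc tpermC eqxx (negPf dc).
Qed.

Lemma sum_row_pairs (n : nat) (la : seq nat) (t : {ffun 'I_n -> 'I_n * 'I_n}) :
  is_tableau la t -> (forall i, nth 0 la i <= n)%N ->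
  (\sum_(p : 'I_n * 'I_n) ((t p.1).1 == (t p.2).1) = \sum_(i < n) nth 0 la i ^ 2)%N.
Proof.
move=> ht le.
rewrite -(pair_bigA _ (fun x y => nat_of_bool ((t x).1 == (t y).1))) /=.
rewrite (partition_big (fun x => (t x).1) predT) //=; apply: eq_bigr => i _.
rewrite (eq_bigr (fun=> nth 0 la i)%N) => [|x /eqP ex].
  rewrite sum_nat_const -mulnn; congr (_ * _)%N.
  by rewrite -[RHS](card_tableau_row_nth ht (le i)); apply: eq_card => x; rewrite !inE.
rewrite ex -(card_tableau_row_nth ht (le i)) -sum1_card [RHS]big_mkcond /=.
by apply: eq_bigr => y _; rewrite inE eq_sym; case: eqP.
Qed.

(** The coefficient of the tabloid of t in the sum is the number of pairs in a common row minus that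
    of pairs in a common column, which is the content sum. Over ordered pairs, the diagonal
    included, these numbers become the sums of squares. *)
Lemma content_zero (C : numFieldType) (n : nat) (la : seq nat)
    (t : {ffun 'I_n -> 'I_n * 'I_n}) (a b : 'I_n) :
  is_partition n la -> is_tableau la t -> a != b ->
  \sum_(y in (tperm a b ^: [set: 'S_n])%g) polytabloid C t *m word_mx C y = 0 ->
  (\sum_(i < n) nth 0 la i ^ 2 = \sum_(i < n) nth 0 (conj_partition la) i ^ 2)%N.
Proof.
move=> hla ht ab S0; have ti := tableau_inj ht.
rewrite -(sum_row_pairs ht (row_leq hla)).
rewrite -(sum_row_pairs (flip_tableau (diagram_conj hla) ht) (column_leq hla)).
have S1 : \sum_(p : 'I_n * 'I_n | p.1 != p.2)
    (((t p.1).1 == (t p.2).1)%:R - ((t p.1).2 == (t p.2).2)%:R : C) = 0.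
  have := congr1 (fun v : 'rV[C]_#|{ffun 'I_n -> 'I_n}| => v 0 (enum_rank (tabloid t)) *+ 2) S0.
  rewrite /= summxE mxE mul0rn -(sum_over_transpositions
    (fun y => (polytabloid C t *m word_mx C y) 0 (enum_rank (tabloid t))) ab).
  by move=> e; rewrite -[RHS]e; apply: eq_bigr => p pp; rewrite transposition_coef.
have {}S1 : \sum_(p : 'I_n * 'I_n)
    (((t p.1).1 == (t p.2).1)%:R - ((t p.1).2 == (t p.2).2)%:R : C) = 0.
  rewrite (bigID (fun p : 'I_n * 'I_n => p.1 != p.2)) /= S1 add0r big1 // => p /negbNE /eqP ->.
  by rewrite !eqxx subrr.
move/eqP: S1; rewrite sumrB subr_eq0 -!natr_sum eqr_nat => /eqP ->.
by apply: eq_bigr => p _; rewrite !ffunE.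
Qed.

Section SmallPartitions.

Local Open Scope nat_scope.

Fixpoint partitions_upto (fuel m k : nat) : seq (seq nat) :=
  if k == 0 then [:: [::]] else
  if fuel is fuel'.+1 then
    flatten [seq [seq a :: l | l <- partitions_upto fuel' a (k - a)] | a <- iota 1 (minn m k)]
  else [::].

Lemma partitions_uptoP fuel m k l : path geq m l -> all (leq 1) l -> sumn l = k ->
  k <= fuel -> l \in partitions_upto fuel m k.
Proof.
elim: fuel m k l => [|fuel IH] m k [|a l] //= => [_ _ <- //|||].
- by move=> _ /andP [a1 _] <-; rewrite leqn0 addn_eq0 -leqn0 leqNgt a1.
- by move=> _ _ <-.
case/andP=> am pl /andP [a1 l1] ek kf.
have k0 : k != 0 by rewrite -ek addn_eq0 -leqn0 leqNgt a1.
rewrite (negPf k0); apply/flattenP.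
exists [seq a :: l0 | l0 <- partitions_upto fuel a (k - a)].
  apply/map_f; rewrite mem_iota a1 add1n ltnS leq_min am -ek leq_addr //.
rewrite map_f // IH //; first by rewrite -ek addKn.
by rewrite leq_subLR (leq_trans kf) // -[fuel.+1]add1n leq_add2r.
Qed.

Definition square_sum n (l : seq nat) := sumn [seq nth 0 l i ^ 2 | i <- iota 0 n].

Lemma square_sumE n l : \sum_(i < n) nth 0 l i ^ 2 = square_sum n l.
Proof.
rewrite -(big_mkord predT (fun i => nth 0 l i ^ 2)) /square_sum sumnE big_map /index_iota.
by rewrite subn0.
Qed.

Lemma small_content_zero n la : is_partition n la -> n = 5 \/ n = 8 ->
  \sum_(i < n) nth 0 la i ^ 2 = \sum_(i < n) nth 0 (conj_partition la) i ^ 2 ->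
  la = conj_partition la.
Proof.
move=> hla n58; rewrite !square_sumE => e.
have /and3P [sl l1 /eqP ln] := hla.
have lp : path geq n la.
  case: la hla sl l1 ln {e} => //= a l _ -> _ <-; rewrite andbT; exact: leq_addr.
have lin := partitions_uptoP lp l1 ln (leqnn n).
have chk : all (fun l => (square_sum n l == square_sum n (conj_partition l)) ==>
    (l == conj_partition l)) (partitions_upto n n n).
  by case: n58 => ->; vm_compute.
by have := allP chk _ lin; rewrite e eqxx => /eqP.
Qed.

End SmallPartitions.

(** * Forms and their centers *)

Section Substitution.

Context {C : numFieldType} {m : nat}.
Implicit Types (f g h : {mpoly C[m]}) (u v : 'rV[C]_m) (A B : 'M[C]_m).

Lemma mpoly_algebra_ind (P : {mpoly C[m]} -> Prop) :
  (forall c, P c%:MP) -> (forall i, P 'X_i) ->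
  (forall f g, P f -> P g -> P (f + g)) -> (forall f g, P f -> P g -> P (f * g)) ->
  forall f, P f.
Proof.
move=> PC PX PD PM f; rewrite (mpolyE f).
elim/big_ind: _ => [||k _]; [exact: PC 0|exact: PD|].
rewrite -mul_mpolyC; apply: (PM _ _) => //; rewrite mpolyXE_id.
elim/big_ind: _ => [||i _]; [exact: PC 1|exact: PM|].
by elim: (k i) => [|j IH]; [exact: PC 1|rewrite exprS; apply: (PM _ _)].
Qed.

Definition linear_form (a : 'I_m -> C) : {mpoly C[m]} := \sum_(k < m) a k *: 'X_k.

Lemma lin_subst_is_zmod_morphism A : zmod_morphism (lin_subst A).
Proof. by move=> f g; rewrite /lin_subst raddfB. Qed.

HB.instance Definition _ A :=
  GRing.isZmodMorphism.Build {mpoly C[m]} {mpoly C[m]} (lin_subst A)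
    (lin_subst_is_zmod_morphism A).

Lemma lin_subst_is_monoid_morphism A : monoid_morphism (lin_subst A).
Proof. by split=> [|f g]; rewrite /lin_subst ?rmorph1 ?rmorphM. Qed.

HB.instance Definition _ A :=
  GRing.isMonoidMorphism.Build {mpoly C[m]} {mpoly C[m]} (lin_subst A)
    (lin_subst_is_monoid_morphism A).

Lemma lin_substZ A a f : lin_subst A (a *: f) = a *: lin_subst A f.
Proof. exact: comp_mpolyZ. Qed.

Lemma lin_substC A c : lin_subst A c%:MP = c%:MP.
Proof. exact: comp_mpolyC. Qed.

Lemma lin_substX A i : lin_subst A 'X_i = linear_form (A^~ i).
Proof. by rewrite /lin_subst comp_mpolyXU -tnth_nth tnth_mktuple. Qed.

Lemma lin_subst_comp A B f : lin_subst A (lin_subst B f) = lin_subst (A *m B) f.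
Proof.
elim/mpoly_algebra_ind: f => [c|i|f g ef eg|f g ef eg].
- by rewrite !lin_substC.
- rewrite !lin_substX raddf_sum /=.
  under eq_bigr => k _ do rewrite lin_substZ lin_substX /linear_form scaler_sumr.
  rewrite exchange_big; apply: eq_bigr => j _ /=.
  by rewrite mxE scaler_suml; apply: eq_bigr => k _; rewrite scalerA mulrC.
- by rewrite !raddfD /= ef eg.
- by rewrite !rmorphM /= ef eg.
Qed.

Lemma lin_subst1 f : lin_subst 1%:M f = f.
Proof.
elim/mpoly_algebra_ind: f => [c|i|f g ef eg|f g ef eg].
- by rewrite lin_substC.
- rewrite lin_substX /linear_form (bigD1 i) //= big1 ?addr0 ?mxE ?eqxx ?scale1r //.
  by move=> k ki; rewrite mxE (negPf ki) scale0r.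
- by rewrite raddfD /= ef eg.
- by rewrite rmorphM /= ef eg.
Qed.

Lemma dirderM v f g : dirder v (f * g) = dirder v f * g + f * dirder v g.
Proof.
rewrite /dirder mulr_suml mulr_sumr -big_split; apply: eq_bigr => i _ /=.
by rewrite mderivM scalerDr scalerAl scalerAr.
Qed.

Lemma dirderC0 v c : dirder v c%:MP = 0.
Proof. by rewrite /dirder big1 // => i _; rewrite mderivC scaler0. Qed.

Lemma dirderX v i : dirder v 'X_i = (v 0 i)%:MP.
Proof.
rewrite /dirder (bigD1 i) //= big1 => [|k ki]; rewrite mderivX.
  rewrite mnm1E eqxx scale1r addr0 (_ : U_(i) - U_(i) = 0)%MM; last first.
    by apply/mnmP => j; rewrite mnmBE subnn mnm0E.
  by rewrite mpolyX0 -mul_mpolyC mulr1.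
by rewrite mnm1E eq_sym (negPf ki) scale0r scaler0.
Qed.

Lemma dirderD v f g : dirder v (f + g) = dirder v f + dirder v g.
Proof. by rewrite -[f]scale1r dirder_linr !scale1r. Qed.

Lemma dirderZ v a f : dirder v (a *: f) = a *: dirder v f.
Proof. by rewrite -[a *: f]addr0 dirder_linr dirder0 addr0. Qed.

Lemma dirder_linear_form v a :
  dirder v (linear_form a) = (\sum_(k < m) v 0 k * a k)%:MP.
Proof.
rewrite /linear_form; have -> : forall r : seq 'I_m,
  dirder v (\sum_(k <- r) a k *: 'X_k) = (\sum_(k <- r) v 0 k * a k)%:MP.
  elim=> [|k r IH]; first by rewrite !big_nil dirder0 mpolyC0.
  rewrite !big_cons dirderD IH dirderZ dirderX mpolyCD -mul_mpolyC -mpolyCM.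
  by rewrite mulrC.
by [].
Qed.

Lemma dirder_lin_subst v A f :
  dirder v (lin_subst A f) = lin_subst A (dirder (v *m A) f).
Proof.
elim/mpoly_algebra_ind: f => [c|i|f g ef eg|f g ef eg].
- by rewrite lin_substC !dirderC0 raddf0.
- by rewrite lin_substX dirder_linear_form dirderX lin_substC mxE.
- by rewrite raddfD /= !dirderD ef eg raddfD.
- by rewrite rmorphM /= !dirderM ef eg raddfD /= !rmorphM.
Qed.

Lemma linear_form_homog a : linear_form a \is 1.-homog.
Proof. by apply: rpred_sum => k _; apply: rpredZ; rewrite dhomogX /= mdeg1. Qed.

Lemma lin_subst_homog A d f : f \is d.-homog -> lin_subst A f \is d.-homog.
Proof.
move=> hf; rewrite /lin_subst comp_mpolyEX big_seq; apply: rpred_sum => k kf.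
apply: rpredZ; rewrite comp_mpolyX.
have <- : mdeg k = d by exact: (dhomog_mf hf kf).
rewrite mdegE; pose F i := tnth [tuple \sum_(j < m) A j i0 *: 'X_j | i0 < m] i ^+ k i.
have hF i : F i \is (k i).-homog.
  rewrite /F tnth_mktuple; have := dhomogMn (k i) (linear_form_homog (A^~ i)).
  by rewrite mul1n.
suff : \prod_(i < m) F i \is (\sum_(i < m) k i).-homog by [].
move: F hF => F hF; elim: (index_enum _) => [|i r IH].
  by rewrite !big_nil dhomog1.
by rewrite !big_cons; apply: dhomogM.
Qed.

End Substitution.

Section HomogeneousForms.

Context {C : numFieldType} {m : nat}.
Implicit Types (f g h : {mpoly C[m]}) (u v : 'rV[C]_m) (X Y : 'M[C]_m).

Lemma foldr_dirder v f s : foldr dirder (dirder v f) s = dirder v (foldr dirder f s).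
Proof. by elim: s => //= u s ->; rewrite dirderC. Qed.

Lemma homog_dirder_eq0 d f : f \is d.+1.-homog -> (forall v, dirder v f = 0) -> f = 0.
Proof.
move=> hf h0; apply/mpolyP => k; rewrite mcoeff0.
have [k0|kn0] := eqVneq k 0%MM.
  by rewrite (dhomog_nemf_coeff hf) // k0 /= mdeg0.
have [i ki] : exists i, (0 < k i)%N.
  apply/existsP; apply: contraNT kn0; rewrite negb_exists => /forallP k0.
  by apply/eqP/mnmP => i; rewrite mnm0E; apply/eqP; rewrite -leqn0 leqNgt.
have fi : f^`M(i) = 0.
  rewrite -(h0 (delta_mx 0 i)) /dirder (bigD1 i) //= big1 ?addr0 ?mxE ?eqxx ?scale1r // => j ji.
  by rewrite mxE (negPf ji) andbF scale0r.
have := congr1 (mcoeff (k - U_(i))%MM) fi; rewrite mcoeff_deriv mcoeff0 submK.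
  by move/eqP; rewrite -mulr_natr mulf_eq0 pnatr_eq0 orbF => /eqP.
by rewrite lep1mP -lt0n.
Qed.

Lemma homog_polar_eq0 e g : g \is e.-homog ->
  (forall s, size s = e -> (foldr dirder g s)@_0%MM = 0) -> g = 0.
Proof.
elim: e g => [|e IH] g hg h0; first by rewrite (homog0_const hg) (h0 [::]) // mpolyC0.
apply: (homog_dirder_eq0 hg) => v; apply: IH; first exact: dirder_homog hg.
by move=> s hs; rewrite foldr_dirder; apply: (h0 (v :: s)); rewrite /= hs.
Qed.

Lemma dirderN v f : dirder v (- f) = - dirder v f.
Proof. by rewrite -scaleN1r dirderZ scaleN1r. Qed.

Lemma dirderB v f g : dirder v (f - g) = dirder v f - dirder v g.
Proof. by rewrite dirderD dirderN. Qed.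

Lemma homog_dirder_inj d f g : (0 < d)%N -> f \is d.-homog -> g \is d.-homog ->
  (forall v, dirder v f = dirder v g) -> f = g.
Proof.
case: d => // d _ hf hg e; apply/eqP; rewrite -subr_eq0; apply/eqP.
by apply: (homog_dirder_eq0 (rpredB hf hg)) => v; rewrite dirderB e subrr.
Qed.

Lemma dirderDl u v f : dirder (u + v) f = dirder u f + dirder v f.
Proof. by rewrite -[u]scale1r dirder_linl !scale1r. Qed.

Lemma dirder0l f : dirder 0 f = 0.
Proof. by rewrite /dirder big1 // => i _; rewrite mxE scale0r. Qed.

Lemma dirderZl a v f : dirder (a *: v) f = a *: dirder v f.
Proof. by rewrite -[a *: v]addr0 dirder_linl dirder0l addr0. Qed.

Lemma dirderNl v f : dirder (- v) f = - dirder v f.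
Proof. by rewrite -scaleN1r dirderZl scaleN1r. Qed.

Lemma dirderBl u v f : dirder (u - v) f = dirder u f - dirder v f.
Proof. by rewrite dirderDl dirderNl. Qed.

Lemma foldr_dirderB f g s :
  foldr dirder (f - g) s = foldr dirder f s - foldr dirder g s.
Proof. by elim: s => //= v s ->; rewrite dirderB. Qed.

Lemma factV_neq0 d : (d`!%:R : C)^-1 != 0.
Proof. by rewrite invr_eq0 pnatr_eq0 -lt0n fact_gt0. Qed.

(** Letting the other d - 2 arguments vary, the condition says that two forms of degree d - 2 have
    the same polarization, so they coincide. *)
Lemma form_centerP d f X : (1 < d)%N -> f \is d.-homog ->
  form_center d f X <->
  (forall u v, dirder (u *m X) (dirder v f) = dirder u (dirder (v *m X) f)).
Proof.
case: d => [|[|d]] // _ hf.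
split=> [hX u v|hX u v s [hs]].
  apply/eqP; rewrite -subr_eq0; apply/eqP; apply: (@homog_polar_eq0 d).
    by rewrite rpredB //; do 2!apply: (dirder_homog (d := _.+1)).
  move=> s hs; have := hX u v s; rewrite hs => /(_ erefl) /(mulfI (factV_neq0 _)) /= e.
  by rewrite foldr_dirderB !foldr_dirder mcoeffB e subrr.
by rewrite /polar /= -!foldr_dirder hX.
Qed.

Lemma twist_dirder d f z p v : (0 < d)%N -> f \is d.-homog -> is_twist d f z p ->
  dirder v p = dirder (v *m z) f.
Proof.
case: d => [|d] // _ hf [hp tw]; apply/eqP; rewrite -subr_eq0; apply/eqP.
apply: (@homog_polar_eq0 d).
  by rewrite rpredB //; apply: (dirder_homog (d := _.+1)).
move=> s hs; have := tw v s; rewrite hs => /(_ erefl) /(mulfI (factV_neq0 _)) /= e.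
by rewrite foldr_dirderB !foldr_dirder mcoeffB e subrr.
Qed.

Lemma jacobian_matrix f h : (forall v, exists u, dirder v h = dirder u f) ->
  exists X, forall v, dirder v h = dirder (v *m X) f.
Proof.
move=> J; have [r hr] := fin_all_exists (fun i : 'I_m => J (delta_mx 0 i)).
exists (\matrix_i r i) => v; rewrite {1}(row_sum_delta v) mulmx_sum_row.
elim: (index_enum _) => [|i s IH]; first by rewrite !big_nil !dirder0l.
by rewrite !big_cons !dirderDl IH !dirderZl hr rowK.
Qed.

End HomogeneousForms.

(** * The center of a nondegenerate form *)

Section Center.

Context {C : numFieldType} {m : nat}.
Variables (d : nat) (f : {mpoly C[m]}).
Hypothesis hf : f \is d.+3.-homog.
Hypothesis nondegenerate : forall v, dirder v f = 0 -> v = 0.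
Implicit Types (g h : {mpoly C[m]}) (u v : 'rV[C]_m) (X Y : 'M[C]_m).

Local Notation Z := (form_center d.+3 f).

Lemma dirder_injl u v : dirder u f = dirder v f -> u = v.
Proof.
move=> e; apply/eqP; rewrite -subr_eq0; apply/eqP; apply: nondegenerate.
by rewrite dirderBl e subrr.
Qed.

Lemma dirder2_injl u v : (forall w, dirder u (dirder w f) = dirder v (dirder w f)) -> u = v.
Proof.
move=> e; apply: dirder_injl; apply: (homog_dirder_inj (d := d.+2)) => //;
  [exact: dirder_homog hf|exact: dirder_homog hf|].
by move=> w; rewrite (dirderC w u) (dirderC w v).
Qed.

Lemma dirder3_injl u v :
  (forall w t, dirder u (dirder t (dirder w f)) = dirder v (dirder t (dirder w f))) -> u = v.
Proof.
move=> e; apply: dirder2_injl => w.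
have hw z : dirder z (dirder w f) \is d.+1.-homog.
  by apply: (dirder_homog (d := d.+2)); apply: dirder_homog hf.
apply: (homog_dirder_inj (ltn0Sn d)) => // t.
by rewrite (dirderC t u) (dirderC t v).
Qed.

Lemma centerP X : Z X <->
  (forall u v, dirder (u *m X) (dirder v f) = dirder u (dirder (v *m X) f)).
Proof. exact: form_centerP. Qed.

Lemma mx_eq_rV X Y : (forall u, u *m X = u *m Y) -> X = Y.
Proof. by move=> e; apply/row_matrixP => i; rewrite !rowE. Qed.

(** The third derivative of f is symmetric and trilinear, and X and Y may be moved from slot to slot
    in it; three slots suffice to interchange them. *)
Lemma center_comm X Y : Z X -> Z Y -> X *m Y = Y *m X.
Proof.
move=> /centerP hX /centerP hY; apply: mx_eq_rV => u; rewrite !mulmxA.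
apply: dirder3_injl => w t.
pose T a b c := dirder a (dirder b (dirder c f)).
have T12 a b c : T a b c = T b a c by apply: dirderC.
have T23 a b c : T a b c = T a c b by rewrite /T (dirderC b).
have TX a b c : T (a *m X) b c = T a b (c *m X) by rewrite T12 /T hX dirderC.
have TY a b c : T (a *m Y) b c = T a b (c *m Y) by rewrite T12 /T hY dirderC.
rewrite -[LHS]/(T (u *m X *m Y) t w) -[RHS]/(T (u *m Y *m X) t w).
by rewrite TY T23 TX [RHS]T23 TX [RHS]T23 TY T23.
Qed.

Lemma centerM X Y : Z X -> Z Y -> Z (X *m Y).
Proof.
move=> zX zY; have e := center_comm zX zY; move: zX zY => /centerP hX /centerP hY.
by apply/centerP => u v; rewrite mulmxA hY hX -mulmxA -e.
Qed.

Lemma center_lin a X Y : Z X -> Z Y -> Z (a *: X + Y).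
Proof.
move=> /centerP hX /centerP hY; apply/centerP => u v.
by rewrite !mulmxDr -!scalemxAr !dirder_linl hX hY dirder_linr.
Qed.

Lemma center_scalar a : Z a%:M.
Proof.
by apply/centerP => u v; rewrite !mul_mx_scalar !dirderZl dirderZ.
Qed.

Lemma center0 : Z 0. Proof. by have := center_scalar 0; rewrite raddf0. Qed.

Lemma center_inv X Y : Z X -> X *m Y = 1%:M -> Y *m X = 1%:M -> Z Y.
Proof.
move=> /centerP hX XY YX; apply/centerP => u v.
by rewrite -[v in LHS]mulmx1 -YX mulmxA -hX -mulmxA YX mulmx1.
Qed.

(** Mixed second derivatives of h commute, which is the symmetry that defines the center of f. *)
Lemma jacobian_center h X : (forall v, dirder v h = dirder (v *m X) f) -> Z X.
Proof.
move=> e; apply/centerP => u v.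
by rewrite -(e v) [RHS]dirderC (e u) dirderC.
Qed.

Lemma jacobian_center_matrix h : (forall v, exists u, dirder v h = dirder u f) ->
  exists2 X, Z X & forall v, dirder v h = dirder (v *m X) f.
Proof. by case/jacobian_matrix => X e; exists X => //; apply: jacobian_center e. Qed.

(** The two inclusions of Jacobians give linear substitutions of directions X and Y, mutually
    inverse because f is nondegenerate; X is central by [jacobian_center]. *)
Lemma same_jacobianP h : same_jacobian d.+3 f h <->
  h \is d.+3.-homog /\
  exists X Y, [/\ Z X, X *m Y = 1%:M & forall v, dirder v h = dirder (v *m X) f].
Proof.
split=> [[hh J]|[hh [X [Y [zX XY e]]]]]; split=> //.
  have [|X zX e] := @jacobian_center_matrix h.
    by move=> v; apply: (J _).1; exists v.
  have [|Y e'] := @jacobian_matrix _ _ h f.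
    by move=> v; apply: (J _).2; exists v.
  exists X, Y; split=> //; apply: mulmx1C; apply: mx_eq_rV => u.
  by apply: dirder_injl; rewrite mulmxA -e -e' mulmx1.
move=> g; split=> [[v ->]|[v ->]]; first by exists (v *m X); rewrite e.
by exists (v *m Y); rewrite e -mulmxA (mulmx1C XY) mulmx1.
Qed.

End Center.

Section FormAction.

Context {C : numFieldType} {n m : nat}.
Variable rG : mx_representation C [set: 'S_n] m.
Implicit Types (f g h : {mpoly C[m]}) (s t : 'S_n) (u v : 'rV[C]_m).

Lemma form_actD s f g : form_act rG s (f + g) = form_act rG s f + form_act rG s g.
Proof. exact: raddfD. Qed.

Lemma form_actZ s a f : form_act rG s (a *: f) = a *: form_act rG s f.
Proof. exact: lin_substZ. Qed.

Lemma form_actN s f : form_act rG s (- f) = - form_act rG s f.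
Proof. exact: raddfN. Qed.

Lemma form_act1 f : form_act rG 1%g f = f.
Proof. by rewrite /form_act invg1 repr_mx1 lin_subst1. Qed.

Lemma form_actM s t f : form_act rG s (form_act rG t f) = form_act rG (t * s)%g f.
Proof. by rewrite /form_act lin_subst_comp -repr_mxM ?inE // invMg. Qed.

Lemma form_act_homog s d f : f \is d.-homog -> form_act rG s f \is d.-homog.
Proof. exact: lin_subst_homog. Qed.

Lemma dirder_form_act v s f :
  dirder v (form_act rG s f) = form_act rG s (dirder (v *m rG s^-1%g) f).
Proof. exact: dirder_lin_subst. Qed.

Lemma form_act_dirder v s f :
  form_act rG s (dirder v f) = dirder (v *m rG s) (form_act rG s f).
Proof. by rewrite dirder_form_act -mulmxA -repr_mxM ?inE // mulgV repr_mx1 mulmx1. Qed.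

Lemma form_act_inj s : injective (form_act rG s).
Proof.
move=> f g e; rewrite -[f]form_act1 -[g]form_act1 -(mulgV s).
by rewrite -!form_actM e.
Qed.

End FormAction.

Section InvariantJacobian.

Context {C : numFieldType} {n m : nat}.
Variables (rG : mx_representation C [set: 'S_n] m) (d : nat) (f : {mpoly C[m]}).
Hypotheses (irrG : mx_irreducible rG) (hf : f \is d.+3.-homog) (f_neq0 : f != 0).
Hypothesis hJ : jacobian_invariant rG f.
Implicit Types (s : 'S_n) (v : 'rV[C]_m).

Lemma jacobian_act s v : exists u, form_act rG s (dirder v f) = dirder u f.
Proof. by apply: (hJ s _).2; exists (dirder v f) => //; exists v. Qed.

(** The v with [dirder v f = 0] are those whose derivation annihilates the Jacobian. By invariance
    of the Jacobian they form a submodule, and if it were all of V then f would be 0. *)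
Lemma invariant_nondegenerate v : dirder v f = 0 -> v = 0.
Proof.
move=> v0; apply/eqP; apply: contraNT f_neq0 => nz.
apply/eqP; apply: (homog_dirder_eq0 hf).
apply: (irreducible_span irrG nz v0) => [|a u w hu hw|s u _ hu].
- exact: dirder0l.
- by rewrite dirder_linl hu hw scaler0 addr0.
apply: (homog_dirder_eq0 (dirder_homog _ hf)) => w.
have [w' e] := jacobian_act s^-1 w; rewrite dirderC.
apply: (@form_act_inj _ _ _ rG s^-1%g); rewrite form_act_dirder e.
rewrite -mulmxA -repr_mxM ?inE // mulgV repr_mx1 mulmx1 dirderC hu dirder0.
by rewrite /form_act raddf0.
Qed.

Let nd := invariant_nondegenerate.
Local Notation Z := (form_center d.+3 f).

Lemma act_center s : exists X Y,
  [/\ Z X, X *m Y = 1%:M & forall v, dirder v (form_act rG s f) = dirder (v *m X) f].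
Proof.
suff /(same_jacobianP hf nd) [_ //] : same_jacobian d.+3 f (form_act rG s f).
split; first exact: form_act_homog.
move=> g; split=> [[v ->]|[v ->]].
  by rewrite dirder_form_act; have [u ->] := jacobian_act s (v *m rG s^-1%g); exists u.
have [u e] := jacobian_act s^-1 v; exists (u *m rG s).
by rewrite -form_act_dirder -e form_actM mulVg form_act1.
Qed.

(** The conjugate [Y] is self-adjoint for the second derivatives of [s^-1 f], which are those of f
    with one argument multiplied by the invertible central A. So [Y *m A] is central, and then so is
    [Y]. *)
Lemma center_conj s X : Z X -> Z (rG s *m X *m rG s^-1%g).
Proof.
move=> zX; have [A [B [zA AB eA]]] := act_center s^-1; have BA := mulmx1C AB.
set Y := rG s *m X *m rG s^-1%g.
suff zYA : Z (Y *m A).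
  rewrite -[Y]mulmx1 -AB mulmxA; apply: (centerM hf nd zYA).
  exact: center_inv zA AB BA.
move/(centerP hf): zX => hX; move/(centerP hf): (zA) => hA.
have act2 a b : dirder a (dirder b (form_act rG s^-1%g f)) =
    form_act rG s^-1%g (dirder (a *m rG s) (dirder (b *m rG s) f)).
  by rewrite dirder_form_act dirder_form_act invgK.
have YrG a : a *m Y *m rG s = a *m rG s *m X.
  rewrite /Y !mulmxA -[RHS]mulmx1 -(mulmxA _ (rG s^-1%g)) -repr_mxM ?inE //.
  by rewrite mulVg repr_mx1.
move: Y YrG => Y YrG.
apply/(centerP hf) => u v; rewrite !mulmxA hA -!eA !act2 !YrG.
by rewrite hX.
Qed.

End InvariantJacobian.

(** * Eigencharacters of the center *)

Section CommutingSpace.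

Variables (C : numClosedFieldType) (m : nat) (Z : 'M[C]_m -> Prop).
Hypotheses (Z0 : Z 0) (Zlin : forall a X Y, Z X -> Z Y -> Z (a *: X + Y)).

(** Z is a mere predicate closed under linear combinations; a subspace of maximal rank inside it
    must exhaust it. *)
Lemma commuting_space_basis :
  exists A : 'M[C]_(m * m), forall X, Z X <-> (mxvec X <= A)%MS.
Proof.
pose P r := `[< exists A : 'M[C]_(m * m),
  \rank A = r /\ forall X, (mxvec X <= A)%MS -> Z X >].
have P0 : exists r, P r.
  exists 0%N; apply/asboolP; exists 0; split; first exact: mxrank0.
  by move=> X; rewrite submx0 => /eqP e; rewrite -(mxvecK X) e linear0.
have Pm r : P r -> (r <= m * m)%N by move=> /asboolP [A [<- _]]; apply: rank_leq_row.
case: (ex_maxnP P0 Pm) => r /asboolP [A [rA ZA]] maxr.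
exists A => X; split=> [zX|]; last exact: ZA.
apply: contraT => nX.
have : P (\rank (A + mxvec X)%MS).
  apply/asboolP; exists (A + mxvec X)%MS; split=> // Y /sub_addsmxP [[u1 u2] /= e].
  have [a ea] : exists a, u2 = a%:M by exists (u2 0 0); apply: mx11_scalar.
  rewrite -(mxvecK Y) e ea mul_scalar_mx addrC linearP /= mxvecK; apply: Zlin => //.
  by apply: ZA; rewrite vec_mxK submxMl.
move/maxr; rewrite -rA leqNgt => /negP; case.
rewrite ltn_neqAle mxrankS ?addsmxSl // andbT.
apply: contra nX => /eqP e; apply: submx_trans (addsmxSr A _) _.
by have := mxrank_leqif_sup (addsmxSl A (mxvec X)); case=> _; rewrite e eqxx => <-.
Qed.

Hypothesis Zcomm : forall X Y, Z X -> Z Y -> X *m Y = Y *m X.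

Lemma common_eigenvector_space : (0 < m)%N ->
  exists2 v : 'rV[C]_m, v != 0 & exists alpha : 'M[C]_m -> C,
    forall X, Z X -> v *m X = alpha X *: v.
Proof.
move=> m0; have [A ZA] := commuting_space_basis.
pose l := [seq vec_mx (row i A) | i : 'I_(m * m)].
have Zl X : X \in l -> Z X.
  by case/mapP => i _ ->; apply/ZA; rewrite vec_mxK row_sub.
have [|v v0 /allP vl] := @common_eigenvector _ _ l m0.
  by move=> X Y /Zl zX /Zl zY; apply: Zcomm.
exists v => //.
have vZ X : Z X -> exists a, v *m X = a *: v.
  move/ZA/submxP => [u e]; apply/sub_rVP.
  rewrite mulmx_sum_row in e; rewrite -(mxvecK X) e raddf_sum mulmx_sumr; apply: summx_sub => i _.
  rewrite /= linearZ -scalemxAr scalemx_sub //; apply: vl; apply: map_f.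
  by rewrite mem_enum.
have [X|f hf] := choice (P := fun X a => Z X -> v *m X = a *: v).
  by have [zX|nz] := pselect (Z X); [have [a] := vZ X zX; exists a|exists 0].
by exists f.
Qed.

End CommutingSpace.

Section Separation.

Variables (C : fieldType) (m : nat) (Z : 'M[C]_m -> Prop) (I : finType).
Variables (chi : I -> 'M[C]_m -> C) (u : I -> 'rV[C]_m).
Hypothesis hu : forall i X, Z X -> u i *m X = chi i X *: u i.

(** A product [Q] of factors [X - chi k X], one for each k whose character differs from that of i0,
    kills the unwanted terms and acts on the others by one nonzero scalar. *)
Lemma eigenvectors_separate (i0 : I) (J : pred I) :
  (forall i, J i <-> forall X, Z X -> chi i X = chi i0 X) ->
  \sum_i u i = 0 -> \sum_(i | J i) u i = 0.
Proof.
move=> hJ S0.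
have [Q [c [uQ cs [a a0 ca]]]] : exists (Q : 'M[C]_m) c, [/\ forall i, u i *m Q = c i *: u i,
    forall i, i \in [seq i <- enum I | ~~ J i] -> c i = 0 &
    exists2 a, a != 0 & forall i, J i -> c i = a].
  elim: (enum I) => [|k s [Q [c [uQ cs [a a0 ca]]]]] /=.
    exists 1%:M, (fun=> 1); split=> // [i|]; first by rewrite mulmx1 scale1r.
    by exists 1; rewrite ?oner_eq0.
  have [Jk|nJ] /= := boolP (J k); first by exists Q, c; split=> //; exists a.
  have [X zX ne] : exists2 X, Z X & chi k X != chi i0 X.
    apply: contrapT => no; case/negP: nJ; apply/hJ => X zX; apply/eqP.
    by apply: contrapT => /negP ne; apply: no; exists X.
  exists (Q *m (X - (chi k X)%:M)), (fun i => c i * (chi i X - chi k X)); split.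
  - move=> i; rewrite mulmxA uQ -scalemxAl mulmxBr hu // mul_mx_scalar -scalerBl.
    by rewrite scalerA.
  - by move=> i; rewrite inE => /orP [/eqP ->|/cs ->]; rewrite ?subrr ?mulr0 ?mul0r.
  - exists (a * (chi i0 X - chi k X)); first by rewrite mulf_neq0 // subr_eq0 eq_sym.
    by move=> i Ji; rewrite ca // (hJ i).1.
have := congr1 (mulmxr Q) S0; rewrite /= mul0mx mulmx_suml (bigID J) /=.
rewrite [X in _ + X]big1 => [|i nJ]; last first.
  by rewrite uQ cs ?scale0r // mem_filter nJ mem_enum.
rewrite addr0 (eq_bigr (fun i => a *: u i)) => [|i Ji]; last by rewrite uQ ca.
by rewrite -scaler_sumr => /eqP; rewrite scaler_eq0 (negPf a0) => /eqP.
Qed.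

End Separation.

Section ClassSums.

Variables (C : numClosedFieldType) (n m : nat).
Variable rG : mx_representation C [set: 'S_n] m.
Hypothesis irrG : mx_irreducible rG.

Lemma irreducible_dim_gt0 : (0 < m)%N.
Proof. by case: irrG => _; rewrite -mxrank_eq0 mxrank1 lt0n. Qed.

Lemma schur_scalar (X : 'M[C]_m) : (forall s : 'S_n, rG s *m X = X *m rG s) ->
  exists a, X = a%:M.
Proof.
move=> hX; have [a /eigenvalueP [v va v0]] := eigenvalue_closed X irreducible_dim_gt0.
exists a; apply/row_matrixP => i; rewrite !rowE.
pose P (u : 'rV[C]_m) := u *m X = u *m a%:M.
suff : forall u, P u by apply.
apply: (irreducible_span irrG v0).
- by rewrite /P mul_mx_scalar.
- by rewrite /P !mul0mx.
- by move=> b u w hu hw; rewrite /P !mulmxDl -!scalemxAl hu hw.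
- by move=> s u _ hu; rewrite /P -mulmxA hX mulmxA hu !mul_mx_scalar scalemxAl.
Qed.

Lemma class_sum_scalar (x : 'S_n) :
  exists a, \sum_(y in (x ^: [set: 'S_n])%g) rG y = a%:M.
Proof.
apply: schur_scalar => s; rewrite mulmx_sumr mulmx_suml.
rewrite [LHS](reindex_inj (conjg_inj s)) /=; apply: eq_big => [y|y _].
  by rewrite memJ_norm // (subsetP (class_norm x [group of [set: 'S_n]])) ?inE.
by rewrite -!repr_mxM ?inE // -conjgC.
Qed.

End ClassSums.

(** * Imprimitivity of irreducible modules *)

Section Imprimitivity.

Variables (C : numClosedFieldType) (n m : nat).
Variable rG : mx_representation C [set: 'S_n] m.
Hypothesis irrG : mx_irreducible rG.
Variable Z : 'M[C]_m -> Prop.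
Hypotheses (Z0 : Z 0) (Zlin : forall a X Y, Z X -> Z Y -> Z (a *: X + Y)).
Hypothesis Zcomm : forall X Y, Z X -> Z Y -> X *m Y = Y *m X.
Hypothesis Zconj : forall (s : 'S_n) X, Z X -> Z (rG s *m X *m rG s^-1%g).

Definition conj_mx (s : 'S_n) X := rG s *m X *m rG s^-1%g.

Lemma conj_mxM s t X : conj_mx s (conj_mx t X) = conj_mx (s * t)%g X.
Proof. by rewrite /conj_mx invMg !repr_mxM ?inE // !mulmxA. Qed.

Lemma conj_mx1 X : conj_mx 1%g X = X.
Proof. by rewrite /conj_mx invg1 repr_mx1 mul1mx mulmx1. Qed.

Lemma conj_mxE (u : 'rV[C]_m) s X : u *m rG s *m X = u *m conj_mx s X *m rG s.
Proof.
rewrite /conj_mx !mulmxA -[RHS]mulmxA -repr_mxM ?inE // mulVg repr_mx1 mulmx1 //.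
Qed.

Section Character.

Variables (v : 'rV[C]_m) (alpha : 'M[C]_m -> C).
Hypotheses (v0 : v != 0) (va : forall X, Z X -> v *m X = alpha X *: v).

(** The stabilizer of the eigencharacter stands for that of the joint eigenspace of v. Only values
    on Z are compared, since [alpha] is arbitrary elsewhere. *)
Definition stabilizer : {set 'S_n} :=
  [set s | `[< forall X, Z X -> alpha (conj_mx s X) = alpha X >]].

Lemma stabilizerP s : reflect (forall X, Z X -> alpha (conj_mx s X) = alpha X)
  (s \in stabilizer).
Proof. by rewrite inE; apply: asboolP. Qed.

Lemma stabilizer_group_set : group_set stabilizer.
Proof.
apply/group_setP; split; first by apply/stabilizerP => X _; rewrite conj_mx1.
move=> s t /stabilizerP hs /stabilizerP ht; apply/stabilizerP => X zX.
by rewrite -conj_mxM hs ?ht //; apply: Zconj.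
Qed.

Canonical stabilizer_group := Group stabilizer_group_set.

Lemma stabilizer_coset x y : (x * y^-1)%g \in stabilizer <->
  forall X, Z X -> alpha (conj_mx y X) = alpha (conj_mx x X).
Proof.
split=> [/stabilizerP h X zX|h].
  rewrite -(h (conj_mx y X)); last exact: Zconj.
  by rewrite conj_mxM mulgKV.
apply/stabilizerP => X zX; rewrite -conj_mxM -h; last exact: Zconj.
by rewrite conj_mxM mulgV conj_mx1.
Qed.

Lemma eigen_orbit y X : Z X -> v *m rG y *m X = alpha (conj_mx y X) *: (v *m rG y).
Proof. by move=> zX; rewrite conj_mxE va ?scalemxAl //; apply: Zconj. Qed.

(** The class sum relation at v is a vanishing sum of eigenvectors indexed by all permutations, with
    the term [- a v] attached to the index 1. Its part with the character of [v *m rG z] vanishes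
    separately. *)
Lemma coset_component x z a : \sum_(y in (x ^: [set: 'S_n])%g) rG y = a%:M ->
  \sum_(y in (x ^: [set: 'S_n])%g | (z * y^-1)%g \in stabilizer) v *m rG y =
  if z \in stabilizer then a *: v else 0.
Proof.
move=> ea; pose u y := (if y \in (x ^: [set: 'S_n])%g then v *m rG y else 0) -
  (if y == 1%g then a *: v else 0).
have hu y X : Z X -> u y *m X = alpha (conj_mx y X) *: u y.
  move=> zX; rewrite /u mulmxBl scalerBr; congr (_ - _).
    by case: ifP => _; rewrite ?mul0mx ?scaler0 ?eigen_orbit.
  case: eqP => [->|_]; last by rewrite mul0mx scaler0.
  by rewrite conj_mx1 -scalemxAl va // !scalerA mulrC.
have S0 : \sum_y u y = 0.
  rewrite sumrB -!big_mkcond /= -mulmx_sumr ea mul_mx_scalar.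
  by rewrite (big_pred1 1%g) ?subrr.
have := @eigenvectors_separate _ _ Z _ (fun y => alpha \o conj_mx y) u hu z
  (fun y => (z * y^-1)%g \in stabilizer) (fun y => stabilizer_coset z y) S0.
rewrite sumrB -!big_mkcondr /= => /eqP; rewrite subr_eq0 => /eqP e.
transitivity (\sum_(y | ((z * y^-1)%g \in stabilizer) && (y \in (x ^: [set: 'S_n])%g))
    v *m rG y); first by apply: eq_bigl => y; rewrite andbC.
rewrite e; case: ifP => zH.
  rewrite (big_pred1 1%g) // => y /=.
  by case: eqP => [->|]; rewrite ?andbF // invg1 mulg1 zH.
by rewrite big_pred0 // => y; case: eqP => [->|]; rewrite ?andbF // invg1 mulg1 zH.
Qed.

Lemma stabilizer_coset_sum x : x \notin stabilizer ->
  \sum_(y in (x ^: [set: 'S_n])%g | (x * y^-1)%g \in stabilizer) v *m rG y = 0.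
Proof.
have [a ea] := class_sum_scalar irrG x.
by rewrite (coset_component _ ea) => /negPf ->.
Qed.

End Character.

(* A form of the theorem of Djokovic and Malzan on imprimitive irreducible characters
   of S_n. *)
Theorem imprimitive_trichotomy : (4 < n)%N ->
  [\/ forall X, Z X -> exists a, X = a%:M,
      exists2 Y, Y != 0 & forall s : 'S_n, rG s *m Y = (-1) ^+ s *: (Y *m rG s) |
      (n = 5 \/ n = 8) /\ exists a b : 'I_n, a != b /\
        \sum_(y in (tperm a b ^: [set: 'S_n])%g) rG y = 0].
Proof.
move=> n4; have m0 := irreducible_dim_gt0 irrG.
have [v v0 [alpha va]] := common_eigenvector_space Z0 Zlin Zcomm m0.
have T4 : (4 < #|'I_n|)%N by rewrite card_ord.
have [all_in|even_in|[none_in n58]] :=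
  block_stabilizer (H := stabilizer_group alpha) T4 v0 (stabilizer_coset_sum va).
- constructor 1 => X zX; exists (alpha X).
  have in_all s : s \in stabilizer alpha.
    have [ts -> _] := prod_tpermP s; apply: group_prod => i _; exact: all_in.
  pose P (u : 'rV[C]_m) := forall X, Z X -> u *m X = alpha X *: u.
  suff PP : forall u, P u.
    by apply/row_matrixP => i; rewrite !rowE PP // mul_mx_scalar.
  apply: (irreducible_span irrG v0 va).
  + by move=> Y _; rewrite mul0mx scaler0.
  + by move=> b u w hu hw Y zY; rewrite mulmxDl -scalemxAl hu // hw // scalerDr scalerA mulrC -scalerA.
  + move=> s u _ hu Y zY; rewrite conj_mxE hu; last exact: Zconj.
    by rewrite (stabilizerP _ _ (in_all s)) // scalemxAl.
- constructor 2.
  pose x0 : 'I_n := Ordinal (ltn_trans (isT : 0 < 4)%N n4).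
  pose x1 : 'I_n := Ordinal (ltn_trans (isT : 1 < 4)%N n4).
  pose t := tperm x0 x1.
  have tV : (t^-1 = t)%g by apply: tpermV.
  have ot : odd_perm t by rewrite odd_tperm.
  have [X zX ne] : exists2 X, Z X & alpha (conj_mx t X) != alpha X.
    have : t \notin stabilizer alpha by rewrite even_in ot.
    apply: contraNP => no; apply/stabilizerP => X zX; apply/eqP.
    by apply: contrapT => /negP ne; apply: no; exists X.
  (* X takes different values on the two characters, which odd permutations exchange. So Y acts on
     [v *m rG s] by c or -c according to the parity of s. *)
  pose Y := X - conj_mx t X.
  have eY s : v *m conj_mx s Y = (alpha (conj_mx s X) - alpha (conj_mx (s * t)%g X)) *: v.
    rewrite /Y {1}/conj_mx mulmxBr mulmxBl -!/(conj_mx _ _) conj_mxM mulmxBr.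
    by rewrite !va ?scalerBl //; apply: Zconj.
  pose c := alpha X - alpha (conj_mx t X).
  have c0 : c != 0 by rewrite subr_eq0 eq_sym.
  have sY (s : 'S_n) : v *m rG s *m Y = ((-1) ^+ s * c) *: (v *m rG s).
    rewrite conj_mxE eY -scalemxAl; congr (_ *: _).
    have [os|os] := boolP (odd_perm s).
      have sH : (s * t)%g \in stabilizer alpha by rewrite even_in odd_permM os ot.
      have es : (s * t * t)%g = s by rewrite -{2}tV mulgK.
      have -> : conj_mx s X = conj_mx (s * t)%g (conj_mx t X) by rewrite conj_mxM es.
      rewrite !(stabilizerP _ _ sH) //; last exact: Zconj.
      by rewrite expr1 mulN1r opprB.
    have sH : s \in stabilizer alpha by rewrite even_in.
    rewrite (stabilizerP _ _ sH) // -conj_mxM (stabilizerP _ _ sH); last exact: Zconj.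
    by rewrite expr0 mul1r.
  have vY : v *m Y = c *: v.
    by have := sY 1%g; rewrite repr_mx1 mulmx1 odd_perm1 expr0 mul1r.
  exists Y; first by apply: contraNneq v0 => Y0; move/esym/eqP: vY;
    rewrite Y0 mulmx0 scaler_eq0 (negPf c0).
  pose P (u : 'rV[C]_m) := forall s : 'S_n, u *m rG s *m Y = (-1) ^+ s *: (u *m Y *m rG s).
  suff PP : forall u, P u.
    by move=> s; apply/row_matrixP => i; rewrite !rowE mulmxA PP -scalemxAr mulmxA.
  apply: (irreducible_span irrG v0).
  + by move=> s; rewrite sY vY -scalemxAl scalerA.
  + by move=> s; rewrite !mul0mx scaler0.
  + move=> b u w hu hw s; rewrite !mulmxDl -!scalemxAl hu hw scalerDr.
    by rewrite !scalerA mulrC.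
  + move=> g u _ hu s; rewrite -(mulmxA u) -repr_mxM ?inE // hu hu -scalemxAl scalerA.
    by rewrite odd_permM signr_addb mulrC (repr_mxM rG) ?inE // mulmxA.
- constructor 3; rewrite card_ord in n58; split=> //.
  pose x0 : 'I_n := Ordinal (ltn_trans (isT : 0 < 4)%N n4).
  pose x1 : 'I_n := Ordinal (ltn_trans (isT : 1 < 4)%N n4).
  have ab : x0 != x1 by [].
  exists x0, x1; split=> //.
  (* The coset of 1 is H, which contains no transposition, so the corresponding component of the
     class sum is empty; this makes the scalar a vanish. *)
  have [a ea] := class_sum_scalar irrG (tperm x0 x1).
  have := coset_component va 1%g ea; rewrite group1 big_pred0 => [/esym/eqP|y].
    by rewrite scaler_eq0 (negPf v0) orbF => /eqP a0; rewrite ea a0 raddf0.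
  apply/negP => /andP [/(tperm_classP _ ab) [c [e [ce ->]]]].
  by rewrite mul1g groupV; apply/negP; apply: none_in.
Qed.

End Imprimitivity.

(** * The two cases *)

Section JacobianIso.

Context {C : numFieldType} {n m : nat}.
Variable rG : mx_representation C [set: 'S_n] m.
Implicit Types f h : {mpoly C[m]}.

Definition dirder_of f (v : 'rV[C]_m) : {mpoly C[m]} := dirder v f.

Lemma dirder_of_is_linear f : linear (dirder_of f).
Proof. by move=> a u v; apply: dirder_linl. Qed.

HB.instance Definition _ f :=
  GRing.isLinear.Build C 'rV[C]_m {mpoly C[m]} _ (dirder_of f) (dirder_of_is_linear f).

(** The map [v |-> dirder v f] is equivariant up to the factor by which s scales f, and that factor
    is the twist. *)
Lemma semi_invariant_jacobian_iso f b :
  (forall v, dirder v f = 0 -> v = 0) ->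
  (forall s : 'S_n, form_act rG s f = pm_char b s *: f) ->
  jacobian_iso rG f (pm_tensor rG b).
Proof.
move=> nd hf; exists (dirder_of f); split=> [u v e|g|s v].
- apply/eqP; rewrite -subr_eq0; apply/eqP; apply: nd.
  by rewrite dirderBl; apply/eqP; rewrite subr_eq0; apply/eqP.
- by [].
change (dirder (v *m pm_tensor rG b s) f = form_act rG s (dirder v f)).
by rewrite form_act_dirder hf dirderZ pm_tensorE -scalemxAr dirderZl.
Qed.

Lemma jacobian_iso_transfer f k k' (r : mx_representation C [set: 'S_n] k)
    (r' : mx_representation C [set: 'S_n] k') (B : 'M[C]_(k', k)) :
  row_free B -> row_full B -> (forall s : 'S_n, r' s *m B = B *m r s) ->
  jacobian_iso rG f r -> jacobian_iso rG f r'.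
Proof.
move=> freeB fullB hB [phi [phi_inj phi_im phi_act]].
exists (phi \o mulmxr B); split=> [u v /= /phi_inj|g|s v /=].
- exact: row_free_inj.
- split=> [/phi_im [v ->]|[v ->]]; last by apply/phi_im; exists (v *m B).
  by have /submxP [w ->] := submx_full v fullB; exists w.
by rewrite -mulmxA hB mulmxA phi_act.
Qed.

Lemma jacobian_iso_same f h k (r : mx_representation C [set: 'S_n] k) :
  same_space (jacobian h) (jacobian f) -> jacobian_iso rG h r -> jacobian_iso rG f r.
Proof.
move=> J [phi [phi_inj phi_im phi_act]]; exists phi; split=> // g.
by rewrite -phi_im; split=> /J.
Qed.

Lemma jacobian_iso_untwist f : jacobian_iso rG f (pm_tensor rG false) -> jacobian_iso rG f rG.
Proof.
apply: (@jacobian_iso_transfer _ _ _ _ _ 1%:M).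
- by rewrite row_free_unit unitmx1.
- by rewrite row_full_unit unitmx1.
by move=> s; rewrite pm_tensorE mulmx1 mul1mx /pm_char expr0 scale1r.
Qed.

End JacobianIso.

(** Transpositions are conjugate and of order 2, so the character has one value on all of them, 1 or
    -1. *)
Lemma linear_character_sym (C : numFieldType) (n : nat) (c : 'S_n -> C) :
  c 1%g = 1 -> (forall s t, c (s * t)%g = c s * c t) ->
  exists b, forall s, c s = pm_char b s.
Proof.
move=> c1 cM.
have cJ s t : c (s ^ t)%g = c s.
  have cV : c t^-1%g * c t = 1 by rewrite -cM mulVg.
  by rewrite /conjg !cM mulrCA cV mulr1.
have csq x y : c (tperm x y) ^+ 2 = 1 by rewrite expr2 -cM tperm2.
have same (x y x' y' : 'I_n) : x != y -> x' != y' -> c (tperm x y) = c (tperm x' y').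
  move=> xy xy'.
  have /imsetP [s _ ->] : tperm x' y' \in (tperm x y ^: [set: 'S_n])%g.
    by apply/tperm_classP => //; exists x', y'.
  by rewrite cJ.
have [b hb] : exists b : bool, forall x y : 'I_n, x != y -> c (tperm x y) = (-1) ^+ b.
  have [/existsP [x /existsP [y xy]]|no] := boolP [exists x : 'I_n, exists y, x != y].
    have := csq x y; move/eqP; rewrite sqrf_eq1 => /orP [] /eqP e.
      by exists false => x' y' xy'; rewrite -(same x y) // e expr0.
    by exists true => x' y' xy'; rewrite -(same x y) // e expr1.
  exists false => x y xy; case/negP: no; apply/existsP; exists x.
  by apply/existsP; exists y.
exists b => s; have [ts -> +] := prod_tpermP s.
elim: ts => [_|[x y] ts IH /andP [/= xy hts]].
  by rewrite big_nil c1 /pm_char odd_perm1 andbF.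
rewrite big_cons cM (hb _ _ xy) (IH hts) /pm_char odd_permM odd_tperm xy -signr_addb.
by case: b {hb IH}.
Qed.

Lemma Alt_perfect n : (4 < n)%N -> (('Alt_('I_n))^`(1) = 'Alt_('I_n))%g.
Proof.
move=> n4; have T4 : (4 < #|'I_n|)%N by rewrite card_ord.
have [_ simA] := simpleP _ (simple_Alt5 T4).
have [der1|//] := simA _ (der_normal 1 ('Alt_('I_n))%g).
have : solvable ('Alt_('I_n))%g by apply: abelian_sol; apply/commG1P.
by rewrite solvable_AltF.
Qed.

Section PartOne.

Variables (C : numClosedFieldType) (n : nat) (la : seq nat).
Hypotheses (n4 : (4 < n)%N) (hla : is_partition n la).
Local Notation V := (specht_repr C n la).
Local Notation m := (specht_dim C n la).

Lemma partition_irreducible : mx_irreducible V.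
Proof.
have [t ht] := tableau_exists hla.
exact: specht_irreducible (diagram_closed hla) ht.
Qed.

(** Each other branch of the trichotomy makes [la] self-conjugate: the anticommuting Y through
    dominance, the vanishing class sum through contents. *)
Lemma commuting_space_scalar (Z : 'M[C]_m -> Prop) :
  Z 0 -> (forall a X Y, Z X -> Z Y -> Z (a *: X + Y)) ->
  (forall X Y, Z X -> Z Y -> X *m Y = Y *m X) ->
  (forall (s : 'S_n) X, Z X -> Z (V s *m X *m V s^-1%g)) ->
  la <> conj_partition la -> forall X, Z X -> exists a, X = a%:M.
Proof.
move=> Z0 Zlin Zcomm Zconj nsc.
case: (imprimitive_trichotomy partition_irreducible Z0 Zlin Zcomm Zconj n4) => //.
  by case=> Y nzY hY; case: nsc; apply: anticommuting_self_conjugate nzY hY.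
case=> n58 [a [b [ab S0]]]; case: nsc; have [t ht] := tableau_exists hla.
apply: (small_content_zero hla n58); apply: (@content_zero C _ _ t a b hla ht ab).
have := congr1 (fun A => val_submod (in_submod (specht_mx C n la) (polytabloid C t) *m A)) S0.
rewrite mulmx0 linear0 mulmx_sumr linear_sum => e; rewrite -[RHS]e.
apply: eq_bigr => s _ /=; rewrite (val_submodJ (specht_mxmodule C n la)) ?inE //.
by rewrite in_submodK // polytabloid_specht.
Qed.

Variables (d : nat) (f : {mpoly C[m]}).
Hypotheses (hf : f \is d.+3.-homog) (f_neq0 : f != 0) (hJ : jacobian_invariant V f).

Let irrV := partition_irreducible.
Let nd := invariant_nondegenerate irrV hf f_neq0 hJ.
Local Notation Z := (form_center d.+3 f).

(** As the center is scalar, each [s f] is a multiple of f, and the multiplier is a linear character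
    of S_n. *)
Lemma not_self_conjugate_case : la <> conj_partition la ->
  exists b : bool,
  [/\ forall s : 'S_n, form_act V s f = pm_char b s *: f,
      jacobian_iso V f (pm_tensor V b),
      jacobian_iso V f (specht_repr C n (if b then conj_partition la else la)) &
      forall h, same_jacobian d.+3 f h <-> exists2 a, a != 0 & h = a *: f].
Proof.
move=> nsc.
have Zs X : Z X -> exists a, X = a%:M.
  apply: (commuting_space_scalar _ _ _ _ nsc).
  - exact: center0 hf.
  - by move=> a X' Y; apply: (center_lin hf).
  - by move=> X' Y; apply: (center_comm hf nd).
  - by move=> s X'; apply: (center_conj irrV hf f_neq0 hJ).
have scal h a : h \is d.+3.-homog -> (forall v, dirder v h = dirder (v *m a%:M) f) -> h = a *: f.
  move=> hh e; apply: (homog_dirder_inj (ltn0Sn d.+2) hh (rpredZ _ hf)) => v.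
  by rewrite e mul_mx_scalar dirderZl dirderZ.
have act_scal (s : 'S_n) : exists a, form_act V s f = a *: f.
  have [X [Y [zX _ e]]] := act_center irrV hf f_neq0 hJ s.
  have [a ea] := Zs X zX; exists a; apply: scal; first exact: form_act_homog.
  by move=> v; rewrite e ea.
have [c hc] := choice act_scal.
have f_inj a b : a *: f = b *: f -> a = b.
  move/eqP; rewrite -subr_eq0 -scalerBl scaler_eq0 (negPf f_neq0) orbF subr_eq0.
  by move/eqP.
have [b hb] : exists b, forall s, c s = pm_char b s.
  apply: linear_character_sym; first by apply: f_inj; rewrite -hc form_act1 scale1r.
  by move=> s t; apply: f_inj; rewrite -hc -form_actM hc form_actZ hc scalerA mulrC.
have inv (s : 'S_n) : form_act V s f = pm_char b s *: f by rewrite hc hb.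
have isob := semi_invariant_jacobian_iso nd inv.
exists b; split=> //.
- case: b isob {hb inv} => iso; last exact: jacobian_iso_untwist.
  have [t ht] := tableau_exists hla.
  have [B [/andP [freeB fullB] hB]] := specht_sign C (diagram_closed hla)
    (diagram_conj_closed hla) (diagram_conj hla) ht.
  exact: jacobian_iso_transfer freeB fullB hB iso.
move=> h; split=> [/(same_jacobianP hf nd) [hh [X [Y [zX XY e]]]]|[a a0 ->]].
  have [a ea] := Zs X zX; exists a; last by apply: scal => // v; rewrite e ea.
  apply: contraNneq f_neq0 => a0; apply/eqP; apply: (homog_dirder_eq0 hf) => v.
  by rewrite -[v]mulmx1 -XY ea a0 raddf0 mul0mx mulmx0 dirder0l.
apply/(same_jacobianP hf nd); split; first exact: rpredZ.
exists a%:M, a^-1%:M; split; first exact: (center_scalar hf).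
  by rewrite -scalar_mxM mulfV.
by move=> v; rewrite mul_mx_scalar dirderZl dirderZ.
Qed.

End PartOne.

(** * Primitive idempotents and the two-block case *)

Section PrimitiveIdempotents.

Variables (F : numFieldType) (m : nat) (Z : 'M[F]_m -> Prop).
Hypotheses (Zlin : forall a X Y, Z X -> Z Y -> Z (a *: X + Y)) (Zs : forall a, Z a%:M).
Hypothesis ZM : forall X Y, Z X -> Z Y -> Z (X *m Y).
Hypothesis Zcomm : forall X Y, Z X -> Z Y -> X *m Y = Y *m X.

(** For distinct [cs], its vanishing says that X is diagonalizable with eigenvalues in [cs]. *)
Definition split_mx (X : 'M[F]_m) (cs : seq F) := \big[mulmx/1%:M]_(c <- cs) (X - c%:M).

Lemma split_mx_cons X c cs : split_mx X (c :: cs) = (X - c%:M) *m split_mx X cs.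
Proof. by rewrite /split_mx big_cons. Qed.

Lemma sub_scalar_mem X c : Z X -> Z (X - c%:M).
Proof.
move=> zX; rewrite addrC -scaleN1r; apply: Zlin => //; exact: Zs.
Qed.

Lemma split_mx_mem X cs : Z X -> Z (split_mx X cs).
Proof.
move=> zX; elim: cs => [|c cs IH]; first by rewrite /split_mx big_nil; apply: Zs.
by rewrite split_mx_cons; apply: ZM => //; apply: sub_scalar_mem.
Qed.

Lemma split_mx_eigen X (Y : 'M[F]_m) c cs : Z X -> Y *m X = c *: Y ->
  Y *m split_mx X cs = (\prod_(a <- cs) (c - a)) *: Y.
Proof.
move=> zX e; elim: cs => [|a cs IH].
  by rewrite /split_mx !big_nil mulmx1 scale1r.
rewrite split_mx_cons big_cons mulmxA mulmxBr e mul_mx_scalar -scalerBl -scalemxAl IH.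
by rewrite scalerA.
Qed.

(* Lagrange interpolation: for distinct c, cs, the multiple of [e * split_mx X cs] fixing
   the c-eigenspace is an idempotent of Z below e. *)
Lemma primitive_eigenvalue e X cs : primitive_idempotent Z e -> Z X -> uniq cs ->
  e *m split_mx X cs = 0 -> exists c, e *m X = c *: e.
Proof.
case=> ze ee e0 prim zX; elim: cs => [|c cs IH] /=.
  by rewrite /split_mx big_nil mulmx1 => _ e00; rewrite e00 eqxx in e0.
move=> /andP [ncs ucs]; rewrite split_mx_cons => S0.
pose k := \prod_(a <- cs) (c - a).
have k0 : k != 0.
  rewrite /k prodf_seq_neq0; apply/allP => a acs /=; rewrite subr_eq0.
  by apply: contraNneq ncs => ->.
pose L := split_mx X cs; have zL : Z L by apply: split_mx_mem.
pose a := k^-1 *: (e *m L).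
have za : Z a.
  by rewrite /a -[_ *: _]addr0 -(raddf0 (@scalar_mx F m)); apply: Zlin; [exact: ZM|exact: Zs].
have aX : a *m X = c *: a.
  apply/eqP; rewrite -subr_eq0 -mul_mx_scalar -mulmxBr /a -scalemxAl -mulmxA.
  rewrite (Zcomm zL); last exact: sub_scalar_mem.
  by rewrite S0 scaler0.
have aL : a *m L = k *: a by apply: split_mx_eigen.
have ea : e *m a = a by rewrite /a -scalemxAr mulmxA ee.
have ae : a *m e = a by rewrite -(Zcomm ze za).
have aa : a *m a = a.
  by rewrite {2}/a -scalemxAr mulmxA ae aL scalerA mulVf // scale1r.
have zea : Z (e - a) by rewrite addrC -scaleN1r; apply: Zlin.
have [|||||||a0|ea0] := prim a (e - a) => //.
- by rewrite mulmxBl !mulmxBr ee ea ae aa subrr subr0.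
- by rewrite mulmxBr ae aa subrr.
- by rewrite mulmxBl ea aa subrr.
- by rewrite addrC subrK.
- apply: IH => //; move/eqP: a0; rewrite scaler_eq0 invr_eq0 (negPf k0) /=.
  by move/eqP.
by exists c; rewrite -(subrK a e) ea0 add0r.
Qed.

End PrimitiveIdempotents.

Section PartTwo.

Variables (C : numClosedFieldType) (n m d : nat).
Variables (rG : mx_representation C [set: 'S_n] m) (f : {mpoly C[m]}).
Hypotheses (n4 : (4 < n)%N) (irrG : mx_irreducible rG).
Hypotheses (hf : f \is d.+3.-homog) (f_neq0 : f != 0) (hJ : jacobian_invariant rG f).
Implicit Types (s t : 'S_n) (u v : 'rV[C]_m) (X Y : 'M[C]_m).

Let nd := invariant_nondegenerate irrG hf f_neq0 hJ.
Local Notation Z := (form_center d.+3 f).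
Let zM := @centerM _ _ _ _ hf nd.
Let zL := @center_lin _ _ _ _ hf.
Let zC := @center_comm _ _ _ _ hf nd.
Let zJ := @center_conj _ _ _ rG d f irrG hf f_neq0 hJ.
Let zS := @center_scalar _ _ _ _ hf.

(** The translates [v *m rG s] of a common eigenvector span V and are eigenvectors of X, so one
    linear factor for each distinct eigenvalue suffices. *)
Lemma center_split X : Z X -> exists2 cs, uniq cs & split_mx X cs = 0.
Proof.
move=> zX; have [v v0 [alpha va]] := common_eigenvector_space (center0 hf)
  zL zC (irreducible_dim_gt0 irrG).
pose cs := undup [seq alpha (conj_mx rG s X) | s : 'S_n].
exists cs; first exact: undup_uniq.
pose P (u : 'rV[C]_m) := u *m split_mx X cs = 0.
have orbit s : P (v *m rG s).
  have : alpha (conj_mx rG s X) \in cs by rewrite mem_undup map_f ?mem_enum.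
  rewrite /P; have := eigen_orbit zJ va s zX; move: (alpha _) (v *m rG s) => c w hw.
  elim: (cs) => // a l IH; rewrite inE split_mx_cons mulmxA mulmxBr hw mul_mx_scalar.
  rewrite -scalerBl -scalemxAl => /orP [/eqP ->|/IH ->]; last by rewrite scaler0.
  by rewrite subrr scale0r.
pose Q (u : 'rV[C]_m) := forall s, P (u *m rG s).
suff QQ : forall u, Q u.
  by apply: mx_eq_rV => u; have := QQ u 1%g; rewrite repr_mx1 mulmx1 mulmx0.
apply: (irreducible_span irrG v0 orbit).
- by move=> s; rewrite /P !mul0mx.
- by move=> a u w hu hw s; rewrite /P !mulmxDl -!scalemxAl hu hw scaler0 addr0.
- by move=> s u _ hu t; rewrite -mulmxA -repr_mxM ?inE.
Qed.

Lemma primitive_conj s e : primitive_idempotent Z e ->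
  primitive_idempotent Z (conj_mx rG s e).
Proof.
have cM t X Y : conj_mx rG t (X *m Y) = conj_mx rG t X *m conj_mx rG t Y.
  rewrite /conj_mx !mulmxA -(mulmxA _ (rG t^-1%g) (rG t)) -repr_mxM ?inE //.
  by rewrite mulVg repr_mx1 mulmx1.
have cD t X Y : conj_mx rG t (X + Y) = conj_mx rG t X + conj_mx rG t Y.
  by rewrite /conj_mx mulmxDr mulmxDl.
have c0 t : conj_mx rG t 0 = 0 by rewrite /conj_mx mulmx0 mul0mx.
have cK t X : conj_mx rG t^-1%g (conj_mx rG t X) = X by rewrite conj_mxM mulVg conj_mx1.
have cK' t X : conj_mx rG t (conj_mx rG t^-1%g X) = X by rewrite conj_mxM mulgV conj_mx1.
case=> ze ee e0 prim; split.
- exact: zJ.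
- by rewrite -cM ee.
- by apply: contraNneq e0 => ce0; rewrite -(cK s e) ce0 c0.
move=> a b za zb aa bb ab ba eab.
have [|||||||a0|b0] := prim (conj_mx rG s^-1%g a) (conj_mx rG s^-1%g b).
- exact: zJ.
- exact: zJ.
- by rewrite -cM aa.
- by rewrite -cM bb.
- by rewrite -cM ab c0.
- by rewrite -cM ba c0.
- by rewrite -cD -eab cK.
- by left; rewrite -(cK' s a) a0 c0.
- by right; rewrite -(cK' s b) b0 c0.
Qed.


Variables (Wp Wm ep em : 'M[C]_m).
Hypotheses (hW : alternating_split rG Wp Wm) (hcan : canonical_idempotents d.+3 f [:: ep; em]).
Hypotheses (epW : (ep :=: Wp)%MS) (emW : (em :=: Wm)%MS).

Let prim_ep : primitive_idempotent Z ep.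
Proof. by apply/hcan.2; rewrite inE eqxx. Qed.
Let prim_em : primitive_idempotent Z em.
Proof. by apply/hcan.2; rewrite !inE eqxx orbT. Qed.
Let zep : Z ep. Proof. by case: prim_ep. Qed.
Let zem : Z em. Proof. by case: prim_em. Qed.
Let epp : ep *m ep = ep. Proof. by case: prim_ep. Qed.
Let emm : em *m em = em. Proof. by case: prim_em. Qed.
Let ep0 : ep != 0. Proof. by case: prim_ep. Qed.
Let em0 : em != 0. Proof. by case: prim_em. Qed.

Lemma blocks_orthogonal : ep *m em = 0.
Proof.
have [_ _ _ _ cap0] := hW; apply/eqP; rewrite -submx0 -cap0 sub_capmx -epW -emW.
by rewrite submxMl (zC zep zem) submxMl.
Qed.

Let epm := blocks_orthogonal.
Let emp : em *m ep = 0. Proof. by rewrite (zC zem zep). Qed.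

Lemma blocks_sum : ep + em = 1%:M.
Proof.
have [_ _ _ sum1 _] := hW.
have /sub_addsmxP [[a b] /= e1] : (1%:M <= ep + em)%MS.
  by rewrite (adds_eqmx epW emW) sum1.
rewrite -[LHS]mul1mx e1 mulmxDl !mulmxDr -!mulmxA epp epm emp emm !mulmx0 addr0 add0r.
by rewrite -e1.
Qed.

Lemma block_even s : ~~ odd_perm s -> conj_mx rG s ep = ep.
Proof.
move=> es; have [[modp _ _] [modm _ _] _ _ _] := hW.
have sA : s \in ('Alt_('I_n))%g by rewrite Alt_even.
have p1 : (ep *m rG s <= ep)%MS.
  by rewrite (eqmxMr _ epW) epW; exact: (mxmoduleP modp s sA).
have m1 : (em *m rG s <= em)%MS.
  by rewrite (eqmxMr _ emW) emW; exact: (mxmoduleP modm s sA).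
have p2 : ep *m rG s *m ep = ep *m rG s.
  by case/submxP: p1 => a ->; rewrite -mulmxA epp.
have m2 : em *m rG s *m ep = 0.
  by case/submxP: m1 => a ->; rewrite -mulmxA emp mulmx0.
have comm : rG s *m ep = ep *m rG s.
  by rewrite -[rG s in LHS]mul1mx -blocks_sum !mulmxDl p2 m2 addr0.
by rewrite /conj_mx comm -mulmxA -repr_mxM ?inE // mulgV repr_mx1 mulmx1.
Qed.

(** Conjugation permutes the primitive idempotents. If s fixed [ep], so would every permutation, and
    [ep] would be a nonzero scalar by Schur's lemma, contradicting [ep *m em = 0]. *)
Lemma block_odd s : odd_perm s -> conj_mx rG s ep = em.
Proof.
move=> os; have /hcan.2 := primitive_conj s prim_ep.
rewrite !inE => /orP [/eqP fix_s|/eqP //].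
have all_fix t : conj_mx rG t ep = ep.
  have [ot|et] := boolP (odd_perm t); last exact: block_even.
  have -> : t = (t * s^-1 * s)%g by rewrite mulgKV.
  by rewrite -conj_mxM fix_s block_even // odd_permM odd_permV ot os.
have [a ea] : exists a, ep = a%:M.
  apply: (schur_scalar irrG) => t; rewrite -[in RHS](all_fix t) /conj_mx -[RHS]mulmxA.
  by rewrite -repr_mxM ?inE // mulVg repr_mx1 mulmx1.
have a0 : a != 0 by apply: contraNneq ep0 => a0; rewrite ea a0 raddf0.
case/eqP: em0; apply/eqP; have /eqP := epm.
by rewrite ea mul_scalar_mx scaler_eq0 (negPf a0).
Qed.

(** X is diagonalizable, so each primitive idempotent reduces it to a scalar, and the two
    idempotents add up to 1. *)
Lemma center_span X : Z X -> exists a b, X = a *: ep + b *: em.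
Proof.
move=> zX; have [cs ucs X0] := center_split zX.
have [|a ha] := primitive_eigenvalue zL zS zM zC prim_ep zX ucs; first by rewrite X0 mulmx0.
have [|b hb] := primitive_eigenvalue zL zS zM zC prim_em zX ucs; first by rewrite X0 mulmx0.
by exists a, b; rewrite -[LHS]mul1mx -blocks_sum mulmxDl ha hb.
Qed.

Variable p : {mpoly C[m]}.
Hypothesis hp : is_twist d.+3 f ep p.
Variables x y : 'I_n.
Hypothesis xy : x != y.

Let q := form_act rG (tperm x y) p.
Let odd_t : odd_perm (tperm x y). Proof. by rewrite odd_tperm. Qed.
Let php : p \is d.+3.-homog. Proof. by case: hp. Qed.
Let qhq : q \is d.+3.-homog. Proof. exact: form_act_homog. Qed.

Let dp v : dirder v p = dirder (v *m ep) f.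
Proof. exact: twist_dirder hf hp. Qed.

Lemma unit_span a b Y : (a *: ep + b *: em) *m Y = 1%:M -> a != 0 /\ b != 0.
Proof.
move=> e; split.
  apply: contraNneq ep0 => a0; rewrite -[ep]mulmx1 -e a0 scale0r add0r mulmxA.
  by rewrite -scalemxAr epm scaler0 mul0mx.
apply: contraNneq em0 => b0; rewrite -[em]mulmx1 -e b0 scale0r addr0 mulmxA.
by rewrite -scalemxAr emp scaler0 mul0mx.
Qed.

(** The central element attached to [s f] is [a *: ep + b *: em]; its invertibility makes both
    coefficients nonzero. *)
Lemma dirder_act s : exists a b, [/\ a != 0, b != 0 &
  forall v, dirder v (form_act rG s p) =
    dirder (v *m conj_mx rG s^-1%g ep *m (a *: ep + b *: em)) f].
Proof.
have [X [Y [zX XY e]]] := act_center irrG hf f_neq0 hJ s.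
have [a [b eX]] := center_span zX; rewrite eX in e XY.
have [a0 b0] := unit_span XY; exists a, b; split=> // v.
rewrite dirder_form_act dp form_act_dirder e /conj_mx invgK !mulmxA //.
Qed.

Lemma dirder_q : exists2 b, b != 0 & forall v, dirder v q = b *: dirder (v *m em) f.
Proof.
have [a [b [_ b0 e]]] := dirder_act (tperm x y).
exists b => // v; rewrite e block_odd ?odd_permV // mulmxDr -!scalemxAr -!mulmxA emp emm.
by rewrite mulmx0 scaler0 add0r dirderZl.
Qed.

Lemma even_scalar s : ~~ odd_perm s -> exists a, form_act rG s p = a *: p.
Proof.
move=> es; have [a [b [_ _ e]]] := dirder_act s.
exists a; apply: (homog_dirder_inj (ltn0Sn d.+2)) => [||v].
- exact: form_act_homog.
- exact: rpredZ.
rewrite e block_even ?odd_permV // mulmxDr -!scalemxAr -!mulmxA epp epm mulmx0 scaler0.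
by rewrite addr0 dirderZl dirderZ dp.
Qed.

Lemma p_neq0 : p != 0.
Proof.
apply: contraNneq ep0 => p0; apply/eqP; apply: mx_eq_rV => u; rewrite mulmx0.
by apply: nd; rewrite -dp p0 dirder0.
Qed.

(** Even permutations scale p, so their commutators fix it, and these generate the perfect group
    A_n. *)
Lemma even_invariant s : ~~ odd_perm s -> form_act rG s p = p.
Proof.
pose K := [set s : 'S_n | form_act rG s p == p].
have gK : group_set K.
  apply/group_setP; split; first by rewrite inE form_act1.
  move=> s1 s2; rewrite !inE => /eqP h1 /eqP h2.
  by rewrite -form_actM h1 h2.
suff : ('Alt_('I_n))%g \subset K.
  by move=> /subsetP sub es; apply/eqP; have := sub s; rewrite Alt_even inE; apply.
rewrite -(Alt_perfect n4) -[K]/(gval (Group gK)) derg1 gen_subG.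
apply/subsetP => _ /imset2P [s1 s2 h1 h2 ->].
rewrite !Alt_even in h1 h2; rewrite inE.
have [a ha] := even_scalar h1; have [b hb] := even_scalar h2.
have a0 : a != 0.
  by apply: contraNneq p_neq0 => a0; apply/eqP/(@form_act_inj _ _ _ rG s1);
    rewrite ha a0 scale0r /form_act raddf0.
have b0 : b != 0.
  by apply: contraNneq p_neq0 => b0; apply/eqP/(@form_act_inj _ _ _ rG s2);
    rewrite hb b0 scale0r /form_act raddf0.
have inv s0 c : c != 0 -> form_act rG s0 p = c *: p -> form_act rG s0^-1%g p = c^-1 *: p.
  move=> c0 hc; apply: (@form_act_inj _ _ _ rG s0).
  by rewrite form_actM mulVg form_act1 form_actZ hc scalerA mulVf // scale1r.
rewrite commgEl /conjg -!form_actM (inv s1 a) // form_actZ (inv s2 b) // !form_actZ.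
by rewrite ha form_actZ hb !scalerA (mulrAC a^-1) mulVf // mul1r mulVf // scale1r.
Qed.

Lemma even_invariant_q s : ~~ odd_perm s -> form_act rG s q = q.
Proof.
move=> es; rewrite /q form_actM.
have -> : (tperm x y * s = (tperm x y * s * (tperm x y)^-1) * tperm x y)%g.
  by rewrite mulgKV.
rewrite -form_actM even_invariant // !odd_permM odd_permV (negPf es) addbF.
by rewrite addbb.
Qed.

Lemma odd_swap s : odd_perm s -> form_act rG s p = q /\ form_act rG s q = p.
Proof.
move=> os; split; last first.
  by rewrite /q form_actM even_invariant // odd_permM os odd_t.
have -> : s = (s * (tperm x y)^-1 * tperm x y)%g by rewrite mulgKV.
by rewrite -form_actM even_invariant // odd_permM odd_permV os odd_t.
Qed.

(** Forms with this Jacobian correspond to the invertible elements of the center. The constant c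
    enters because q is obtained from p by the action, so it is only known to be a nonzero multiple
    of the twist of f by [em]. *)
Lemma same_jacobian_blocks h : same_jacobian d.+3 f h <->
  exists a b, [/\ a != 0, b != 0 & h = a *: p + b *: q].
Proof.
have [c c0 hq] := dirder_q.
have dpq a b v : dirder v (a *: p + b *: q) = dirder (v *m (a *: ep + (b * c) *: em)) f.
  rewrite dirderD !dirderZ dp hq mulmxDr -!scalemxAr dirderDl !dirderZl.
  by rewrite scalerA.
split=> [/(same_jacobianP hf nd) [hh [X [Y [zX XY e]]]]|[a [b [a0 b0 ->]]]].
  have [a [b eX]] := center_span zX; rewrite eX in e XY.
  have [a0 b0] := unit_span XY.
  exists a, (b / c); split=> //; first by rewrite mulf_neq0 ?invr_eq0.
  apply: (homog_dirder_inj (ltn0Sn d.+2) hh) => [|v]; first by rewrite rpredD ?rpredZ.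
  by rewrite dpq mulfVK // e.
apply/(same_jacobianP hf nd); split; first by rewrite rpredD ?rpredZ.
exists (a *: ep + (b * c) *: em), (a^-1 *: ep + (b * c)^-1 *: em); split=> [||v].
- by apply: (zL _ zep); rewrite -[_ *: em]addr0; exact: zL _ zem (center0 hf).
- have bc0 : b * c != 0 by rewrite mulf_neq0.
  rewrite !mulmxDl !mulmxDr -!scalemxAl -!scalemxAr epp epm emp emm !scaler0 addr0 add0r.
  by rewrite !scalerA !mulfV // !scale1r blocks_sum.
exact: dpq.
Qed.

(** The isomorphism type of J(f) is read off from the invariant form p + q, which has the same
    Jacobian. *)
Lemma self_conjugate_case :
  [/\ jacobian_iso rG f rG,
      forall h, same_jacobian d.+3 f h <->
        exists a b, [/\ a != 0, b != 0 & h = a *: p + b *: q],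
      same_jacobian d.+3 f (p + q) /\ (forall s, form_act rG s (p + q) = p + q) &
      same_jacobian d.+3 f (p - q) /\
        (forall s, form_act rG s (p - q) = (-1) ^+ s *: (p - q))].
Proof.
have jpq : same_jacobian d.+3 f (p + q).
  by apply/same_jacobian_blocks; exists 1, 1; rewrite !scale1r oner_eq0.
have inv s : form_act rG s (p + q) = p + q.
  rewrite form_actD; have [os|es] := boolP (odd_perm s).
    by have [-> ->] := odd_swap os; rewrite addrC.
  by rewrite (even_invariant es) (even_invariant_q es).
split; [|exact: same_jacobian_blocks|by []|split].
- apply: (jacobian_iso_same jpq.2); apply: jacobian_iso_untwist.
  apply: semi_invariant_jacobian_iso => [v v0|s]; last by rewrite inv /pm_char expr0 scale1r.
  have /(same_jacobianP hf nd) [_ [X [Y [_ XY e]]]] := jpq.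
  by rewrite -[v]mulmx1 -XY mulmxA (nd (v := v *m X)) ?mul0mx // -e.
- apply/same_jacobian_blocks; exists 1, (-1).
  by rewrite scale1r scaleN1r oppr_eq0 oner_eq0.
move=> s; rewrite form_actD form_actN; have [os|es] := boolP (odd_perm s).
  by have [-> ->] := odd_swap os; rewrite expr1 scaleN1r opprB.
by rewrite (even_invariant es) (even_invariant_q es) expr0 scale1r.
Qed.

End PartTwo.

Theorem theorem4p2 (R : realType) (n : nat) (hn : (5 <= n)%N)
    (la : seq nat) (hla : is_partition n la) (d : nat) (hd : (3 <= d)%N)
    (f : {mpoly R[i][specht_dim R[i] n la]})
    (hf : f \is d.-homog) (f_neq0 : f != 0)
    (hJ : jacobian_invariant (specht_repr R[i] n la) f) :
  let V := specht_repr R[i] n la in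
  (la <> conj_partition la ->
     exists b : bool,
     [/\ forall s : 'S_n, form_act V s f = pm_char b s *: f,
         jacobian_iso V f (pm_tensor V b),
         jacobian_iso V f
           (specht_repr R[i] n (if b then conj_partition la else la)) &
         forall h, same_jacobian d f h <-> exists2 a, a != 0 & h = a *: f])
  /\
  (la = conj_partition la ->
     forall Wp Wm ep em : 'M[R[i]]_(specht_dim R[i] n la),
     alternating_split V Wp Wm ->
     canonical_idempotents d f [:: ep; em] ->
     (ep :=: Wp)%MS -> (em :=: Wm)%MS ->
     forall p, is_twist d f ep p ->
     forall x y : 'I_n, x != y ->
     let q := form_act V (tperm x y) p in
     [/\ jacobian_iso V f V,
         forall h, same_jacobian d f h <->
           exists a b, [/\ a != 0, b != 0 & h = a *: p + b *: q],
         same_jacobian d f (p + q) /\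
           (forall s : 'S_n, form_act V s (p + q) = p + q) &
         same_jacobian d f (p - q) /\
           (forall s : 'S_n, form_act V s (p - q) = (-1) ^+ s *: (p - q))]).
Proof.
case: d hd f hf f_neq0 hJ => [|[|[|d]]] hd f hf f_neq0 hJ V; try discriminate hd.
have irrV := partition_irreducible R[i] hla; split=> [nsc|_].
  exact: (not_self_conjugate_case hn hla hf f_neq0 hJ nsc).
move=> Wp Wm ep em hW hcan epW emW p hp x y xy q.
exact: (self_conjugate_case hn irrV hf f_neq0 hJ hW hcan epW emW hp xy).
Qed.
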